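(* Let $0<p<1$. Then $E^p_c\neq E^1$; more precisely, the norm of $E^1$ and the norm of the Banach envelope $E^p_c$ are not equivalent on $E^p$ (which is contained in both $E^1$ and $E^p_c$).
   Context: An entire function $f$ is of exponential type $\tau>0$ if for every $\epsilon>0$ there is $C_\epsilon>0$ such that $|f(z)|\le C_\epsilon e^{(\tau+\epsilon)|z|}$ for all $z\in\mathbb{C}$. For $0<p<\infty$, $E^p$ is the space of entire functions $f$ of exponential type $\pi$ with $f|_{\mathbb{R}}\in L^p(\mathbb{R})$, equipped with $\|f\|_{E^p}=\left(\int_{-\infty}^\infty |f(x)|^p\,dx\right)^{1/p}$ (a norm for $p\ge 1$, a quasi-norm for $0<p<1$). One has $E^p\subset E^1$ for $0<p<1$. For a quasi-normed space $X$ with separating dual, the Banach envelope $X_c$ is the completion of $(X,\|\cdot\|_C)$, where $C$ is the convex hull of the closed unit ball of $X$ and $\|\cdot\|_C$ is the Minkowski functional of $C$. The completion $E^p_c$ is regarded as a space of entire functions via the extension of the inclusion of $E^p$ into the entire functions; its norm is equivalent to $\int_{\mathbb{C}} e^{-\pi |y|}|y|^{1/p-2}|f(x+iy)|\,dx\,dy$. *)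

(* Defs.v *)
From HB Require Import structures.
From mathcomp Require Import all_boot all_order all_algebra.
From mathcomp Require Import all_classical all_reals all_analysis.
From mathcomp Require Import complex.

Set Implicit Arguments.
Unset Strict Implicit.
Unset Printing Implicit Defensive.

Import Order.TTheory GRing.Theory Num.Theory.
Import numFieldNormedType.Exports.

Local Open Scope classical_set_scope.
Local Open Scope complex_scope.
Local Open Scope ring_scope.

Definition equivalent_norms_on (R : realType) (T : Type) (X : set T)
    (N1 N2 : T -> \bar R) : Prop :=
  exists a b : R, [/\ 0 < a, 0 < b & forall x, X x ->
    (a%:E * N1 x <= N2 x)%E /\ (N2 x <= b%:E * N1 x)%E].

Section BanachEnvelope.
Variables (R : realType) (V : lmodType R[i]).

(* The scalars of [convex_set] are the [l : R[i]] with [0 <= l <= 1]. In the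
   partial order of [R[i]] these are exactly the reals of [0, 1], so convexity
   is real convexity. *)
Definition convex_hull (A : set V) : set V :=
  smallest (@convex_set R[i] V) A.

(* Equal to [+oo] at the points that no positive dilate of [A] contains. *)
Definition minkowski_functional (A : set V) (x : V) : \bar R :=
  ereal_inf [set t%:E | t in [set t : R | 0 < t /\
                                         ((fun a : V => t%:C *: a) @` A) x]].

(* [X] is the carrier, a subspace of [V], of a quasi-normed space with quasi-norm
   [q]. *)
Definition envelope_norm (X : set V) (q : V -> \bar R) : V -> \bar R :=
  minkowski_functional (convex_hull [set x | X x /\ (q x <= 1)%E]).

Definition cauchy_for (N : V -> \bar R) (u : nat -> V) : Prop :=
  forall eps : R, 0 < eps -> exists n0 : nat, forall m n : nat,
    (n0 <= m)%N -> (n0 <= n)%N -> (N (u m - u n)%R < eps%:E)%E.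

End BanachEnvelope.

Section EntireFunctions.
Variable R : realType.
Local Notation C := R[i].

Definition entire (f : C -> C) : Prop :=
  forall z : C, derivable (f : C^o -> C^o) z 1.

(* "Of type tau" means of type at most tau. *)
Definition exponential_type (tau : R) (f : C -> C) : Prop :=
  forall eps : R, 0 < eps -> exists2 K : R, 0 < K &
    forall z : C, Normc.normc (f z) <= K * expR ((tau + eps) * Normc.normc z).

Definition Ep_norm (p : R) (f : C -> C) : \bar R :=
  Lnorm lebesgue_measure p%:E (fun x : R => (Normc.normc (f x%:C))%:E).

(* The restriction to R of an entire function is continuous, hence measurable:
   membership in L^p amounts to finiteness of the p-norm. *)
Definition Ep_space (p : R) : set (C -> C) :=
  [set f | [/\ entire f, exponential_type pi f & (Ep_norm p f < +oo)%E]].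

Definition Epc_norm (p : R) : (C -> C) -> \bar R :=
  envelope_norm (Ep_space p) (Ep_norm p).

(* The completion of [Ep_space p] for [Epc_norm p], as a space of entire
   functions: a class of Cauchy sequences is sent to its limit for uniform
   convergence on compact sets, which is the continuous extension of the
   inclusion of [Ep_space p] in the space of entire functions. On [Ep_space p]
   the norm of the completion is [Epc_norm p]. *)
Definition Epc_space (p : R) : set (C -> C) :=
  [set f | entire f /\ exists u : nat -> C^o -> C^o,
     [/\ forall n, Ep_space p (u n), cauchy_for (Epc_norm p) u &
         {family compact, u @ \oo --> (f : C^o -> C^o)}]].

End EntireFunctions.

(* Main.v *)
(* Evaluation at [i y] separates the two norms. For [f] in [E^p] the subharmonicity of
   [|f(z) exp (i pi z)|^p] in the upper half-plane, where this function has a harmonic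
   majorant with boundary values [|f|^p], gives [|f(i y)|^p <= C exp (p pi y) / y] as
   soon as [|f|_(E^p) <= 1]. The right-hand side defines a convex set of functions, so
   [exp (- pi y) |f(i y)| <= C y^(-1/p) |f|_(E^p_c)]. With
   [G(w) = ((exp (i w / N) - 1) / (i w / N))^N], the functions
   [f_e(z) = exp (- i pi z) e G(e z)] stay bounded in [E^1], whereas
   [exp (- pi y) f_e(i y) >= e exp (- 1)] at [y = 1/e]: their envelope norms are at least
   [c e^(1 - 1/p)]. The average of [exp (- i pi z) G(s z)] against [s^q ds] over [0, 1], with
   [0 < q < 1/p - 1], lies in [E^1] and decays like [y^(-1-q)] on the imaginary axis after
   division by [exp (pi y)], hence is not in the completion.

   Subharmonicity is used through sums over four points: if [F] has a second order Taylor
   expansion at [z], then [F(z + t) F(z - t) F(z + i t) F(z - i t) = F(z)^4 + o(t^2)], because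
   the fourth roots of unity have vanishing first two symmetric functions. Goursat's theorem
   provides such expansions for the primitives of an entire function, so that no Cauchy
   formula is needed. *)
Require Import Defs.
From mathcomp Require Import all_boot all_order all_algebra.
From mathcomp Require Import all_classical all_reals all_analysis.
From mathcomp Require Import measurable_realfun complex.
From mathcomp Require Import ring lra.

Set Implicit Arguments.
Unset Strict Implicit.
Unset Printing Implicit Defensive.

Import Order.TTheory GRing.Theory Num.Theory.
Import numFieldNormedType.Exports.

Local Open Scope classical_set_scope.
Local Open Scope complex_scope.
Local Open Scope ring_scope.
Local Notation nc := Normc.normc.

(** The half-plane bound is the delicate step: functions of exponential type have exactly the
    critical growth for an angle [pi], so the usual Phragmen-Lindelof damping factors fail there. A
    quarter-plane leaves room for one, and the bound is first proved on each of them with an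
    additive constant depending on [f]. This constant makes the top side of tall rectangles harmless
    once the exponent is slightly enlarged, and a second pass over the half-plane removes it,
    leaving only the boundary mass. The auxiliary parameters are chosen after the point [(x, y)], so
    that undoing the factor there costs at most [exp 1].

    On the envelope, evaluation at height [y] decays like [y^(-1/p)] after division by [exp (pi y)],
    whereas [E^1] only forces [1/y]. The gap [y^(1/p - 1)], unbounded because [p < 1], is what both
    counterexamples exploit.

    Integrals are differences of antiderivatives of continuous functions, hence oriented and
    additive by algebra. Lebesgue integrals serve to produce antiderivatives and to translate norms
    into boundary masses. *)

(** * The modulus of complex numbers *)

Section Modulus.
Variable R : realType.
Implicit Types z w : R[i].

Lemma nc_ge0 z : 0 <= nc z.
Proof. by case: z => a b; exact: sqrtr_ge0. Qed.

Lemma ncD z w : nc (z + w) <= nc z + nc w.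
Proof. exact: le_normcD. Qed.

Lemma ncN z : nc (- z) = nc z.
Proof. exact: normcN. Qed.

Lemma ncM z w : nc (z * w) = nc z * nc w.
Proof. exact: Normc.normcM. Qed.

Lemma nc0 : nc (0 : R[i]) = 0.
Proof. exact: Normc.normc0. Qed.

Lemma nc1 : nc (1 : R[i]) = 1.
Proof. exact: Normc.normc1. Qed.

Lemma ncV z : nc z^-1 = (nc z)^-1.
Proof. exact: Normc.normcV. Qed.

Lemma nc_eq0 z : (nc z == 0) = (z == 0).
Proof.
by apply/eqP/eqP => [/Normc.eq0_normc //|->]; exact: nc0.
Qed.

Lemma nc_gt0 z : (0 < nc z) = (z != 0).
Proof. by rewrite lt_def nc_ge0 andbT nc_eq0. Qed.

Lemma ncX z n : nc (z ^+ n) = nc z ^+ n.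
Proof. by elim: n => [|n ih]; rewrite ?expr0 ?nc1// !exprS ncM ih. Qed.

Lemma ncBC z w : nc (z - w) = nc (w - z).
Proof. by rewrite -ncN opprB. Qed.

Lemma ncB z w : nc (z - w) <= nc z + nc w.
Proof. by rewrite (le_trans (ncD _ _))// ncN. Qed.

Lemma ncB_ge z w : nc z - nc w <= nc (z - w).
Proof. by rewrite lerBlDr -{1}(subrK w z) ncD. Qed.

Lemma ncR (x : R) : nc x%:C = `|x|.
Proof. by rewrite /= expr0n addr0 sqrtr_sqr. Qed.

Lemma nci : nc ('i : R[i]) = 1.
Proof. by rewrite /= expr0n add0r expr1n sqrtr1. Qed.

Lemma nc_sqr z : nc z ^+ 2 = complex.Re z ^+ 2 + complex.Im z ^+ 2.
Proof. by case: z => a b; rewrite /= sqr_sqrtr// addr_ge0 ?sqr_ge0. Qed.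

Lemma Re_le_nc z : `|complex.Re z| <= nc z.
Proof. by case: z => a b; rewrite /= -sqrtr_sqr ler_wsqrtr// lerDl sqr_ge0. Qed.

Lemma Im_le_nc z : `|complex.Im z| <= nc z.
Proof. by case: z => a b; rewrite /= -sqrtr_sqr ler_wsqrtr// lerDr sqr_ge0. Qed.

Lemma complexRI (x y : R) : x +i* y = x%:C + 'i * y%:C.
Proof. by rewrite {1}(complexE (x +i* y)). Qed.

Lemma nc_le_ReIm z : nc z <= `|complex.Re z| + `|complex.Im z|.
Proof.
by case: z => a b; rewrite complexRI (le_trans (ncD _ _))// ncM nci !ncR mul1r /= ?(addr0,mulr0,mul0r,subr0,mul1r,add0r).
Qed.

Lemma ReD z w : complex.Re (z + w) = complex.Re z + complex.Re w.
Proof. by case: z; case: w. Qed.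

Lemma ImD z w : complex.Im (z + w) = complex.Im z + complex.Im w.
Proof. by case: z; case: w. Qed.

Lemma ReN z : complex.Re (- z) = - complex.Re z.
Proof. by case: z. Qed.

Lemma ImN z : complex.Im (- z) = - complex.Im z.
Proof. by case: z. Qed.

Lemma ReM z w : complex.Re (z * w) =
  complex.Re z * complex.Re w - complex.Im z * complex.Im w.
Proof. by case: z; case: w. Qed.

Lemma ImM z w : complex.Im (z * w) =
  complex.Re z * complex.Im w + complex.Im z * complex.Re w.
Proof. by case: z => a b; case: w. Qed.

Lemma cplx_eta z : complex.Re z +i* complex.Im z = z.
Proof. by case: z. Qed.

End Modulus.

(** * Complex differentiability in epsilon form *)

Section ComplexDifferentiability.
Variable R : realType.
Implicit Types (f g : R[i] -> R[i]) (z w h d : R[i]).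

(** The difference quotient is multiplied out, so that [h = 0] is included and the triangle
    inequality applies without division. *)
Definition cderiv f z d := forall e : R, 0 < e -> exists2 r : R, 0 < r &
  forall h, nc h < r -> nc (f (z + h) - f z - d * h) <= e * nc h.

(** Balls of [R[i]^o] have their radii in [R[i]]. A positive element of [R[i]] is a positive real,
    so its real part is a radius for the real-valued modulus. *)
Lemma nbhs0_ncP (P : R[i] -> Prop) :
  (\forall h \near (0 : R[i]^o), P h) <-> exists2 r : R, 0 < r & forall h, nc h < r -> P h.
Proof.
split.
- move=> /nbhs_ballP [e /= e0 He]; exists (complex.Re e).
    by move: e0; case: (e) => a b; rewrite ltcE /= => /andP[].
  move=> h hr; apply: He; rewrite -ball_normE /= sub0r normrN.
  move: e0 hr; case: (e) => a b; rewrite ltcE /= => /andP[/eqP b0 a0] hr.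
  by rewrite ltcE /= -b0 eqxx.
- move=> [r r0 Hr]; apply/nbhs_ballP; exists r%:C.
    by rewrite /= ltcR.
  by move=> h; rewrite -ball_normE /= sub0r normrN ltcR => /Hr.
Qed.

Lemma entireP f : entire f <-> forall z, exists d, cderiv f z d.
Proof.
split=> H z.
- have /cvg_ex [/= d Hd] := H z; exists d => e e0.
  move/cvgrPdist_lt : Hd => /(_ e%:C); rewrite ltcR => /(_ e0).
  rewrite near_withinE => /nbhs0_ncP [r r0 Hr].
  exists r => // h hr; have [->|h0] := eqVneq h 0.
    by rewrite addr0 subrr sub0r mulr0 oppr0 nc0 mulr0.
  have := Hr _ hr h0; rewrite ltcR => /ltW {}Hr.
  rewrite -(ler_pM2r (x := (nc h)^-1)) ?invr_gt0 ?nc_gt0// mulfK ?nc_eq0//.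
  rewrite -ncV -ncM; apply: le_trans Hr; rewrite [leRHS]ncBC.
  rewrite le_eqVlt; apply/orP; left; apply/eqP; congr (nc _).
  rewrite /GRing.scale /= mulr1 (addrC h z); field; exact: h0.
- have [d Hd] := H z; apply/cvg_ex; exists d; apply/cvgrPdist_lt => e.
  rewrite ltcE /= => /andP[/eqP e0 e1].
  rewrite near_withinE; apply/nbhs0_ncP.
  have [r r0 Hr] := Hd (complex.Re e / 2) (divr_gt0 e1 (ltr0n _ 2)).
  exists r => // h hr h0; rewrite -[e]cplx_eta e0 ltcR.
  apply: (@le_lt_trans _ _ (complex.Re e / 2)); last by lra.
  have := Hr _ hr; rewrite -ler_pdivrMr ?nc_gt0// -ncV -ncM; apply: le_trans.
  rewrite le_eqVlt; apply/orP; left; apply/eqP; rewrite ncBC; congr (nc _).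
  rewrite /GRing.scale /= mulr1 (addrC h z); field; exact: h0.
Qed.

Lemma cderiv_cont f z d : cderiv f z d -> forall e : R, 0 < e ->
  exists2 r : R, 0 < r & forall h, nc h < r -> nc (f (z + h) - f z) <= e.
Proof.
move=> Hf e e0; have [r r0 Hr] := Hf 1 ltr01.
have n1 : 0 < nc d + 1 by have := nc_ge0 d; lra.
exists (Num.min r (e / (nc d + 1))); first by rewrite lt_min r0 divr_gt0.
move=> h; rewrite lt_min => /andP[/Hr h1]; rewrite ltr_pdivlMr// => h2.
rewrite -(subrK (d * h) (f (z + h) - f z)) (le_trans (ncD _ _))// ncM.
by rewrite mul1r in h1; lra.
Qed.

Lemma cderivD f g z a b :
  cderiv f z a -> cderiv g z b -> cderiv (fun w => f w + g w) z (a + b).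
Proof.
move=> Hf Hg e e0; have e2 : 0 < e / 2 by lra.
have [r r0 Hr] := Hf _ e2; have [s s0 Hs] := Hg _ e2.
exists (Num.min r s); first by rewrite lt_min r0.
move=> h; rewrite lt_min => /andP[/Hr h1 /Hs h2].
rewrite [X in nc X](_ : _ =
  (f (z + h) - f z - a * h) + (g (z + h) - g z - b * h)); last by ring.
by rewrite (le_trans (ncD _ _))//; lra.
Qed.

Lemma cderivM f g z a b : cderiv f z a -> cderiv g z b ->
  cderiv (fun w => f w * g w) z (a * g z + f z * b).
Proof.
move=> Hf Hg e e0.
pose K := nc (f z) + nc (g z) + nc b + 1.
have K0 : 0 < K by rewrite /K; have := nc_ge0 (f z); have := nc_ge0 (g z); have := nc_ge0 b; lra.
have e3 : 0 < Num.min 1 (e / (3 * K)) by rewrite lt_min ltr01 divr_gt0// mulr_gt0.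
have [r r0 Hr] := Hf _ e3; have [s s0 Hs] := Hg _ e3.
have [t t0 Ht] := cderiv_cont Hf e3.
exists (Num.min r (Num.min s t)); first by rewrite !lt_min r0 s0.
move=> h; rewrite !lt_min => /and3P[/Hr h1 /Hs h2 /Ht h3].
rewrite [X in nc X](_ : _ =
  (f (z + h) - f z) * (g (z + h) - g z - b * h) + (f (z + h) - f z) * (b * h)
  + (f (z + h) - f z - a * h) * g z + f z * (g (z + h) - g z - b * h)); last by ring.
apply: (le_trans (ncD _ _)); rewrite ncM.
apply: (le_trans (lerD (ncD _ _) (lexx _))); rewrite ncM.
apply: (le_trans (lerD (lerD (ncD _ _) (lexx _)) (lexx _))); rewrite !ncM.
set m := Num.min _ _ in h1 h2 h3 e3.
have m1 : m <= 1 by rewrite ge_min lexx.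
have m2 : m * (3 * K) <= e by rewrite -ler_pdivlMr ?mulr_gt0// ge_min lexx orbT.
have A := nc_ge0 h.
have B1 : nc (f (z + h) - f z) * nc (g (z + h) - g z - b * h) <= 1 * (m * nc h).
  by apply: ler_pM; rewrite ?nc_ge0// (le_trans h3).
have B2 : nc (f (z + h) - f z) * (nc b * nc h) <= m * (nc b * nc h).
  by apply: ler_wpM2r => //; rewrite mulr_ge0// nc_ge0.
have B3 : nc (f (z + h) - f z - a * h) * nc (g z) <= m * nc h * nc (g z).
  by apply: ler_wpM2r => //; rewrite nc_ge0.
have B4 : nc (f z) * nc (g (z + h) - g z - b * h) <= nc (f z) * (m * nc h).
  by apply: ler_wpM2l => //; rewrite nc_ge0.
have B5 : m * K * nc h <= e * nc h.
  apply: ler_wpM2r => //; have : 0 <= m * K by rewrite mulr_ge0// ltW.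
  lra.
rewrite /K in B5; nra.
Qed.

Lemma cderiv_id z : cderiv id z 1.
Proof.
move=> e e0; exists 1 => // h _.
rewrite (_ : _ - _ = 0) ?nc0 ?mulr_ge0 ?nc_ge0 ?ltW//; ring.
Qed.

Lemma cderiv_cst c z : cderiv (fun=> c) z 0.
Proof.
move=> e e0; exists 1 => // h _.
rewrite (_ : _ - _ = 0) ?nc0 ?mulr_ge0 ?nc_ge0 ?ltW//; ring.
Qed.

Lemma cderiv_comp f g z a b : cderiv f z a -> cderiv g (f z) b ->
  cderiv (g \o f) z (b * a).
Proof.
move=> Hf Hg e e0.
pose K := nc a + nc b + 1.
have K0 : 0 < K by rewrite /K; have := nc_ge0 a; have := nc_ge0 b; lra.
have m0 : 0 < Num.min 1 (e / (2 * K)) by rewrite lt_min ltr01 divr_gt0// mulr_gt0.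
set m := Num.min _ _ in m0.
have m1 : m <= 1 by rewrite ge_min lexx.
have m2 : m * (2 * K) <= e by rewrite -ler_pdivlMr ?mulr_gt0// ge_min lexx orbT.
have [s s0 Hs] := Hg _ m0.
have [r r0 Hr] := Hf _ m0; have [t t0 Ht] := cderiv_cont Hf (divr_gt0 s0 (ltr0n _ 2)).
exists (Num.min r t); first by rewrite !lt_min r0.
move=> h; rewrite !lt_min => /andP[/Hr h1 /Ht h3].
have /Hs {Hs} : nc (f (z + h) - f z) < s by apply: le_lt_trans h3 _; lra.
rewrite subrKC => h2 /=.
rewrite [X in nc X](_ : _ =
  (g (f (z + h)) - g (f z) - b * (f (z + h) - f z)) +
  b * (f (z + h) - f z - a * h)); last by ring.
apply: (le_trans (ncD _ _)); rewrite ncM.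
have h4 : nc (f (z + h) - f z) <= nc h * (nc a + 1).
  rewrite -(subrK (a * h) (f (z + h) - f z)) (le_trans (ncD _ _))// ncM.
  have := nc_ge0 h; nra.
have A := nc_ge0 h.
have B1 : nc b * nc (f (z + h) - f z - a * h) <= nc b * (m * nc h).
  by apply: ler_wpM2l => //; rewrite nc_ge0.
have B2 : m * nc (f (z + h) - f z) <= m * (nc h * (nc a + 1)).
  by apply: ler_wpM2l => //; rewrite ltW.
have B5 : m * K * nc h <= e * nc h.
  apply: ler_wpM2r => //; have : 0 <= m * K by rewrite mulr_ge0// ltW.
  lra.
rewrite /K in B5; lra.
Qed.

Lemma entireD f g : entire f -> entire g -> entire (fun z => f z + g z).
Proof.
move=> /entireP Hf /entireP Hg; apply/entireP => z.
have [a Ha] := Hf z; have [b Hb] := Hg z.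
by exists (a + b); exact: cderivD.
Qed.

Lemma entireM f g : entire f -> entire g -> entire (fun z => f z * g z).
Proof.
move=> /entireP Hf /entireP Hg; apply/entireP => z.
have [a Ha] := Hf z; have [b Hb] := Hg z.
by exists (a * g z + f z * b); exact: cderivM.
Qed.

Lemma entire_comp f g : entire f -> entire g -> entire (g \o f).
Proof.
move=> /entireP Hf /entireP Hg; apply/entireP => z.
have [a Ha] := Hf z; have [b Hb] := Hg (f z).
by exists (b * a); exact: cderiv_comp.
Qed.

Lemma entire_id : entire (id : R[i] -> R[i]).
Proof. by apply/entireP => z; exists 1; exact: cderiv_id. Qed.

Lemma entire_cst (c : R[i]) : entire (fun _ : R[i] => c).
Proof. by apply/entireP => z; exists 0; exact: cderiv_cst. Qed.

Lemma entire_cont f : entire f -> forall z (e : R), 0 < e ->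
  exists2 r : R, 0 < r & forall h, nc h < r -> nc (f (z + h) - f z) <= e.
Proof. by move=> /entireP Hf z; have [d] := Hf z; exact: cderiv_cont. Qed.

End ComplexDifferentiability.

(** * Antiderivatives of continuous real functions *)

Section Antiderivatives.
Variable R : realType.
Implicit Types (f g F G : R -> R) (a b x y : R).

Lemma is_derive_continuous F x d : is_derive x 1 F d -> {for x, continuous F}.
Proof.
by move=> /@ex_derive /derivable1_diffP; exact: differentiable_continuous.
Qed.

Lemma derive_ge0_le F f a b : a <= b ->
  (forall x, a < x < b -> is_derive x 1 F (f x)) ->
  {within `[a, b], continuous F} ->
  (forall x, a < x < b -> 0 <= f x) -> F a <= F b.
Proof.
rewrite le_eqVlt => /predU1P[-> //|ab] Ff cF f0; rewrite -subr_ge0.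
have [c cab ->] : exists2 c, c \in `]a, b[%R & F b - F a = f c * (b - a).
  by apply: MVT => // x; rewrite in_itv => /Ff.
by rewrite mulr_ge0 ?subr_ge0 ?(ltW ab)//; apply: f0; move: cab; rewrite in_itv.
Qed.

Lemma derive_le F f G g a b : a <= b ->
  (forall x, is_derive x 1 F (f x)) -> (forall x, is_derive x 1 G (g x)) ->
  (forall x, a <= x <= b -> f x <= g x) -> F b - F a <= G b - G a.
Proof.
move=> ab Ff Gg fg.
suff : (G - F) a <= (G - F) b by rewrite !fctE; lra.
apply: (@derive_ge0_le (G - F) (fun x => g x - f x)) => //.
- apply: continuous_subspaceT => x; apply: is_derive_continuous; exact: is_deriveB.
- by move=> x /andP[/ltW h1 /ltW h2]; rewrite subr_ge0 fg// h1.
Qed.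

Lemma derive_dist F f G g a b e : a <= b ->
  (forall x, is_derive x 1 F (f x)) -> (forall x, is_derive x 1 G (g x)) ->
  (forall x, a <= x <= b -> `|f x - g x| <= e) ->
  `|(F b - F a) - (G b - G a)| <= e * (b - a).
Proof.
move=> ab Ff Gg fg.
have De (s : R) x : is_derive x 1 (s \*: (id : R -> R)) s.
  by apply: is_derive_eq; rewrite /GRing.scale /= mulr1.
rewrite ler_norml; apply/andP; split.
- have := @derive_le (G + ((- e) \*: (id : R -> R))) (fun x => g x - e) F f a b ab.
  rewrite !fctE /GRing.scale /= => H.
  suff : G b + - e * b - (G a + - e * a) <= F b - F a by lra.
  apply: H => // x /fg.
  by rewrite ler_norml; lra.
- have := @derive_le F f (G + (e \*: (id : R -> R))) (fun x => g x + e) a b ab.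
  rewrite !fctE /GRing.scale /= => H.
  suff : F b - F a <= G b + e * b - (G a + e * a) by lra.
  apply: H => // x /fg.
  by rewrite ler_norml; lra.
Qed.

Lemma local_antiderivative f a : continuous f ->
  exists F, forall x, a < x -> is_derive x 1 F (f x).
Proof.
move=> cf; exists (fun x => (\int[lebesgue_measure]_(t in `[a, x]) f t)%R) => x ax.
have x1 : x < x + 1 by lra.
have [] := @continuous_FTC1_closed R f a x (x + 1) x1 _ ax (cf x).
  apply: continuous_compact_integrable; first exact: segment_compact.
  exact: continuous_subspaceT.
by move=> H <-; rewrite derive1E; exact: derivableP.
Qed.

Lemma antiderivative f : continuous f -> exists F, forall x, is_derive x 1 F (f x).
Proof.
move=> cf; have [L HL] := choice (fun a => local_antiderivative a cf).
(* [L a] is an antiderivative only to the right of [a], so the base point moves with [x] to stay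
   below both [x] and [0]. Normalizing at [0] makes the different choices agree; the single base
   point [c] below serves all [y] at distance less than 1 from [x]. *)
pose F x := L (- `|x| - 1) x - L (- `|x| - 1) 0.
exists F => x.
pose c := - `|x| - 2.
have Lx : is_derive x 1 (fun y => L c y - L c 0) (f x).
  have Lcx : is_derive x 1 (L c) (f x).
    by apply: HL; rewrite /c; have := ler_norm (- x); rewrite normrN; lra.
  by rewrite -[f x]subr0; have := is_deriveB Lcx (is_derive_cst (L c 0) x 1).
apply: near_eq_is_derive Lx.
have : \forall y \near x, `|x - y| < 1.
  by apply/nbhs_ballP; exists 1 => //= y; rewrite -ball_normE.
apply: filterS => y xy; rewrite /F.
set d := - `|y| - 1.
have cd : c < d.
  have : `|y| < `|x| + 1; last by rewrite /c /d; lra.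
  by rewrite -(subrK x y) (le_lt_trans (ler_normD _ _))// distrC; lra.
have d0 : d < 0 by rewrite /d; have := normr_ge0 y; lra.
have dy : d < y by rewrite /d; have := ler_norm (- y); rewrite normrN; lra.
have Hz u v : d < u -> u <= v -> L c u - L d u = L c v - L d v.
  move=> du uv.
  have Hd w : u <= w -> is_derive w 1 (L c - L d) 0.
    move=> uw.
    have h1 : is_derive w 1 (L c) (f w) by apply: HL; lra.
    have h2 : is_derive w 1 (L d) (f w) by apply: HL; lra.
    by rewrite -(subrr (f w)); exact: is_deriveB.
  have cw : {within `[u, v], continuous (L c - L d)}.
    apply: continuous_in_subspaceT => w; rewrite inE /= in_itv /= => /andP[uw _].
    exact: (is_derive_continuous (Hd _ uw)).
  have Hd' w : w \in `]u, v[ -> is_derive w 1 (L c - L d) 0.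
    by rewrite in_itv /= => /andP[/ltW uw _]; exact: Hd.
  have [w _] := @MVT_segment _ (L c - L d) (fun=> 0) u v uv Hd' cw.
  by rewrite mul0r !fctE; lra.
have [y0|y0] := leP 0 y.
  by have := Hz 0 y d0 y0; lra.
by have := Hz y 0 dy (ltW y0); lra.
Qed.

(* Junk when [f] has no antiderivative. *)
Definition prim f : R -> R := get [set F | forall x, is_derive x 1 F (f x)].

Lemma primP f : continuous f -> forall x, is_derive x 1 (prim f) (f x).
Proof.
move=> cf; rewrite /prim; case: xgetP => [F -> //|].
by have [F HF] := antiderivative cf => /(_ F).
Qed.

Lemma prim_mono f a b : continuous f -> (forall x, a <= x <= b -> 0 <= f x) ->
  a <= b -> prim f a <= prim f b.
Proof.
move=> cf f0 ab; rewrite -subr_ge0 -(subrr ((cst 0 : R -> R) a)).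
rewrite -[X in X - _]/((cst 0 : R -> R) b).
by apply: (derive_le ab _ (primP cf) f0).
Qed.

End Antiderivatives.
(** * Primitives of entire functions *)

Section Bisection.
Variable R : realType.

Lemma lt_half_pow (w d : R) : 0 < d -> exists n, w / 2 ^+ n < d.
Proof.
move=> d0; exists (Num.bound `|w / d|).
rewrite ltr_pdivrMr ?exprn_gt0// mulrC -ltr_pdivrMr//.
apply: (le_lt_trans (ler_norm _)).
apply: (lt_trans (archi_boundP (normr_ge0 _))).
by rewrite -natrX ltr_nat ltn_expl.
Qed.

Lemma nested_point (xs : nat -> R) (w : R) : 0 <= w ->
  (forall n, exists2 b : bool, true & xs n.+1 = xs n + b%:R * (w / 2 ^+ n.+1)) ->
  exists u, forall n, xs n <= u <= xs n + w / 2 ^+ n.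
Proof.
move=> w0 H.
have wn n : 0 <= w / 2 ^+ n by rewrite divr_ge0// exprn_ge0.
have step n : xs n <= xs n.+1 <= xs n + w / 2 ^+ n - w / 2 ^+ n.+1.
  have := wn n.+1.
  have -> : w / 2 ^+ n = 2 * (w / 2 ^+ n.+1).
    by rewrite exprS invfM; field; rewrite expf_neq0.
  by have [[] _ ->] := H n; rewrite /= ?mul0r ?mul1r; lra.
have nest n k : xs n <= xs (n + k)%N <= xs n + w / 2 ^+ n - w / 2 ^+ (n + k).
  elim: k => [|k ih]; first by rewrite addn0; lra.
  by rewrite addnS; have := step (n + k)%N; lra.
have nest' n m : xs m <= xs n + w / 2 ^+ n.
  have [nm|mn] := leP n m.
    by have := nest n (m - n)%N; rewrite subnKC//; have := wn m; lra.
  by have := nest m (n - m)%N; rewrite subnKC ?(ltnW mn)//; have := wn n; lra.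
(* By [nest'] every right endpoint bounds all the left endpoints, so their supremum lies in every
   interval. *)
exists (sup (range xs)) => n; apply/andP; split.
  apply: ub_le_sup; last by exists n.
  by exists (xs n + w / 2 ^+ n) => _ [m _ <-].
by apply: ge_sup => [|_ [m _ <-] //]; exists (xs 0%N), 0%N.
Qed.

(** Compactness as an induction principle: a bad rectangle has a bad quarter, and nested bad
    quarters shrink to a point where the local hypothesis is violated. Only subrectangles with the
    original proportions occur, hence the dyadic form of that hypothesis. *)
Lemma bisection (P : R -> R -> R -> R -> Prop) (x0 y0 w h : R) :
  0 <= w -> 0 <= h ->
  (forall x y w h, 0 <= w -> 0 <= h ->
    P x y (w / 2) (h / 2) -> P (x + w / 2) y (w / 2) (h / 2) ->
    P x (y + h / 2) (w / 2) (h / 2) -> P (x + w / 2) (y + h / 2) (w / 2) (h / 2) ->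
    P x y w h) ->
  (forall u v, x0 <= u <= x0 + w -> y0 <= v <= y0 + h ->
    exists2 d : R, 0 < d & forall x y n, w / 2 ^+ n < d -> h / 2 ^+ n < d ->
      x <= u <= x + w / 2 ^+ n -> y <= v <= y + h / 2 ^+ n ->
      P x y (w / 2 ^+ n) (h / 2 ^+ n)) ->
  P x0 y0 w h.
Proof.
move=> w0 h0 Hc Hl; apply: contrapT => nP.
pose bad n (p : R * R) := ~ P p.1 p.2 (w / 2 ^+ n) (h / 2 ^+ n).
have wn n : 0 <= w / 2 ^+ n by rewrite divr_ge0// exprn_ge0.
have hn n : 0 <= h / 2 ^+ n by rewrite divr_ge0// exprn_ge0.
have half (v : R) n : v / 2 ^+ n / 2 = v / 2 ^+ n.+1.
  by rewrite exprS invfM; field; rewrite expf_neq0.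
(* Badness is a premise under the existential, so that [choice] applies to a relation that is total
   on all levels and corners. *)
have step (q : nat * (R * R)) : exists p' : R * R, bad q.1 q.2 ->
  bad q.1.+1 p' /\ exists b1 b2 : bool,
   p' = (q.2.1 + b1%:R * (w / 2 ^+ q.1.+1), q.2.2 + b2%:R * (h / 2 ^+ q.1.+1)).
  case: q => n [x y] /=.
  have [|] := pselect (bad n (x, y)); last by exists (x, y).
  move=> nb; have Hq := Hc x y _ _ (wn n) (hn n).
  rewrite !half in Hq.
  have [|q1] := pselect (bad n.+1 (x, y)).
    exists (x, y) => _; split => //; exists false, false.
    by rewrite /= !mul0r !addr0.
  have [|q2] := pselect (bad n.+1 (x + w / 2 ^+ n.+1, y)).
    exists (x + w / 2 ^+ n.+1, y) => _; split => //; exists true, false.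
    by rewrite /= !mul0r !addr0 mul1r.
  have [|q3] := pselect (bad n.+1 (x, y + h / 2 ^+ n.+1)).
    exists (x, y + h / 2 ^+ n.+1) => _; split => //; exists false, true.
    by rewrite /= !mul0r !addr0 mul1r.
  have [|q4] := pselect (bad n.+1 (x + w / 2 ^+ n.+1, y + h / 2 ^+ n.+1)).
    exists (x + w / 2 ^+ n.+1, y + h / 2 ^+ n.+1) => _; split => //.
    by exists true, true; rewrite /= !mul1r.
  by exfalso; apply: nb; apply: Hq; apply: contrapT.
have [s Hs] := choice step.
pose c := fix c n := if n is m.+1 then s (m, c m) else (x0, y0).
have badc n : bad n (c n).
  elim: n => [|n ih]; first by rewrite /bad /= !expr0 !divr1.
  by have [] := Hs (n, c n) ih.
have [u Hu] : exists u, forall n, (c n).1 <= u <= (c n).1 + w / 2 ^+ n.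
  apply: (@nested_point (fun n => (c n).1)) => // n.
  by have [_ [b1 [b2 /= ->]]] := Hs (n, c n) (badc n); exists b1.
have [v Hv] : exists v, forall n, (c n).2 <= v <= (c n).2 + h / 2 ^+ n.
  apply: (@nested_point (fun n => (c n).2)) => // n.
  by have [_ [b1 [b2 /= ->]]] := Hs (n, c n) (badc n); exists b2.
have [d d0 Hd] : exists2 d : R, 0 < d & forall x y n, w / 2 ^+ n < d -> h / 2 ^+ n < d ->
      x <= u <= x + w / 2 ^+ n -> y <= v <= y + h / 2 ^+ n ->
      P x y (w / 2 ^+ n) (h / 2 ^+ n).
  apply: Hl; first by have := Hu 0%N; rewrite expr0 divr1.
  by have := Hv 0%N; rewrite expr0 divr1.
have [n Hn] := lt_half_pow (w + h) d0.
rewrite mulrDl in Hn.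
apply: (badc n); apply: Hd => //; have := wn n; have := hn n; lra.
Qed.

End Bisection.

(** * Goursat's theorem and primitives *)

Section Goursat.
Variable R : realType.
Implicit Types (f : R[i] -> R[i]) (g : R -> R[i]) (z d : R[i]) (a b x y w h s t e r : R).

Definition ccont g :=
  continuous (@complex.Re R \o g) /\ continuous (@complex.Im R \o g).

(** The oriented integral of [g]: additivity and reversal hold by algebra, without any order on the
    endpoints. *)
Definition cint g a b : R[i] :=
  (prim (@complex.Re R \o g) b - prim (@complex.Re R \o g) a) +i*
  (prim (@complex.Im R \o g) b - prim (@complex.Im R \o g) a).

Lemma cintD g a b c : cint g a b + cint g b c = cint g a c.
Proof. by rewrite /cint; apply/eqP; rewrite eq_complex /=; apply/andP; split; apply/eqP; ring. Qed.

Lemma cintN g a b : cint g b a = - cint g a b.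
Proof. by rewrite /cint; apply/eqP; rewrite eq_complex /=; apply/andP; split; apply/eqP; ring. Qed.

(* The factor [2] comes from treating the real and imaginary parts separately. *)
Lemma complex_mvt (G H g h : R -> R[i]) a b e : a <= b ->
  (forall t, is_derive t 1 (@complex.Re R \o G) (complex.Re (g t))) ->
  (forall t, is_derive t 1 (@complex.Im R \o G) (complex.Im (g t))) ->
  (forall t, is_derive t 1 (@complex.Re R \o H) (complex.Re (h t))) ->
  (forall t, is_derive t 1 (@complex.Im R \o H) (complex.Im (h t))) ->
  (forall t, a <= t <= b -> nc (g t - h t) <= e) ->
  nc ((G b - G a) - (H b - H a)) <= 2 * e * (b - a).
Proof.
move=> ab Gr Gi Hr Hi He.
have A : `|complex.Re ((G b - G a) - (H b - H a))| <= e * (b - a).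
  rewrite !(ReD, ReN); apply: (derive_dist ab Gr Hr) => t tab.
  by rewrite -ReN -ReD (le_trans (Re_le_nc _))// He.
have B : `|complex.Im ((G b - G a) - (H b - H a))| <= e * (b - a).
  rewrite !(ImD, ImN); apply: (derive_dist ab Gi Hi) => t tab.
  by rewrite -ImN -ImD (le_trans (Im_le_nc _))// He.
by apply: (le_trans (nc_le_ReIm _)); lra.
Qed.

Lemma cint_near g (H h : R -> R[i]) a b e : a <= b -> ccont g ->
  (forall t, is_derive t 1 (@complex.Re R \o H) (complex.Re (h t))) ->
  (forall t, is_derive t 1 (@complex.Im R \o H) (complex.Im (h t))) ->
  (forall t, a <= t <= b -> nc (g t - h t) <= e) ->
  nc (cint g a b - (H b - H a)) <= 2 * e * (b - a).
Proof.
move=> ab [cr ci] Hr Hi He.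
exact: (@complex_mvt (fun t => prim (@complex.Re R \o g) t +i* prim (@complex.Im R \o g) t)
  H g h a b e ab (primP cr) (primP ci) Hr Hi He).
Qed.

(** The subtracted term is the exact integral of the affine approximation. Both orders of [a] and
    [b] are covered because Taylor expansions involve displacements of either sign. *)
Lemma cint_affine g z d a b e : ccont g ->
  (forall t, (a <= t <= b) || (b <= t <= a) -> nc (g t - (z + d * (t - a)%:C)) <= e) ->
  nc (cint g a b - (z * (b - a)%:C + d * ((b - a) ^+ 2 / 2)%:C)) <= 2 * e * `|b - a|.
Proof.
move=> cg He.
pose H (t : R) := z * (t - a)%:C + d * ((t - a) ^+ 2 / 2)%:C.
have dsq (t : R) : is_derive t 1 (fun t : R => (t - a) ^+ 2 / 2) (t - a).
  by apply: is_derive_eq; rewrite /GRing.scale /=; lra.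
have dl (t : R) : is_derive t 1 (fun t : R => t - a) 1.
  by apply: is_derive_eq; rewrite subr0.
have HR t : is_derive t 1 (@complex.Re R \o H) (complex.Re (z + d * (t - a)%:C)).
  rewrite (_ : @complex.Re R \o H = fun t => complex.Re z * (t - a) + complex.Re d * ((t - a) ^+ 2 / 2)).
    by apply: is_derive_eq; rewrite ReD ReM /GRing.scale /=; ring.
  by apply/funext => u; rewrite /= ReD !ReM /=; ring.
have HI t : is_derive t 1 (@complex.Im R \o H) (complex.Im (z + d * (t - a)%:C)).
  rewrite (_ : @complex.Im R \o H = fun t => complex.Im z * (t - a) + complex.Im d * ((t - a) ^+ 2 / 2)).
    by apply: is_derive_eq; rewrite ImD ImM /GRing.scale /=; ring.
  by apply/funext => u; rewrite /= ImD !ImM /=; ring.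
have Ha : H a = 0 by rewrite /H subrr expr0n /= mul0r !mulr0 addr0.
have [ab|/ltW ba] := leP a b.
- rewrite -[X in _ - X]/(H b) -[H b]subr0 -Ha (ger0_norm (_ : 0 <= b - a)) ?subr_ge0//.
  apply: (cint_near ab cg HR HI) => t tab; apply: He.
  by rewrite tab.
- rewrite -[X in _ - X]/(H b) -ncN (_ : - _ = cint g b a - (H a - H b)); last first.
    by rewrite (cintN g a b) Ha; ring.
  rewrite ler0_norm ?subr_le0// (opprB b a).
  apply: (cint_near ba cg HR HI) => t tab; apply: He.
  by rewrite tab orbT.
Qed.

Definition hpath f y : R -> R[i] := fun t => f (t +i* y).
Definition vpath f x : R -> R[i] := fun t => f (x +i* t).

Lemma ccont_line f (l : R -> R[i]) : entire f ->
  (forall s t, nc (l t - l s) <= `|t - s|) -> ccont (f \o l).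
Proof.
move=> ef Hl.
have K s e : 0 < e -> exists2 r : R, 0 < r & forall t, `|s - t| < r -> nc (f (l t) - f (l s)) < e.
  move=> e0; have [r r0 Hr] := entire_cont ef (l s) (divr_gt0 e0 (ltr0n _ 2)).
  exists r => // t st; apply: (@le_lt_trans _ _ (e / 2)); last by lra.
  have := Hr (l t - l s); rewrite subrKC; apply.
  by rewrite (le_lt_trans (Hl _ _))// distrC.
split => s; apply/cvgrPdist_lt => e e0; have [r r0 Hr] := K s e e0;
  apply/nbhs_ballP; exists r => //= t /Hr st.
- by rewrite distrC -ReN -ReD (le_lt_trans (Re_le_nc _)).
- by rewrite distrC -ImN -ImD (le_lt_trans (Im_le_nc _)).
Qed.

Lemma ccont_hpath f y : entire f -> ccont (hpath f y).
Proof.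
move=> ef; apply: (@ccont_line f (fun t => t +i* y)) => // s t.
by rewrite (_ : _ - _ = (t - s)%:C) ?ncR//; apply/eqP; rewrite eq_complex /= subrr !eqxx.
Qed.

Lemma ccont_vpath f x : entire f -> ccont (vpath f x).
Proof.
move=> ef; apply: (@ccont_line f (fun t => x +i* t)) => // s t.
by rewrite (_ : _ - _ = 'i * (t - s)%:C) ?ncM ?nci ?mul1r ?ncR// !complexRI; ring.
Qed.

Definition rect_int f x y w h : R[i] :=
  cint (hpath f y) x (x + w) + 'i * cint (vpath f (x + w)) y (y + h)
  - 'i * cint (vpath f x) y (y + h) - cint (hpath f (y + h)) x (x + w).

(** The affine part of [f] integrates to zero around the rectangle. The remainder, at most
    [e (w + h)] in modulus, contributes [2 e (w + h)] times the length of each side, and the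
    perimeter is [2 (w + h)]. *)
Lemma rect_int_small f z d e r x y w h : entire f ->
  (forall k, nc k < r -> nc (f (z + k) - f z - d * k) <= e * nc k) ->
  0 <= e -> 0 <= w -> 0 <= h -> w + h < r ->
  x <= complex.Re z <= x + w -> y <= complex.Im z <= y + h ->
  nc (rect_int f x y w h) <= 4 * e * (w + h) ^+ 2.
Proof.
move=> ef Hf e0 w0 h0 whr; case: z Hf => u v Hf; rewrite [complex.Re (_ +i* _)]/= [complex.Im (_ +i* _)]/= => uw vh.
have whe : 0 <= e * (w + h) by rewrite mulr_ge0// addr_ge0.
have near s t : x <= s <= x + w -> y <= t <= y + h ->
    nc (f (s +i* t) - (f (u +i* v) + d * ((s - u) +i* (t - v)))) <= e * (w + h).
  move=> sw th.
  have kw : nc ((s - u) +i* (t - v)) <= w + h.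
    apply: (le_trans (nc_le_ReIm _)) => /=.
    by apply: lerD; rewrite ler_norml; lra.
  have := Hf ((s - u) +i* (t - v)) (le_lt_trans kw whr).
  rewrite (_ : u +i* v + _ = s +i* t); last first.
    by apply/eqP; rewrite eq_complex /= !subrKC !eqxx.
  rewrite -addrA -opprD => /le_trans; apply; exact: ler_wpM2l.
have Hh (t0 : R) : y <= t0 <= y + h ->
    nc (cint (hpath f t0) x (x + w) - ((f (u +i* v) + d * ((x - u) +i* (t0 - v))) * w%:C
        + d * (w ^+ 2 / 2)%:C)) <= 2 * (e * (w + h)) * w.
  move=> th.
  have := @cint_affine (hpath f t0) (f (u +i* v) + d * ((x - u) +i* (t0 - v))) d
    x (x + w) (e * (w + h)) (ccont_hpath _ ef).
  rewrite (_ : x + w - x = w) ?(ger0_norm w0); last by ring.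
  apply=> s; rewrite /hpath => sx; have := near s t0 _ th.
  rewrite (_ : _ + d * ((s - u) +i* (t0 - v)) =
    f (u +i* v) + d * ((x - u) +i* (t0 - v)) + d * (s - x)%:C); last first.
    by rewrite !complexRI; ring.
  by apply; lra.
have Hv (s0 : R) : x <= s0 <= x + w ->
    nc (cint (vpath f s0) y (y + h) - ((f (u +i* v) + d * ((s0 - u) +i* (y - v))) * h%:C
        + 'i * d * (h ^+ 2 / 2)%:C)) <= 2 * (e * (w + h)) * h.
  move=> th.
  have := @cint_affine (vpath f s0) (f (u +i* v) + d * ((s0 - u) +i* (y - v))) ('i * d)
    y (y + h) (e * (w + h)) (ccont_vpath _ ef).
  rewrite (_ : y + h - y = h) ?(ger0_norm h0); last by ring.
  apply=> s; rewrite /vpath => sx; have := near s0 s th.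
  rewrite (_ : _ + d * ((s0 - u) +i* (s - v)) =
    f (u +i* v) + d * ((s0 - u) +i* (y - v)) + 'i * d * (s - y)%:C); last first.
    by rewrite !complexRI; ring.
  by apply; lra.
have h1 := Hh y ltac:(lra); have h2 := Hh (y + h) ltac:(lra).
have h3 := Hv x ltac:(lra); have h4 := Hv (x + w) ltac:(lra).
set a1 := _ - _ in h1; set a2 := _ - _ in h2; set a3 := _ - _ in h3; set a4 := _ - _ in h4.
have -> : rect_int f x y w h = a1 + 'i * a4 - 'i * a3 - a2.
  rewrite /rect_int /a1 /a2 /a3 /a4 !complexRI.
  have ii : 'i * 'i = -1 :> R[i] by apply/eqP; rewrite eq_complex /=; apply/andP; split; apply/eqP; ring.
  ring: ii.
apply: (le_trans (ncB _ _)); apply: (le_trans (lerD (ncB _ _) (lexx _))).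
apply: (le_trans (lerD (lerD (ncD _ _) (lexx _)) (lexx _))); rewrite !ncM nci !mul1r.
rewrite expr2; lra.
Qed.

Lemma rect_int_quarters f x y w h : rect_int f x y w h =
  rect_int f x y (w / 2) (h / 2) + rect_int f (x + w / 2) y (w / 2) (h / 2) +
  rect_int f x (y + h / 2) (w / 2) (h / 2) +
  rect_int f (x + w / 2) (y + h / 2) (w / 2) (h / 2).
Proof.
rewrite /rect_int.
have dbl (u v : R) : u + v / 2 + v / 2 = u + v by field.
rewrite !dbl.
rewrite -(cintD (hpath f y) x (x + w / 2) (x + w)) -(cintD (hpath f (y + h)) x (x + w / 2) (x + w)).
rewrite -(cintD (vpath f x) y (y + h / 2)) -(cintD (vpath f (x + w)) y (y + h / 2)).
ring.
Qed.

Lemma rect_int0 f x y w h : entire f -> 0 <= w -> 0 <= h -> rect_int f x y w h = 0.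
Proof.
move=> ef w0 h0; apply/eqP; rewrite -nc_eq0; apply/eqP/le_anti; rewrite nc_ge0 andbT.
rewrite leNgt; apply/negP => D0.
pose K := 4 * (w + h) ^+ 2.
have K0 : 0 <= K by rewrite mulr_ge0// sqr_ge0.
(* With this [e] the bound [4 e (w + h)^2] is less than half of the supposedly positive modulus.
   Being quadratic in the size, it is also the sum of the bounds for the four quarters, so
   [bisection] applies. *)
pose e := nc (rect_int f x y w h) / (2 * (K + 1)).
have e0 : 0 < e by rewrite divr_gt0// mulr_gt0//; lra.
suff : nc (rect_int f x y w h) <= 4 * e * (w + h) ^+ 2.
  have : e * (2 * (K + 1)) = nc (rect_int f x y w h) by rewrite /e divfK//; apply: lt0r_neq0; lra.
  by rewrite (_ : 4 * e * _ = e * K) /K; [nra|ring].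
apply: (@bisection _ (fun x y w h => nc (rect_int f x y w h) <= 4 * e * (w + h) ^+ 2)) => //.
- move=> {K0 D0 e0}x1 y1 w1 h1 w10 h10 q1 q2 q3 q4; rewrite rect_int_quarters.
  apply: (le_trans (ncD _ _)); apply: (le_trans (lerD (ncD _ _) (lexx _))).
  apply: (le_trans (lerD (lerD (ncD _ _) (lexx _)) (lexx _))).
  have -> : 4 * e * (w1 + h1) ^+ 2 = 4 * (4 * e * (w1 / 2 + h1 / 2) ^+ 2) by field.
  by lra.
- move=> u v _ _; have [d Hd] := (entireP f).1 ef (u +i* v).
  have [r r0 Hr] := Hd e e0; exists (r / 2) => [|x1 y1 n wr hr xu yv]; first by lra.
  have wn : 0 <= w / 2 ^+ n by rewrite divr_ge0// exprn_ge0.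
  have hn : 0 <= h / 2 ^+ n by rewrite divr_ge0// exprn_ge0.
  apply: (rect_int_small ef Hr) => //; [exact: ltW|lra].
Qed.

Lemma cauchy_goursat f x x' y y' : entire f ->
  cint (hpath f y) x x' + 'i * cint (vpath f x') y y' =
  'i * cint (vpath f x) y y' + cint (hpath f y') x x'.
Proof.
move=> ef.
wlog yy : y y' / y <= y'.
  move=> H; have [/H //|/ltW/H {}H] := leP y y'.
  rewrite (cintN (vpath f x') y' y) (cintN (vpath f x) y' y).
  move/eqP: H; rewrite -subr_eq0 -oppr_eq0 => /eqP H; apply/subr0_eq.
  by rewrite -[RHS]H; ring.
wlog xx : x x' / x <= x'.
  move=> H; have [/H //|/ltW/H {}H] := leP x x'.
  rewrite (cintN (hpath f y) x' x) (cintN (hpath f y') x' x).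
  move/eqP: H; rewrite -subr_eq0 -oppr_eq0 => /eqP H; apply/subr0_eq.
  by rewrite -[RHS]H; ring.
have := @rect_int0 f x y (x' - x) (y' - y) ef.
rewrite !subr_ge0 => /(_ xx yy); rewrite /rect_int !(subrKC, subrK) => H.
by apply/subr0_eq; rewrite -[RHS]H; ring.
Qed.

Definition taylor2 f z := exists b c : R[i], forall e, 0 < e -> exists2 r : R, 0 < r &
  forall h : R[i], nc h < r -> nc (f (z + h) - f z - b * h - c * h ^+ 2) <= e * nc h ^+ 2.

(** [F] integrates [f] along an L-shaped path from [0]; path independence lets every increment start
    at [z] instead. Integrating the first order expansion of [f] gives the coefficients [f z] and
    [f' z / 2]. The second conclusion controls horizontal difference quotients by the oscillation of
    [f] alone. *)
Lemma entire_primitive f : entire f -> exists2 F, (forall z, taylor2 F z) &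
  forall z s e, (forall t, `|t| <= `|s| -> nc (f (z + t%:C) - f z) <= e) ->
    nc (F (z + s%:C) - F z - f z * s%:C) <= 2 * e * `|s|.
Proof.
move=> ef.
pose F z := cint (hpath f 0) 0 (complex.Re z) + 'i * cint (vpath f (complex.Re z)) 0 (complex.Im z).
have step x y s t : F ((x + s) +i* (y + t)) - F (x +i* y) =
    cint (hpath f y) x (x + s) + 'i * cint (vpath f (x + s)) y (y + t).
  rewrite /F /= -(cintD (hpath f 0) 0 x) -(cintD (vpath f (x + s)) 0 y).
  have /eqP := cauchy_goursat x (x + s) 0 y ef.
  rewrite -subr_eq0 => /eqP H; apply/subr0_eq.
  by rewrite -[RHS]H; ring.
exists F.
- move=> [x y]; have [d Hd] := (entireP f).1 ef (x +i* y).
  exists (f (x +i* y)), (d / 2) => e e0.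
  have e4 : 0 < e / 4 by lra.
  have [r r0 Hr] := Hd _ e4; exists r => // h hr.
  case: h hr => s t hr.
  have hn := nc_ge0 (s +i* t).
  have ls : `|s| <= nc (s +i* t) by have := Re_le_nc (s +i* t).
  have lt_ : `|t| <= nc (s +i* t) by have := Im_le_nc (s +i* t).
  have nle s' t' : `|s'| <= `|s| -> `|t'| <= `|t| -> nc (s' +i* t') <= nc (s +i* t).
    move=> hs ht; rewrite -(ler_pXn2r (ltn0Sn 1)) ?nnegrE ?nc_ge0// !nc_sqr /=.
    by apply: lerD; rewrite -[leLHS]real_normK ?num_real// -[leRHS]real_normK ?num_real// lerXn2r ?nnegrE.
  have near s' t' : `|s'| <= `|s| -> `|t'| <= `|t| ->
      nc (f ((x + s') +i* (y + t')) - (f (x +i* y) + d * (s' +i* t'))) <= e / 4 * nc (s +i* t).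
    move=> hs ht; have := Hr (s' +i* t') (le_lt_trans (nle _ _ hs ht) hr).
    rewrite (_ : x +i* y + _ = (x + s') +i* (y + t')) // opprD addrA => /le_trans; apply.
    by apply: ler_wpM2l; [lra|exact: nle].
  have A : nc (cint (hpath f y) x (x + s) - (f (x +i* y) * s%:C + d * (s ^+ 2 / 2)%:C))
      <= 2 * (e / 4 * nc (s +i* t)) * `|s|.
    have := @cint_affine (hpath f y) (f (x +i* y)) d x (x + s)
      (e / 4 * nc (s +i* t)) (ccont_hpath _ ef).
    rewrite (_ : x + s - x = s); last by ring.
    apply=> s' hs; have := near (s' - x) 0; rewrite addr0 subrKC normr0.
    rewrite (_ : (s' - x) +i* 0 = (s' - x)%:C) //; apply => //.
    by case/orP: hs => hs; [rewrite !ger0_norm|rewrite !ler0_norm]; lra.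
  have B : nc (cint (vpath f (x + s)) y (y + t) -
      ((f (x +i* y) + d * s%:C) * t%:C + ('i * d) * (t ^+ 2 / 2)%:C))
      <= 2 * (e / 4 * nc (s +i* t)) * `|t|.
    have := @cint_affine (vpath f (x + s)) (f (x +i* y) + d * s%:C) ('i * d) y (y + t)
      (e / 4 * nc (s +i* t)) (ccont_vpath _ ef).
    rewrite (_ : y + t - y = t); last by ring.
    apply=> t' ht; have := near s (t' - y); rewrite subrKC.
    rewrite (_ : _ + d * (s +i* (t' - y)) =
      f (x +i* y) + d * s%:C + 'i * d * (t' - y)%:C); last by rewrite !complexRI; ring.
    apply => //.
    by case/orP: ht => ht; [rewrite !ger0_norm|rewrite !ler0_norm]; lra.
  rewrite (_ : x +i* y + (s +i* t) = (x + s) +i* (y + t)) // step.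
  set a := _ - _ in A; set b := _ - _ in B.
  rewrite [X in nc X](_ : _ = a + 'i * b); last first.
    rewrite /a /b !complexRI.
    have ii : 'i * 'i = -1 :> R[i] by apply/eqP; rewrite eq_complex /=; apply/andP; split; apply/eqP; ring.
    by field: ii.
  apply: (le_trans (ncD _ _)); rewrite ncM nci mul1r.
  have en : 0 <= e * nc (s +i* t) by rewrite mulr_ge0// ltW.
  have := ler_wpM2l en ls; have := ler_wpM2l en lt_.
  by rewrite expr2 mulrA; lra.
- move=> [x y] s e He.
  have := step x y s 0; rewrite addr0 (_ : (x + s) +i* y = x +i* y + s%:C); last first.
    by rewrite !complexRI; ring.
  rewrite -(cintD _ y y y) => ->.
  have -> : cint (vpath f (x + s)) y y = 0.
    by rewrite /cint !subrr.
  rewrite addr0 mulr0 addr0.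
  have := @cint_affine (hpath f y) (f (x +i* y)) 0 x (x + s) e (ccont_hpath _ ef).
  rewrite (_ : x + s - x = s) ?mul0r ?addr0; last by ring.
  apply=> t ht; rewrite mul0r addr0 /hpath.
  have := He (t - x); rewrite (_ : x +i* y + (t - x)%:C = t +i* y); last by rewrite !complexRI; ring.
  apply; by case/orP: ht => ht; [rewrite !ger0_norm|rewrite !ler0_norm]; lra.
Qed.

End Goursat.
(** * Maximum principle and harmonic majorants *)

Section PowerInequalities.
Variable R : realType.
Implicit Types a b p : R.

(** For [t] in [0, 1] one has [t <= t^p]; this is applied to [t = a / (a + b)] and
    [t = b / (a + b)], whose sum is 1. *)
Lemma powR_subadditive a b p : 0 <= a -> 0 <= b -> 0 < p -> p <= 1 ->
  (a + b) `^ p <= a `^ p + b `^ p.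
Proof.
move=> a0 b0 p0 p1; have [ab0|ab] := eqVneq (a + b) 0.
  by rewrite ab0 powR0 ?gt_eqF// addr_ge0 ?powR_ge0.
have S0 : 0 < a + b by rewrite lt_def ab addr_ge0.
have K c : 0 <= c -> c <= a + b -> (a + b) `^ p * (c / (a + b)) <= c `^ p.
  rewrite le_eqVlt => /predU1P[<- _|c0 cab]; first by rewrite mul0r mulr0 powR_ge0.
  rewrite -{2}(divfK ab c) [leLHS]mulrC powRM; [|exact: divr_ge0 (ltW c0) (ltW S0)|exact: ltW].
  apply: ler_wpM2r; first exact: powR_ge0.
  by apply: ger1_powR => //; rewrite divr_gt0// ler_pdivrMr// mul1r.
have Ka : (a + b) `^ p * (a / (a + b)) <= a `^ p by apply: K => //; lra.
have Kb : (a + b) `^ p * (b / (a + b)) <= b `^ p by apply: K => //; lra.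
apply: le_trans (lerD Ka Kb).
by rewrite -mulrDr -mulrDl divff// mulr1.
Qed.

Lemma powR_small e p : 0 < p -> 0 < e -> exists2 d : R, 0 < d & d `^ p = e.
Proof.
move=> p0 e0; exists (e `^ p^-1); first exact: powR_gt0.
by rewrite -powRrM mulVf ?gt_eqF// powRr1// ltW.
Qed.

Lemma powR_le a b p : 0 <= a -> a <= b -> 0 <= p -> a `^ p <= b `^ p.
Proof.
by move=> a0 ab p0; apply: ge0_ler_powR => //; rewrite nnegrE// (le_trans a0).
Qed.

End PowerInequalities.

(** * Compactness and the maximum principle on rectangles *)

Section Rectangles.
Variable R : realType.
Implicit Types (z k : R[i]) (u : R[i] -> R) (x y w h e r t m : R).

Definition rectangle x y w h : set R[i] :=
  [set z | x <= complex.Re z <= x + w /\ y <= complex.Im z <= y + h].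

Definition rect_boundary x y w h : set R[i] :=
  [set z | rectangle x y w h z /\ [\/ complex.Re z = x, complex.Re z = x + w,
     complex.Im z = y | complex.Im z = y + h]].

Definition rect_interior x y w h : set R[i] :=
  [set z | x < complex.Re z < x + w /\ y < complex.Im z < y + h].

(** The Heine-Borel property in inductive form. It yields boundedness and attainment of maxima in
    [rect_max], and later uniform continuity. *)
Lemma rect_induction (P : set R[i] -> Prop) x y w h : 0 <= w -> 0 <= h ->
  (forall A B : set R[i], A `<=` B -> P B -> P A) ->
  (forall A B, P A -> P B -> P (A `|` B)) ->
  (forall z, rectangle x y w h z -> exists2 r, 0 < r & P [set z' | nc (z' - z) < r]) ->
  P (rectangle x y w h).
Proof.
move=> w0 h0 Psub PU Ploc.
apply: (@bisection _ (fun x y w h => P (rectangle x y w h))) => //.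
- move=> x1 y1 w1 h1 w10 h10 P1 P2 P3 P4.
  apply: Psub (PU _ _ (PU _ _ P1 P2) (PU _ _ P3 P4)) => z [zx zy].
  have [xl|xl] := leP (complex.Re z) (x1 + w1 / 2);
    have [yl|yl] := leP (complex.Im z) (y1 + h1 / 2).
  + by left; left; split; lra.
  + by right; left; split; lra.
  + by left; right; split; lra.
  + by right; right; split; lra.
- move=> u v xu yv; have [r r0 Pr] := Ploc (u +i* v) (conj xu yv).
  exists (r / 2) => [|x1 y1 n wr hr xu1 yv1]; first by lra.
  apply: Psub Pr => z [zx zy] /=.
  rewrite (le_lt_trans (nc_le_ReIm _))// ReD ImD ReN ImN.
  rewrite [complex.Re (_ +i* _)]/= [complex.Im (_ +i* _)]/=.
  rewrite (_ : r = r / 2 + r / 2); last by field.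
  by apply: ltrD; rewrite ltr_norml; lra.
Qed.

Definition usc_on (A : set R[i]) u := forall z, A z -> forall e, 0 < e ->
  exists2 r, 0 < r & forall k, nc k < r -> u (z + k) <= u z + e.

Lemma rect_max u x y w h : 0 <= w -> 0 <= h -> usc_on (rectangle x y w h) u ->
  exists2 z, rectangle x y w h z & forall z', rectangle x y w h z' -> u z' <= u z.
Proof.
move=> w0 h0 cu; set Q := rectangle x y w h in cu *.
have Q0 : Q (x +i* y) by split => /=; lra.
(* The first [Q z] is the set of the induction, the second restricts the property to the rectangle,
   since the local discs may leave it. *)
have [B HB] : exists B, forall z, Q z -> Q z -> u z <= B.
  apply: (@rect_induction (fun A => exists B, forall z, A z -> Q z -> u z <= B)) => //.
  - by move=> A A' sA [B HB]; exists B => z /sA; exact: HB.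
  - move=> A A' [B HB] [B' HB']; exists (Num.max B B') => z [/HB|/HB'] H /H;
      by rewrite le_max => ->; rewrite ?orbT.
  - move=> z Qz; have [r r0 Hr] := cu z Qz 1 ltr01.
    by exists r => //; exists (u z + 1) => z' /= /Hr; rewrite subrKC.
pose M := sup [set u z | z in Q].
have supM : has_sup [set u z | z in Q].
  by split; [exists (u (x +i* y)), (x +i* y)|exists B => _ [z Qz <-]; exact: HB].
have leM z : Q z -> u z <= M by move=> Qz; apply: ub_le_sup; [exact: supM.2|exists z].
have [[z Qz uz]|nM] := pselect (exists2 z, Q z & M <= u z).
  by exists z => // z' /leM /le_trans; apply.
have ltM z : Q z -> u z < M.
  by move=> Qz; rewrite ltNge; apply/negP => H; apply: nM; exists z.
(* If the supremum [M] is not attained, the local gaps below [M] combine into a uniform one, which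
   contradicts the choice of [M]. *)
have [e e0 He] : exists2 e, 0 < e & forall z, Q z -> Q z -> u z <= M - e.
  apply: (@rect_induction (fun A => exists2 e, 0 < e & forall z, A z -> Q z -> u z <= M - e)) => //.
  - by move=> A A' sA [e e0 He]; exists e => // z /sA; exact: He.
  - move=> A A' [e e0 He] [e' e0' He']; exists (Num.min e e'); first by rewrite lt_min e0.
    move=> z [/He|/He'] H /H; have : Num.min e e' <= e by rewrite ge_min lexx.
      by lra.
    have : Num.min e e' <= e' by rewrite ge_min lexx orbT.
    by lra.
  - move=> z Qz; have d0 : 0 < (M - u z) / 2 by have := ltM z Qz; lra.
    have [r r0 Hr] := cu z Qz _ d0; exists r => //; exists ((M - u z) / 2) => // z' /= /Hr.
    by rewrite subrKC; lra.
exfalso; have : M <= M - e.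
  by apply: ge_sup => [|_ [z Qz <-]]; [exact: supM.1|exact: He].
by lra.
Qed.

(* Sub-mean value inequality up to [o(t^2)]. *)
Definition sub4 u z := forall e, 0 < e -> exists2 r, 0 < r & forall t, 0 < t -> t < r ->
  4 * u z - e * t ^+ 2 <=
  u (z + t%:C) + u (z - t%:C) + u (z + 'i * t%:C) + u (z - 'i * t%:C).

Lemma sub4D u v z : sub4 u z -> sub4 v z -> sub4 (fun z => u z + v z) z.
Proof.
move=> Hu Hv e e0; have e2 : 0 < e / 2 by lra.
have [r r0 Hr] := Hu _ e2; have [s s0 Hs] := Hv _ e2.
exists (Num.min r s); first by rewrite lt_min r0.
move=> t t0; rewrite lt_min => /andP[/(Hr _ t0) h1 /(Hs _ t0) h2].
by lra.
Qed.

Lemma nc_sqr4 z t : nc (z + t%:C) ^+ 2 + nc (z - t%:C) ^+ 2 + nc (z + 'i * t%:C) ^+ 2 +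
  nc (z - 'i * t%:C) ^+ 2 = 4 * nc z ^+ 2 + 4 * t ^+ 2.
Proof.
case: z => a b; rewrite !nc_sqr !(ReD, ImD, ReN, ImN, ReM, ImM) /=.
by rewrite !(mul0r, mul1r, mulr0, oppr0, addr0, subr0, add0r); ring.
Qed.

Lemma nc_it t : nc ('i * t%:C : R[i]) = `|t|.
Proof. by rewrite ncM nci mul1r ncR. Qed.

(** The four-point sum of [th |z|^2] exceeds four times its central value by exactly [4 th t^2].
    Adding this term outweighs the error allowed by [sub4], taken as [2 th t^2], so that an interior
    maximum is impossible. *)
Lemma max_principle4 u m x y w h : 0 <= w -> 0 <= h ->
  usc_on (rectangle x y w h) u ->
  (forall z, rect_interior x y w h z -> sub4 u z) ->
  (forall z, rect_boundary x y w h z -> u z <= m) ->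
  forall z, rectangle x y w h z -> u z <= m.
Proof.
move=> w0 h0 cu su bu z1 Qz1; rewrite leNgt; apply/negP => mz.
set Q := rectangle x y w h in cu Qz1.
pose K := (`|x| + w + (`|y| + h)) ^+ 2.
have K0 : 0 <= K by exact: sqr_ge0.
have HK z : Q z -> nc z ^+ 2 <= K.
  move=> [zx zy]; rewrite /K lerXn2r ?nnegrE ?nc_ge0 ?addr_ge0//.
  apply: (le_trans (nc_le_ReIm _)).
  have ax := ler_norm x; have ay := ler_norm y.
  have bx := ler_norm (- x); have by_ := ler_norm (- y).
  rewrite !normrN in bx by_.
  by apply: lerD; rewrite ler_norml; lra.
(* Since [|z|^2 <= K] on the rectangle, this [th] raises the boundary values by less than
   [u z1 - m], so the maximum of the perturbed function stays in the interior. *)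
have [th th0 thK] : exists2 th, 0 < th & th * (2 * (K + 1)) = u z1 - m.
  exists ((u z1 - m) / (2 * (K + 1))); first by apply: divr_gt0; lra.
  by rewrite divfK//; apply: lt0r_neq0; lra.
pose v z := u z + th * nc z ^+ 2.
have cv : usc_on Q v.
  move=> z Qz e e0; have e2 : 0 < e / 2 by lra.
  have [r r0 Hr] := cu z Qz _ e2.
  pose s := Num.min 1 (e / (2 * (th * (2 * nc z + 1)))).
  have n0 := nc_ge0 z.
  have L0 : 0 < th * (2 * nc z + 1) by rewrite mulr_gt0//; lra.
  have L2 : 0 < 2 * (th * (2 * nc z + 1)) by lra.
  exists (Num.min r s) => [|k].
    by rewrite !lt_min r0 ltr01 divr_gt0.
  rewrite !lt_min => /and3P[/Hr kr k1]; rewrite ltr_pdivlMr// => ke.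
  rewrite /v; have k0 := nc_ge0 k.
  have : nc (z + k) ^+ 2 <= (nc z + nc k) ^+ 2.
    by rewrite lerXn2r ?nnegrE ?nc_ge0 ?addr_ge0 ?nc_ge0// ncD.
  move=> /(ler_wpM2l (ltW th0)) H.
  have : th * (nc z + nc k) ^+ 2 <= th * nc z ^+ 2 + nc k * (th * (2 * nc z + 1)).
    rewrite (_ : _ + _ = th * (nc z ^+ 2 + nc k * (2 * nc z + 1))); last by ring.
    by apply: ler_wpM2l; [exact: ltW|nra].
  by lra.
have [z Qz Hz] := rect_max w0 h0 cv.
have vz : m + th * K < v z.
  apply: (@lt_le_trans _ _ (v z1)); last exact: Hz.
  have : 0 <= th * nc z1 ^+ 2 by rewrite mulr_ge0 ?sqr_ge0// ltW.
  by rewrite /v; lra.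
have [bz|nbz] := pselect (rect_boundary x y w h z).
  have := bu z bz; have := ler_wpM2l (ltW th0) (HK z Qz); move: vz; rewrite /v; lra.
case: (Qz) => zx zy.
have zi : rect_interior x y w h z.
  split; rewrite !lt_neqAle.
  - case/andP: zx => -> ->; rewrite !andbT; apply/andP; split; apply/eqP => E;
      apply: nbz; split=> //; [exact: Or41|exact: Or42].
  - case/andP: zy => -> ->; rewrite !andbT; apply/andP; split; apply/eqP => E;
      apply: nbz; split=> //; [exact: Or43|exact: Or44].
have th2 : 0 < 2 * th by lra.
have [r r0 Hr] := su z zi _ th2.
case: zi => zx' zy'.
pose t := Num.min (r / 2) (Num.min (Num.min (complex.Re z - x) (x + w - complex.Re z))
   (Num.min (complex.Im z - y) (y + h - complex.Im z))).
have t0 : 0 < t by rewrite !lt_min; apply/andP; split; [lra|apply/andP; split; lra].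
have tr : t < r by apply: (@le_lt_trans _ _ (r / 2)); [rewrite ge_min lexx|lra].
have [t1 t2 t3 t4] : [/\ t <= complex.Re z - x, t <= x + w - complex.Re z,
    t <= complex.Im z - y & t <= y + h - complex.Im z].
  by split; rewrite /t !ge_min lexx ?orbT.
have := Hr t t0 tr.
have := nc_sqr4 z t.
have A1 : v (z + t%:C) <= v z by apply: Hz; split; rewrite !(ReD, ImD) /=; lra.
have A2 : v (z - t%:C) <= v z by apply: Hz; split; rewrite !(ReD, ImD) /=; lra.
have A3 : v (z + 'i * t%:C) <= v z.
  by apply: Hz; split; rewrite !(ReD, ImD, ReM, ImM) /=; lra.
have A4 : v (z - 'i * t%:C) <= v z.
  by apply: Hz; split; rewrite !(ReD, ImD, ReN, ImN, ReM, ImM) /=; lra.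
move: A1 A2 A3 A4; rewrite /v.
have : 0 < th * t ^+ 2 by rewrite mulr_gt0// exprn_gt0.
move: (nc (z + t%:C) ^+ 2) (nc (z - t%:C) ^+ 2) (nc (z + 'i * t%:C) ^+ 2) (nc (z - 'i * t%:C) ^+ 2).
move: (nc z ^+ 2) (t ^+ 2) => c0 tt c1 c2 c3 c4 g A1 A2 A3 A4 E H.
have E' : th * (c1 + c2 + c3 + c4) = th * (4 * c0 + 4 * tt) by rewrite E.
lra.
Qed.

End Rectangles.

(** * Subharmonicity of powers of the modulus *)

Section MaximumPrinciple.
Variable R : realType.
Implicit Types (f F : R[i] -> R[i]) (z k b c : R[i]) (e r t p m s : R).

Lemma taylor2_at4 F z : taylor2 F z -> exists b c, forall e, 0 < e ->
  exists2 r, 0 < r & forall t, 0 < t -> t < r ->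
  [/\ nc (F (z + t%:C) - F z - b * t%:C - c * t%:C ^+ 2) <= e * t ^+ 2,
      nc (F (z - t%:C) - F z + b * t%:C - c * t%:C ^+ 2) <= e * t ^+ 2,
      nc (F (z + 'i * t%:C) - F z - 'i * b * t%:C + c * t%:C ^+ 2) <= e * t ^+ 2 &
      nc (F (z - 'i * t%:C) - F z + 'i * b * t%:C + c * t%:C ^+ 2) <= e * t ^+ 2].
Proof.
have ii : 'i * 'i = -1 :> R[i].
  by apply/eqP; rewrite eq_complex /=; apply/andP; split; apply/eqP; ring.
move=> [b [c H]]; exists b, c => e e0; have [r r0 Hr] := H e e0.
exists r => // t t0 tr.
have nt : nc (t%:C : R[i]) = t by rewrite ncR gtr0_norm.
have nit : nc ('i * t%:C : R[i]) = t by rewrite nc_it gtr0_norm.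
split.
- by have := Hr t%:C; rewrite nt; exact.
- have := Hr (- t%:C); rewrite ncN nt => /(_ tr); apply: le_trans.
  by rewrite le_eqVlt; apply/orP; left; apply/eqP; congr (nc _); ring.
- have := Hr ('i * t%:C); rewrite nit => /(_ tr); apply: le_trans.
  by rewrite le_eqVlt; apply/orP; left; apply/eqP; congr (nc _); ring: ii.
- have := Hr (- ('i * t%:C)); rewrite ncN nit => /(_ tr); apply: le_trans.
  by rewrite le_eqVlt; apply/orP; left; apply/eqP; congr (nc _); ring: ii.
Qed.

Lemma sub4_Re F z : taylor2 F z -> sub4 (fun w => complex.Re (F w)) z.
Proof.
move=> /taylor2_at4 [b [c H]] e e0; have e4 : 0 < e / 4 by lra.
have [r r0 Hr] := H _ e4; exists r => // t t0 tr.
have [h1 h2 h3 h4] := Hr t t0 tr.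
have {}h1 := le_trans (Re_le_nc _) h1; have {}h2 := le_trans (Re_le_nc _) h2.
have {}h3 := le_trans (Re_le_nc _) h3; have {}h4 := le_trans (Re_le_nc _) h4.
move: h1 h2 h3 h4; rewrite !(ReD, ReN) !ler_norml; lra.
Qed.

Lemma amgm4 (a1 a2 a3 a4 : R) :
  4 * (a1 * a2 * a3 * a4) <= a1 ^+ 4 + a2 ^+ 4 + a3 ^+ 4 + a4 ^+ 4.
Proof.
have := sqr_ge0 (a1 ^+ 2 - a2 ^+ 2); have := sqr_ge0 (a3 ^+ 2 - a4 ^+ 2).
have := sqr_ge0 (a1 * a2 - a3 * a4).
nra.
Qed.

Lemma amgm4_powR (x1 x2 x3 x4 p : R) : 0 <= x1 -> 0 <= x2 -> 0 <= x3 -> 0 <= x4 ->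
  4 * (x1 * x2 * x3 * x4) `^ (p / 4) <= x1 `^ p + x2 `^ p + x3 `^ p + x4 `^ p.
Proof.
move=> h1 h2 h3 h4; rewrite !powRM ?mulr_ge0//.
have K x : 0 <= x -> x `^ p = (x `^ (p / 4)) ^+ 4.
  by move=> x0; rewrite -powR_mulrn ?powR_ge0// -powRrM divfK.
by rewrite !K//; exact: amgm4.
Qed.

Lemma prod4_near (q1 q2 q3 q4 a1 a2 a3 a4 : R[i]) e :
  [/\ nc q1 <= 2, nc q2 <= 2, nc q3 <= 2 & nc q4 <= 2] ->
  [/\ nc a1 <= 2, nc a2 <= 2, nc a3 <= 2 & nc a4 <= 2] ->
  [/\ nc (a1 - q1) <= e, nc (a2 - q2) <= e, nc (a3 - q3) <= e & nc (a4 - q4) <= e] ->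
  nc (a1 * a2 * a3 * a4 - q1 * q2 * q3 * q4) <= 32 * e.
Proof.
move=> [q1b q2b q3b q4b] [a1b a2b a3b a4b] [h1 h2 h3 h4].
have -> : a1 * a2 * a3 * a4 - q1 * q2 * q3 * q4 =
  (a1 - q1) * (a2 * a3 * a4) + (a2 - q2) * (q1 * a3 * a4) +
  (a3 - q3) * (q1 * q2 * a4) + (a4 - q4) * (q1 * q2 * q3) by ring.
have K (d u v w : R[i]) : nc d <= e -> nc u <= 2 -> nc v <= 2 -> nc w <= 2 ->
    nc (d * (u * v * w)) <= 8 * e.
  move=> hd hu hv hw; rewrite !ncM (_ : 8 * e = e * (2 * 2 * 2)); last by ring.
  by do 3?[apply: ler_pM => //; rewrite ?mulr_ge0 ?nc_ge0//].
rewrite (_ : 32 * e = 8 * e + 8 * e + 8 * e + 8 * e); last by ring.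
do 3![apply: (le_trans (ncD _ _)); apply: lerD; last exact: K].
exact: K.
Qed.

(** After division by [F z], the product of the four quadratic polynomials is [1 + O(t^4)]. The
    constant 33 is 32, from replacing the values by the polynomials, plus 1 from the quartic
    term. *)
Lemma taylor2_prod4 F z d : taylor2 F z -> F z != 0 -> 0 < d ->
  exists2 r, 0 < r & forall t, 0 < t -> t < r ->
  nc (F z) ^+ 4 * (1 - 33 * (d * t ^+ 2)) <=
  nc (F (z + t%:C)) * nc (F (z - t%:C)) * nc (F (z + 'i * t%:C)) * nc (F (z - 'i * t%:C)).
Proof.
move=> tF Fz0 d0.
have [b [c H]] := taylor2_at4 tF.
move: (F z) Fz0 H => w Fz0 H.
have w0 : 0 < nc w by rewrite nc_gt0.
pose b' := b / w; pose c' := c / w.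
have [B1 B2] : 0 <= nc b' /\ 0 <= nc c' by split; exact: nc_ge0.
(* For [t <= 1], [M] bounds the coefficient of [t^4] in [q1 q2 q3 q4 - 1], which is computed below
   in [Q]. *)
pose M := 2 * nc c' ^+ 2 + nc c' ^+ 4 + nc (c' * 2 - b' ^+ 2) ^+ 2.
have M0 : 0 <= M by rewrite /M !addr_ge0 ?mulr_ge0 ?exprn_ge0 ?nc_ge0.
have dw0 : 0 < d * nc w by rewrite mulr_gt0.
have [r r0 Hr] := H _ dw0.
(* The first three bounds keep the polynomials below [5 / 4] and the errors below [1 / 4], so all
   factors have modulus at most 2; the last absorbs the quartic term into [d t^2]. *)
have [s s0 [sB sd s1 sM]] : exists2 s, 0 < s & [/\ s * (4 * (nc b' + nc c')) <= 1,
    s * (4 * d) <= 1, s <= 1 & s * M <= d].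
  have K y e : 0 <= y -> 0 < e -> exists2 s, 0 < s & forall t, t <= s -> 0 <= t -> t * y <= e.
    move=> y0 e0; exists (e / (y + 1)) => [|t]; first by apply: divr_gt0 => //; lra.
    rewrite ler_pdivlMr; last lra.
    by move=> h1 h2; lra.
  have y1 : 0 <= 4 * (nc b' + nc c') by lra.
  have y2 : 0 <= 4 * d by lra.
  have [u1 u10 U1] := K _ _ y1 ltr01; have [u2 u20 U2] := K _ _ y2 ltr01.
  have [u3 u30 U3] := K _ _ M0 d0.
  exists (Num.min (Num.min u1 u2) (Num.min u3 1)); first by rewrite !lt_min u10 u20 u30 ltr01.
  split.
  - by apply: U1; rewrite ?ge_min ?lexx// !le_min !ltW.
  - by apply: U2; rewrite ?ge_min ?lexx ?orbT// !le_min !ltW.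
  - by rewrite !ge_min lexx !orbT.
  - by apply: U3; rewrite ?ge_min ?lexx ?orbT// !le_min !ltW.
exists (Num.min r s); first by rewrite lt_min r0.
move=> t t0; rewrite lt_min => /andP[tr /ltW ts].
have [h1 h2 h3 h4] := Hr t t0 tr.
have {}sB : t * (4 * (nc b' + nc c')) <= 1.
  by apply: le_trans sB; apply: ler_wpM2r => //; lra.
have {}sd : t * (4 * d) <= 1.
  by apply: le_trans sd; apply: ler_wpM2r => //; lra.
have {}sM : t * M <= d by apply: le_trans sM; exact: ler_wpM2r.
have {ts s0}t1 : t <= 1 by apply: le_trans s1.
have tt : 0 <= t ^+ 2 by exact: sqr_ge0.
have tt1 : t ^+ 2 <= t by rewrite expr2 ger_pMl.
have nt : nc (t%:C : R[i]) = t by rewrite ncR gtr0_norm.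
have [T TE] : exists T : R[i], T = t%:C by exists t%:C.
rewrite -TE in h1 h2 h3 h4 nt *.
pose q1 := 1 + b' * T + c' * T ^+ 2; pose q2 := 1 - b' * T + c' * T ^+ 2.
pose q3 := 1 + 'i * b' * T - c' * T ^+ 2; pose q4 := 1 - 'i * b' * T - c' * T ^+ 2.
have ii : 'i * 'i = -1 :> R[i].
  by apply/eqP; rewrite eq_complex /=; apply/andP; split; apply/eqP; ring.
have close (x y : R[i]) : nc (x * w) <= d * nc w * t ^+ 2 -> y = x -> nc y <= d * t ^+ 2.
  by move=> hx ->; move: hx; rewrite ncM (_ : d * _ * _ = d * t ^+ 2 * nc w) ?ler_pM2r//; ring.
have g1 : nc (F (z + T) / w - q1) <= d * t ^+ 2.
  apply: (close ((F (z + T) - w - b * T - c * T ^+ 2) / w)); first by rewrite divfK.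
  by rewrite /q1 /b' /c'; field.
have g2 : nc (F (z - T) / w - q2) <= d * t ^+ 2.
  apply: (close ((F (z - T) - w + b * T - c * T ^+ 2) / w)); first by rewrite divfK.
  by rewrite /q2 /b' /c'; field.
have g3 : nc (F (z + 'i * T) / w - q3) <= d * t ^+ 2.
  apply: (close ((F (z + 'i * T) - w - 'i * b * T + c * T ^+ 2) / w)); first by rewrite divfK.
  by rewrite /q3 /b' /c'; field.
have g4 : nc (F (z - 'i * T) / w - q4) <= d * t ^+ 2.
  apply: (close ((F (z - 'i * T) - w + 'i * b * T + c * T ^+ 2) / w)); first by rewrite divfK.
  by rewrite /q4 /b' /c'; field.
have Bq : nc b' * t + nc c' * t ^+ 2 <= 1 / 4.
  by have := ler_wpM2l B2 tt1; clear -sB; lra.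
have qb (x y : R[i]) : nc x <= nc b' * t -> nc y <= nc c' * t ^+ 2 -> nc (1 + x + y) <= 5 / 4.
  move=> hx hy; apply: (le_trans (ncD _ _)); apply: (le_trans (lerD (ncD _ _) (lexx _))).
  by rewrite nc1; clear -hx hy Bq; lra.
have nc2 : nc (c' * T ^+ 2) <= nc c' * t ^+ 2 by rewrite ncM ncX nt.
have nb1 : nc (b' * T) <= nc b' * t by rewrite ncM nt.
have nb2 : nc ('i * b' * T) <= nc b' * t by rewrite !ncM nci mul1r nt.
have b1 : nc q1 <= 5 / 4 by exact: qb.
have b2 : nc q2 <= 5 / 4 by apply: qb; rewrite // ncN.
have b3 : nc q3 <= 5 / 4 by apply: qb; rewrite // ncN.
have b4 : nc q4 <= 5 / 4 by apply: qb; rewrite ncN.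
have Q : nc (q1 * q2 * q3 * q4 - 1) <= d * t ^+ 2.
  have -> : q1 * q2 * q3 * q4 - 1 =
    T ^+ 4 * (2 * c' ^+ 2 + c' ^+ 4 * T ^+ 4 - (c' * 2 - b' ^+ 2) ^+ 2).
    by rewrite /q1 /q2 /q3 /q4; ring: ii.
  rewrite ncM ncX nt.
  have : nc (2 * c' ^+ 2 + c' ^+ 4 * T ^+ 4 - (c' * 2 - b' ^+ 2) ^+ 2) <= M.
    apply: (le_trans (ncB _ _)); rewrite /M; apply: lerD; last by rewrite ncX.
    apply: (le_trans (ncD _ _)); apply: lerD.
      rewrite ncM ncX; have -> : nc (2 : R[i]) = 2.
        by rewrite -(ger0_norm (ler0n R 2)) -ncR; congr nc; rewrite rmorph_nat.
      by [].
    rewrite ncM !ncX nt ler_piMr ?exprn_ge0 ?nc_ge0//.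
    by rewrite exprn_ile1// ltW.
  move=> hM; have t40 : 0 <= t ^+ 4 by rewrite exprn_ge0// ltW.
  apply: (le_trans (ler_wpM2l t40 hM)).
  rewrite (_ : t ^+ 4 * M = (t ^+ 2 * M) * t ^+ 2); last by ring.
  apply: ler_wpM2r => //; apply: le_trans sM; exact: ler_wpM2r.
have dt : d * t ^+ 2 <= 1 / 4.
  by have := ler_wpM2l (ltW d0) tt1; clear -sd; lra.
move: q1 q2 q3 q4 b1 b2 b3 b4 g1 g2 g3 g4 Q => q1 q2 q3 q4 b1 b2 b3 b4 g1 g2 g3 g4 Q.
have Fw (x : R[i]) : nc (F x) = nc (F x / w) * nc w by rewrite -ncM divfK.
rewrite (Fw (z + T)) (Fw (z - T)) (Fw (z + 'i * T)) (Fw (z - 'i * T)).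
move: (F (z + T) / w) (F (z - T) / w) (F (z + 'i * T) / w) (F (z - 'i * T) / w) g1 g2 g3 g4 => a1 a2 a3 a4 g1 g2 g3 g4.
move: (d * t ^+ 2) dt Q g1 g2 g3 g4 (nc_ge0 w) b1 b2 b3 b4.
clear => e dt Q g1 g2 g3 g4 w0 b1 b2 b3 b4.
have two (a q : R[i]) : nc (a - q) <= e -> nc q <= 5 / 4 -> nc a <= 2 /\ nc q <= 2.
  move=> ha hq; split; last by lra.
  by rewrite -(subrK q a) (le_trans (ncD _ _))//; lra.
have [a1b q1b] := two _ _ g1 b1; have [a2b q2b] := two _ _ g2 b2.
have [a3b q3b] := two _ _ g3 b3; have [a4b q4b] := two _ _ g4 b4.
have P := prod4_near (And4 q1b q2b q3b q4b) (And4 a1b a2b a3b a4b) (And4 g1 g2 g3 g4).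
have X1 : 1 - 33 * e <= nc (a1 * a2 * a3 * a4).
  have := ncB_ge 1 (1 - a1 * a2 * a3 * a4); rewrite nc1.
  rewrite (_ : 1 - (1 - _) = a1 * a2 * a3 * a4); last by ring.
  have : nc (1 - a1 * a2 * a3 * a4) <= 33 * e.
    rewrite ncBC (_ : _ - 1 = (a1 * a2 * a3 * a4 - q1 * q2 * q3 * q4) + (q1 * q2 * q3 * q4 - 1)); last by ring.
    by apply: (le_trans (ncD _ _)); clear -P Q; lra.
  by clear; lra.
have w4 : 0 <= nc w ^+ 4 by rewrite exprn_ge0.
apply: (le_trans (ler_wpM2l w4 X1)); rewrite !ncM.
by rewrite le_eqVlt; apply/orP; left; apply/eqP; ring.
Qed.

(** At a zero of [F] the function attains its minimum 0. Elsewhere the arithmetic-geometric mean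
    inequality turns the product estimate into a sum estimate, and [(1 - x)^(p/4) >= 1 - x] because
    [p / 4 <= 1]. *)
Lemma sub4_powR F z p : taylor2 F z -> 0 < p -> p <= 1 ->
  sub4 (fun w => nc (F w) `^ p) z.
Proof.
move=> tF p0 p1 e e0; have [Fz0|Fz0] := eqVneq (F z) 0.
  exists 1 => // t t0 _; rewrite Fz0 nc0 powR0 ?gt_eqF// mulr0 sub0r.
  apply: (@le_trans _ _ 0); last by rewrite !addr_ge0 ?powR_ge0.
  by rewrite oppr_le0 mulr_ge0 ?sqr_ge0// ltW.
have W0 : 0 < nc (F z) `^ p by rewrite powR_gt0// nc_gt0.
(* 132 is 4 times the 33 of [taylor2_prod4]; the radius below, with [34 * d], keeps [1 - 33 d t^2]
   positive. *)
have [d d0 dW] : exists2 d, 0 < d & d * (132 * nc (F z) `^ p) = e.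
  exists (e / (132 * nc (F z) `^ p)); first by apply: divr_gt0; lra.
  by rewrite divfK//; apply: lt0r_neq0; lra.
have [r r0 Hr] := taylor2_prod4 tF Fz0 d0.
exists (Num.min r (Num.min 1 (1 / (34 * d)))).
  by rewrite !lt_min r0 ltr01 divr_gt0// mulr_gt0.
move=> t t0; rewrite !lt_min ltr_pdivlMr ?mulr_gt0// => /and3P[/(Hr _ t0) h t1 td].
have E1 : 0 < 1 - 33 * (d * t ^+ 2) <= 1.
  have tt1 : t ^+ 2 <= t by rewrite expr2 ger_pMl// ltW.
  have := ler_wpM2l (ltW d0) tt1.
  have : 0 < d * t ^+ 2 by rewrite mulr_gt0// exprn_gt0.
  by clear -td; lra.
have p4 : 0 <= p / 4 by lra.
have AM := @amgm4_powR (nc (F (z + t%:C))) (nc (F (z - t%:C))) (nc (F (z + 'i * t%:C)))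
  (nc (F (z - 'i * t%:C))) p (nc_ge0 _) (nc_ge0 _) (nc_ge0 _) (nc_ge0 _).
apply: le_trans AM.
have H1 : 0 <= nc (F z) ^+ 4 by rewrite exprn_ge0 ?nc_ge0.
have H2 : 0 <= 1 - 33 * (d * t ^+ 2) by case/andP: E1 => /ltW.
have := powR_le (mulr_ge0 H1 H2) h p4; rewrite (powRM _ H1 H2).
have -> : (nc (F z) ^+ 4) `^ (p / 4) = nc (F z) `^ p.
  have -> : nc (F z) ^+ 4 = nc (F z) `^ 4 by rewrite powR_mulrn// nc_ge0.
  by rewrite -powRrM mulrC divfK.
have p41 : p / 4 <= 1 by lra.
have := ler_wpM2l (ltW W0) (ger1_powR E1 p41).
move: (_ `^ (p / 4)) (_ `^ (p / 4)) dW => A B <-; clear.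
by lra.
Qed.

Lemma nc_powR_close (u v : R[i]) d p : 0 < p -> p <= 1 -> 0 <= d ->
  nc (u - v) <= d -> nc u `^ p <= nc v `^ p + d `^ p.
Proof.
move=> p0 p1 d0 uv; apply: le_trans (powR_subadditive (nc_ge0 _) d0 p0 p1).
apply: powR_le; rewrite ?nc_ge0 ?(ltW p0)//.
by rewrite -{1}(subrKC v u) (le_trans (ncD _ _))// lerD2l.
Qed.

Lemma taylor2_cont F z : taylor2 F z -> forall e, 0 < e ->
  exists2 r, 0 < r & forall k, nc k < r -> nc (F (z + k) - F z) <= e.
Proof.
move=> [b [c H]] e e0; have [r r0 Hr] := H 1 ltr01.
pose B := nc b + nc c + 1.
have B0 : 1 <= B by rewrite /B; have := nc_ge0 b; have := nc_ge0 c; lra.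
have eB : 0 < e / B by apply: divr_gt0; lra.
exists (Num.min r (Num.min 1 (e / B))); first by rewrite !lt_min r0 ltr01 eB.
move=> k; rewrite !lt_min => /and3P[/Hr kr k1]; rewrite ltr_pdivlMr; last lra.
move=> ke; have k0 := nc_ge0 k.
rewrite (_ : F (z + k) - F z = (F (z + k) - F z - b * k - c * k ^+ 2) + b * k + c * k ^+ 2); last by ring.
apply: (le_trans (ncD _ _)); apply: (le_trans (lerD (ncD _ _) (lexx _))).
rewrite (ncM b) (ncM c) ncX.
have kk : nc k ^+ 2 <= nc k by rewrite expr2; nra.
have := ler_wpM2l (nc_ge0 c) kk; rewrite /B in ke; lra.
Qed.

Lemma taylor2_comb F (a z s : R[i]) : taylor2 F z -> taylor2 F (z + s) ->
  taylor2 (fun w => (F (w + s) - F w) * a) z.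
Proof.
move=> [b [c H]] [b' [c' H']]; exists ((b' - b) * a), ((c' - c) * a) => e e0.
have a1 : 0 < nc a + 1 by have := nc_ge0 a; lra.
have e2 : 0 < e / (2 * (nc a + 1)) by apply: divr_gt0; lra.
have [r r0 Hr] := H _ e2; have [r' r0' Hr'] := H' _ e2.
exists (Num.min r r'); first by rewrite lt_min r0.
move=> k; rewrite lt_min => /andP[/Hr h1 /Hr' h2].
rewrite [X in nc X](_ : _ = ((F (z + s + k) - F (z + s) - b' * k - c' * k ^+ 2) -
   (F (z + k) - F z - b * k - c * k ^+ 2)) * a); last first.
  by rewrite (addrAC z k s); ring.
rewrite ncM; apply: (le_trans (ler_wpM2r (nc_ge0 a) (ncB _ _))).
set x := nc k ^+ 2 in h1 h2 *.
have x0 : 0 <= x by rewrite exprn_ge0// nc_ge0.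
have h3 := lerD h2 h1.
apply: (le_trans (ler_wpM2r (nc_ge0 a) h3)).
have qE : e / (2 * (nc a + 1)) * (2 * (nc a + 1)) = e.
  by rewrite divfK//; apply: lt0r_neq0; lra.
have := mulr_ge0 (ltW e2) x0; move: (e / _) qE => q <-.
by clear; lra.
Qed.

Lemma entire_unif_cont f x y w h e : entire f -> 0 <= w -> 0 <= h -> 0 < e ->
  exists2 r, 0 < r & forall z, rectangle x y w h z ->
    forall k, nc k <= r -> nc (f (z + k) - f z) <= e.
Proof.
move=> ef w0 h0 e0.
apply: (@rect_induction R (fun A => exists2 r, 0 < r & forall z, A z ->
    forall k, nc k <= r -> nc (f (z + k) - f z) <= e)) => //.
- by move=> A B AB [r r0 Hr]; exists r => // z /AB; exact: Hr.
- move=> A B [r r0 Hr] [r' r0' Hr']; exists (Num.min r r'); first by rewrite lt_min r0.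
  by move=> z Hz k; rewrite le_min => /andP[kr kr']; case: Hz => Hz; [exact: Hr|exact: Hr'].
- move=> z _; have e2 : 0 < e / 2 by lra.
  have [r r0 Hr] := entire_cont ef z e2.
  exists (r / 2); first by lra.
  exists (r / 4) => [|z' /= zz k kr]; first by lra.
  have A : nc (f z' - f z) <= e / 2.
    by have := Hr (z' - z); rewrite subrKC; apply; lra.
  have B : nc (f (z' + k) - f z) <= e / 2.
    have := Hr (z' - z + k); rewrite addrA subrKC; apply.
    by rewrite (le_lt_trans (ncD _ _))//; lra.
  rewrite (_ : f (z' + k) - f z' = (f (z' + k) - f z) - (f z' - f z)); last by ring.
  by apply: (le_trans (ncB _ _)); lra.
Qed.

(* [f] need not have a second order Taylor expansion, but its averages
   [(F (z + s) - F z) / s] over short horizontal segments, with [F] a primitive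
   of [f], do, and they tend to [f] uniformly on the rectangle. *)
Lemma max_principle_entire f (H : R[i] -> R) x y w h p m : entire f ->
  0 < p -> p <= 1 -> 0 <= w -> 0 <= h ->
  (forall z, rectangle x y w h z -> forall e, 0 < e -> exists2 r, 0 < r &
     forall k, nc k < r -> `|H (z + k) - H z| <= e) ->
  (forall z, rect_interior x y w h z -> sub4 (fun z => - H z) z) ->
  (forall z, rect_boundary x y w h z -> nc (f z) `^ p <= H z + m) ->
  forall z, rectangle x y w h z -> nc (f z) `^ p <= H z + m.
Proof.
move=> ef p0 p1 w0 h0 cH sH bH z Qz; apply/ler_addgt0Pl => e e0.
have e2 : 0 < e / 2 by lra.
have [d d0 dp] := powR_small p0 e2.
have d2 : 0 < d / 2 by lra.
have [F tF FP] := entire_primitive ef.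
have [s s0 Hs] := entire_unif_cont x y ef w0 h0 d2.
pose g u := (F (u + s%:C) - F u) * (s^-1)%:C.
have tg u : taylor2 g u by apply: taylor2_comb.
have gf u : rectangle x y w h u -> nc (g u - f u) <= d.
  move=> Qu; have := FP u s (d / 2).
  rewrite (gtr0_norm s0) => /(_ _)/wrap[t ts|]; first by apply: Hs => //; rewrite ncR.
  rewrite (_ : 2 * (d / 2) * s = d * s); last by field.
  rewrite -ler_pdivrMr// => /(le_trans _); apply.
  rewrite le_eqVlt; apply/orP; left; apply/eqP.
  rewrite -[X in _ / X](gtr0_norm s0) -ncR -ncV -ncM; congr (nc _); rewrite /g fmorphV.
  by field; apply/eqP => -[/eqP]; rewrite gt_eqF.
have sub (a b : R[i]) : nc (a - b) <= d -> nc a `^ p <= nc b `^ p + e / 2.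
  by move=> ab; rewrite -dp; apply: nc_powR_close => //; exact: ltW.
have : nc (g z) `^ p - H z <= m + e / 2.
  apply: (@max_principle4 R (fun u => nc (g u) `^ p - H u) (m + e / 2) x y w h) => //.
  - move=> u Qu a a0; have a2 : 0 < a / 2 by lra.
    have [c c0 cp] := powR_small p0 a2.
    have [r r0 Hr] := taylor2_cont (tg u) c0.
    have [r' r0' Hr'] := cH u Qu _ a2.
    exists (Num.min r r'); first by rewrite lt_min r0.
    move=> k; rewrite lt_min => /andP[/Hr h1 /Hr']; rewrite ler_norml => h2.
    have := nc_powR_close p0 p1 (ltW c0) h1.
    by rewrite cp; lra.
  - by move=> u Qu; apply: sub4D; [exact: sub4_powR|exact: sH].
  - by move=> u bu; have := bH u bu; have := sub _ _ (gf u (proj1 bu)); lra.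
have := gf z Qz; rewrite ncBC => /sub; lra.
Qed.

End MaximumPrinciple.

(** * Harmonic majorants from Poisson sums *)

Section PoissonMajorant.
Variable R : realType.
Implicit Types (f F G : R[i] -> R[i]) (z k c : R[i]) (a b x y h e t p m J : R).

Lemma taylor2D F G z : taylor2 F z -> taylor2 G z -> taylor2 (fun w => F w + G w) z.
Proof.
move=> [b [c H]] [b' [c' H']]; exists (b + b'), (c + c') => e e0.
have e2 : 0 < e / 2 by lra.
have [r r0 Hr] := H _ e2; have [r' r0' Hr'] := H' _ e2.
exists (Num.min r r'); first by rewrite lt_min r0.
move=> k; rewrite lt_min => /andP[/Hr h1 /Hr' h2].
rewrite [X in nc X](_ : _ = (F (z + k) - F z - b * k - c * k ^+ 2) +
   (G (z + k) - G z - b' * k - c' * k ^+ 2)); last by ring.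
by apply: (le_trans (ncD _ _)); lra.
Qed.

Lemma taylor2_cst c z : taylor2 (fun=> c) z.
Proof.
exists 0, 0 => e e0; exists 1 => // k _.
by rewrite !mul0r !subr0 subrr nc0 mulr_ge0 ?sqr_ge0// ltW.
Qed.

Lemma taylor2Z F c z : taylor2 F z -> taylor2 (fun w => c * F w) z.
Proof.
move=> [b [d H]]; exists (c * b), (c * d) => e e0.
have c1 : 0 < nc c + 1 by have := nc_ge0 c; lra.
have [r r0 Hr] := H _ (divr_gt0 e0 c1); exists r => // k /Hr h1.
rewrite [X in nc X](_ : _ = c * (F (z + k) - F z - b * k - d * k ^+ 2)); last by ring.
rewrite ncM; apply: (le_trans (ler_wpM2l (nc_ge0 c) h1)).
rewrite mulrA ler_wpM2r ?sqr_ge0// mulrCA ler_piMr ?(ltW e0)//.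
by rewrite ler_pdivrMr//; lra.
Qed.

Lemma taylor2_sum n (F : nat -> R[i] -> R[i]) z : (forall j, taylor2 (F j) z) ->
  taylor2 (fun w => \sum_(j < n) F j w) z.
Proof.
move=> H; elim: n => [|n ih].
  have -> : (fun w => \sum_(j < 0) F j w) = fun=> 0.
    by apply/funext => w; rewrite big_ord0.
  exact: taylor2_cst.
have -> : (fun w => \sum_(j < n.+1) F j w) = fun w => \sum_(j < n) F j w + F n w.
  by apply/funext => w; rewrite big_ord_recr.
exact: taylor2D.
Qed.

Lemma taylor2_inv c z : z != c -> taylor2 (fun w => (w - c)^-1) z.
Proof.
rewrite -subr_eq0 => u0.
exists (- ((z - c) ^- 2)), ((z - c) ^- 3) => e e0.
have nu : 0 < nc (z - c) by rewrite nc_gt0.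
exists (Num.min (nc (z - c) / 2) (e * nc (z - c) ^+ 4 / 2)).
  by rewrite lt_min !divr_gt0// mulr_gt0// exprn_gt0.
move=> k; rewrite lt_min => /andP[k1 k2].
have uk : nc (z - c) / 2 <= nc (z - c + k).
  by have := ncB_ge (z - c) (- k); rewrite opprK ncN; lra.
have uk0 : z - c + k != 0 by rewrite -nc_gt0; lra.
rewrite (_ : _ - _ = - (k ^+ 3 / ((z - c) ^+ 3 * (z - c + k)))); last first.
  rewrite (addrAC z k). by field; rewrite uk0.
rewrite ncN ncM ncV ncM !ncX.
rewrite ler_pdivrMr ?mulr_gt0 ?exprn_gt0 //; last lra.
have k0 := nc_ge0 k.
have K1 : nc k <= e * (nc (z - c) ^+ 3 * nc (z - c + k)).
  apply: (le_trans (ltW k2)).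
  rewrite (exprSr _ 3) -mulrA ler_wpM2l ?(ltW e0)// -mulrA ler_wpM2l//.
  by rewrite exprn_ge0// ltW.
have := ler_wpM2l (sqr_ge0 (nc k)) K1; rewrite (exprSr _ 2); lra.
Qed.

Lemma Re_sum n (F : nat -> R[i]) :
  complex.Re (\sum_(j < n) F j) = \sum_(j < n) complex.Re (F j).
Proof.
by elim: n => [|n ih]; rewrite ?big_ord0// !big_ord_recr /= ReD ih.
Qed.

(* The Poisson kernel of the half-plane [Im z > - h], up to a constant factor. *)
Lemma Re_poisson z t h : complex.Re ('i / (z - (t -i* h))) =
  (complex.Im z + h) / ((complex.Re z - t) ^+ 2 + (complex.Im z + h) ^+ 2).
Proof. by case: z => x y /=; rewrite opprK mul0r mul1r sub0r opprK. Qed.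

Lemma powR_nc_cont f p : entire f -> 0 < p -> p <= 1 ->
  continuous (fun x : R => nc (f x%:C) `^ p).
Proof.
move=> ef p0 p1 x; apply/cvgrPdist_lt => e e0.
have e2 : 0 < e / 2 by lra.
have [d d0 dp] := powR_small p0 e2.
have [r r0 Hr] := entire_cont ef x%:C d0.
apply/nbhs_ballP; exists r => //= y xy.
have H : nc (f y%:C - f x%:C) <= d.
  have := Hr (y - x)%:C; rewrite ncR distrC => /(_ xy).
  by rewrite rmorphB subrKC.
have sub (u v : R[i]) : nc (u - v) <= d -> nc u `^ p <= nc v `^ p + e / 2.
  by move=> uv; rewrite -dp; apply: nc_powR_close => //; exact: ltW.
have h1 := sub _ _ H; rewrite ncBC in H; have h2 := sub _ _ H.
by rewrite ltr_norml; lra.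
Qed.

Lemma mesh_point a h x n : 0 < h -> a <= x <= a + n.+1%:R * h ->
  exists2 j, (j < n.+1)%N & a + j%:R * h <= x <= a + j.+1%:R * h.
Proof.
move=> h0; elim: n => [|n ih] /andP[ax xb].
  by exists 0%N => //; rewrite mul0r addr0 ax.
have [xl|xl] := leP x (a + n.+1%:R * h).
  by have [|j jn Hj] := ih; [rewrite ax|exists j => //; rewrite ltnW].
by exists n.+1 => //; rewrite (ltW xl).
Qed.

(* [K] is a Riemann sum for the Poisson integral of [phi], moved up by the mesh [h] so that
   each term dominates [phi] on its own cell. *)
Lemma poisson_majorant (phi : R -> R) a b h n (d : R) : 0 < h -> 0 <= d -> b = a + n.+1%:R * h ->
  continuous phi -> (forall x, 0 <= phi x) ->
  (forall x y, a <= x <= b -> a <= y <= b -> `|x - y| <= h -> phi x <= phi y + d) ->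
  exists K : R[i] -> R[i], [/\ forall z, 0 <= complex.Im z -> taylor2 K z,
    forall z, 0 <= complex.Im z -> 0 <= complex.Re (K z),
    forall x, a <= x <= b -> phi x <= complex.Re (K x%:C) &
    forall z, 0 < complex.Im z ->
      complex.Re (K z) <= 2 * (prim phi b - prim phi a + d * (b - a)) / complex.Im z].
Proof.
move=> h0 d0 bE cphi phi0 osc.
pose t j : R := a + j%:R * h.
have tS j : t j.+1 = t j + h by rewrite /t -addn1 natrD; ring.
(* The integral of [phi] over the cell, enlarged by its oscillation, so that [A j / h] dominates
   [phi] on the whole cell. *)
pose A j := prim phi (t j.+1) - prim phi (t j) + d * h.
have dh : 0 <= d * h by rewrite mulr_ge0// ltW.
have A0 j : 0 <= A j.
  have : prim phi (t j) <= prim phi (t j.+1) by apply: prim_mono => //; rewrite tS; lra.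
  by rewrite /A; lra.
pose P j z := ('i / (z - (t j -i* h))) : R[i].
pose K z := \sum_(j < n.+1) (2 * A j)%:C * P j z.
have PE j z : complex.Re (P j z) = (complex.Im z + h) / ((complex.Re z - t j) ^+ 2 + (complex.Im z + h) ^+ 2).
  exact: Re_poisson.
have KE z : complex.Re (K z) = \sum_(j < n.+1) 2 * A j * complex.Re (P j z).
  by rewrite /K (Re_sum n.+1 (fun j => (2 * A j)%:C * P j z)); apply: eq_bigr => j _; rewrite ReM mul0r subr0.
have P0 j z : 0 <= complex.Im z -> 0 <= complex.Re (P j z).
  by move=> z0; rewrite PE divr_ge0 ?addr_ge0 ?sqr_ge0// ltW.
exists K; split.
- move=> z z0; apply: (@taylor2_sum n.+1 (fun j w => (2 * A j)%:C * P j w)) => j.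
  apply: taylor2Z; apply: taylor2Z; apply: taylor2_inv.
  by apply/eqP => /(congr1 (@complex.Im R)) /= E; move: z0; rewrite E; lra.
- by move=> z z0; rewrite KE; apply: sumr_ge0 => j _; rewrite mulr_ge0 ?P0// mulr_ge0.
- move=> x xab; have xab' : a <= x <= a + n.+1%:R * h by rewrite -bE.
  have [j jn tj] := mesh_point h0 xab'.
  have Aj : phi x <= A j / h.
    rewrite ler_pdivlMr// /A -lerBlDr -mulrBl.
    have -> : (phi x - d) * h = ((phi x - d) * t j.+1 - (phi x - d) * t j) by rewrite tS; ring.
    have L (u : R) : is_derive u 1 (fun u => (phi x - d) * u) (phi x - d).
      by apply: is_derive_eq; rewrite /GRing.scale /=; ring.
    apply: (derive_le _ L (primP cphi)); first by rewrite tS; lra.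
    move=> y; rewrite tS => /andP[y1 y2].
    have tn : t j + h <= b.
      rewrite -tS bE /t lerD2l ler_wpM2r ?(ltW h0)// ler_nat//.
    have at_ : a <= t j by rewrite /t lerDl mulr_ge0// ltW.
    have tj' : t j <= x <= t j + h by rewrite -tS.
    rewrite lerBlDr; apply: osc => //; first by apply/andP; split; lra.
    by rewrite ler_norml; lra.
  (* The term of the cell of [x] suffices, the others being nonnegative. At horizontal distance at
     most [h] the kernel [h / ((x - t j)^2 + h^2)] is at least [1 / (2 h)], whence the factor 2 in
     [K]. *)
  apply: (le_trans Aj); rewrite KE (bigD1 (Ordinal jn)) // -[leLHS]addr0.
  apply: lerD; last by apply: sumr_ge0 => i _; apply: mulr_ge0; [exact: mulr_ge0|apply: P0; exact: lexx].
  rewrite PE /= add0r [leLHS]mulrC [in leRHS](mulrC 2) -mulrA mulrC ler_wpM2l//.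
  have tj' : t j <= x <= t j + h by rewrite -tS.
  have hh : (x - t j) ^+ 2 <= h ^+ 2 by rewrite lerXn2r ?nnegrE; lra.
  have h2 : 0 < h ^+ 2 by rewrite exprn_gt0.
  have q0 : 0 < (x - t j) ^+ 2 + h ^+ 2 by have := sqr_ge0 (x - t j); lra.
  rewrite mulrA ler_pdivlMr// mulrC -ler_pdivlMr ?invr_gt0// invrK.
  by rewrite -mulrA -expr2; lra.
- move=> z z0; rewrite KE.
  have PI j : complex.Re (P j z) <= (complex.Im z)^-1.
    have yh : 0 < complex.Im z + h by lra.
    have sq : 0 <= (complex.Re z - t j) ^+ 2 by exact: sqr_ge0.
    have q0 : 0 < (complex.Re z - t j) ^+ 2 + (complex.Im z + h) ^+ 2.
      by have := exprn_gt0 2 yh; lra.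
    rewrite PE ler_pdivrMr// mulrC ler_pdivlMr// expr2.
    by have := mulr_ge0 (ltW yh) (ltW h0); lra.
  have -> : 2 * (prim phi b - prim phi a + d * (b - a)) / complex.Im z =
      \sum_(j < n.+1) 2 * A j * (complex.Im z)^-1.
    rewrite -mulr_suml -mulr_sumr; congr (2 * _ / _).
    rewrite big_split /= -(big_mkord xpredT (fun j => prim phi (t j.+1) - prim phi (t j))).
    rewrite telescope_sumr//.
    rewrite sumr_const card_ord /t -bE mul0r addr0 -mulr_natl bE; ring.
  by apply: ler_sum => j _; rewrite ler_wpM2l ?PI// mulr_ge0.
Qed.

(** The Poisson sum majorizes [|f|^p] on the bottom side and the constant [m] does so on the other
    three; the oscillation error disappears as the mesh is refined. *)
Lemma rect_estimate f a b h p m J : entire f -> 0 < p -> p <= 1 -> a < b -> 0 < h ->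
  0 <= m -> prim (fun x => nc (f x%:C) `^ p) b - prim (fun x => nc (f x%:C) `^ p) a <= J ->
  (forall z, rectangle a 0 (b - a) h z -> complex.Re z = a \/ complex.Re z = b \/ complex.Im z = h ->
     nc (f z) `^ p <= m) ->
  forall z, rectangle a 0 (b - a) h z -> 0 < complex.Im z ->
    nc (f z) `^ p <= 2 * J / complex.Im z + m.
Proof.
move=> ef p0 p1 ab h0 m0 HJ Hm z Qz z0; apply/ler_addgt0Pl => e e0.
set phi := (fun x => _) in HJ.
have cphi : continuous phi by exact: powR_nc_cont.
have ba : 0 < b - a by lra.
(* This is the contribution of the oscillation [d] to the bound of [poisson_majorant] at the given
   point [z]. *)
have [d d0 dE] : exists2 d, 0 < d & 2 * (d * (b - a)) / complex.Im z = e.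
  exists (e * complex.Im z / (2 * (b - a))); first by rewrite !(divr_gt0, mulr_gt0).
  by field; rewrite !gt_eqF.
have [c c0 cp] := powR_small p0 d0.
have [r r0 Hr] := entire_unif_cont a 0 ef (ltW ba) (lexx 0) c0.
pose n := Num.bound ((b - a) / r).
pose l := (b - a) / n.+1%:R.
have l0 : 0 < l by rewrite divr_gt0.
have bE : b = a + n.+1%:R * l by rewrite /l mulrC divfK ?pnatr_eq0//; ring.
have lr : l <= r.
  rewrite ler_pdivrMr// mulrC -ler_pdivrMr// (le_trans (ltW (archi_boundP _)))//.
    by rewrite divr_ge0// ltW.
  by rewrite ler_nat.
have phi0 x : 0 <= phi x by exact: powR_ge0.
have osc x y : a <= x <= b -> a <= y <= b -> `|x - y| <= l -> phi x <= phi y + d.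
  move=> xab yab xy.
  have H : nc (f x%:C - f y%:C) <= c.
    have := Hr y%:C _ (x - y)%:C; rewrite ncR rmorphB subrKC; apply.
      by split => /=; lra.
    exact: le_trans xy lr.
  by rewrite -cp; apply: nc_powR_close => //; exact: ltW.
have [K [tK K0 Kphi KJ]] := poisson_majorant l0 (ltW d0) bE cphi phi0 osc.
have Hz : nc (f z) `^ p <= complex.Re (K z) + m.
  have tQ u : rectangle a 0 (b - a) h u -> taylor2 K u by case=> _ /andP[u0 _]; exact: tK.
  apply: (@max_principle_entire R f (fun z => complex.Re (K z)) a 0 (b - a) h) => //; try lra.
  - move=> u Qu e' e'0; have [s s0 Hs] := taylor2_cont (tQ u Qu) e'0.
    exists s => // k /Hs; apply: le_trans.
    by rewrite -ReN -ReD; exact: Re_le_nc.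
  - move=> u [ux uy]; have tN := @taylor2Z K (-1) u _.
    have -> : (fun z => - complex.Re (K z)) = (fun z => complex.Re (-1 * K z)).
      by apply/funext => v; rewrite mulN1r ReN.
    by apply: sub4_Re; apply: tN; apply: tQ; split; lra.
  - move=> u [Qu Bu]; have [|uy] := pselect (complex.Im u = 0).
      case: u Qu {Bu} => x y [/= xab _] y0.
      rewrite y0 -/(x%:C); apply: (@le_trans _ _ (complex.Re (K x%:C))); last by lra.
      by apply: Kphi; lra.
    have u0 : 0 <= complex.Im u by case: Qu => _ /andP[].
    have := K0 u u0; have : nc (f u) `^ p <= m; last by lra.
    apply: Hm => //; case: Bu => // Eu; [by left|by right; left; lra|by right; right; lra].
apply: (le_trans Hz); rewrite addrCA addrC.
rewrite -addrA (addrC m) addrA lerD2r (le_trans (KJ z z0))// -dE -mulrDl.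
by rewrite ler_wpM2r ?invr_ge0 ?(ltW z0)//; lra.
Qed.

End PoissonMajorant.
(** * The Phragmen-Lindelof estimate *)

Section ComplexExponential.
Variable R : realType.
Implicit Types (z w h : R[i]) (x y t e : R).

Definition cexp z : R[i] :=
  (expR (complex.Re z))%:C * (cos (complex.Im z) +i* sin (complex.Im z)).

Lemma nc_cexp z : nc (cexp z) = expR (complex.Re z).
Proof.
by rewrite /cexp ncM ncR /= cos2Dsin2 sqrtr1 mulr1 ger0_norm// expR_ge0.
Qed.

Lemma cexp0 : cexp 0 = 1.
Proof. by rewrite /cexp /= expR0 cos0 sin0 mul1r. Qed.

Lemma cexpD z w : cexp (z + w) = cexp z * cexp w.
Proof.
rewrite /cexp ReD ImD expRD cosD sinD; apply/eqP; rewrite eq_complex /=.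
by apply/andP; split; apply/eqP; ring.
Qed.

Lemma cexpR x : cexp x%:C = (expR x)%:C.
Proof. by rewrite /cexp /= cos0 sin0; apply/eqP; rewrite eq_complex /= !mulr0 !mul0r subr0 addr0 mulr1 !eqxx. Qed.

Lemma cexp_line_Re h t : is_derive t 1 (@complex.Re R \o (fun t => cexp (h * t%:C)))
  (complex.Re (h * cexp (h * t%:C))).
Proof.
have -> : @complex.Re R \o (fun t => cexp (h * t%:C)) =
  (fun t => expR (complex.Re h * t) * cos (complex.Im h * t)).
  apply/funext => s; rewrite /= /cexp !(ReM, ImM) /=.
  by rewrite !mulr0 subr0 mul0r subr0 add0r.
apply: is_derive_eq; rewrite /cexp !(ReM, ImM) /= /GRing.scale /=.
by rewrite !mulr0 !mul0r !subr0 !add0r !addr0; ring.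
Qed.

Lemma cexp_line_Im h t : is_derive t 1 (@complex.Im R \o (fun t => cexp (h * t%:C)))
  (complex.Im (h * cexp (h * t%:C))).
Proof.
have -> : @complex.Im R \o (fun t => cexp (h * t%:C)) =
  (fun t => expR (complex.Re h * t) * sin (complex.Im h * t)).
  apply/funext => s; rewrite /= /cexp !(ReM, ImM) /=.
  by rewrite !mulr0 subr0 mul0r !add0r addr0.
apply: is_derive_eq; rewrite /cexp !(ReM, ImM) /= /GRing.scale /=.
by rewrite !mulr0 !mul0r !subr0 !add0r !addr0; ring.
Qed.

(** The mean value inequality along the segment from [0] to [z], where the real part is extremal at
    an endpoint. *)
Lemma cexp_sub1 z : nc (cexp z - 1) <= 2 * nc z * Num.max 1 (expR (complex.Re z)).
Proof.
have dz t : is_derive t 1 (@complex.Re R \o (cst 0 : R -> R[i])) (complex.Re (0 : R[i])).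
  exact: is_derive_cst.
have dz' t : is_derive t 1 (@complex.Im R \o (cst 0 : R -> R[i])) (complex.Im (0 : R[i])).
  exact: is_derive_cst.
have := @complex_mvt R (fun t => cexp (z * t%:C)) (cst 0) (fun t => z * cexp (z * t%:C)) (fun=> 0)
  0 1 (nc z * Num.max 1 (expR (complex.Re z))) ler01 (cexp_line_Re z) (cexp_line_Im z) dz dz'.
rewrite !subr0 !mulr1 mulr0 cexp0 mulrA; apply => t /andP[t0 t1].
rewrite subr0 ncM nc_cexp ler_wpM2l ?nc_ge0// ReM /= mulr0 subr0.
have [z0|z0] := leP 0 (complex.Re z).
  by rewrite le_max ler_expR ler_piMr// orbT.
by rewrite le_max -[leRHS]expR0 ler_expR mulr_le0_ge0// ltW.
Qed.

Lemma Re_le_ncW z : complex.Re z <= nc z.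
Proof. exact: le_trans (ler_norm _) (Re_le_nc z). Qed.

Lemma cexp_sub1_sub z : nc (cexp z - 1 - z) <= 4 * nc z ^+ 2 * expR (nc z).
Proof.
have dz t : is_derive t 1 (@complex.Re R \o (fun t => z * t%:C)) (complex.Re z).
  have -> : @complex.Re R \o (fun t => z * t%:C) = (fun t => complex.Re z * t).
    by apply/funext => s /=; rewrite ReM /= mulr0 subr0.
  by apply: is_derive_eq; rewrite /GRing.scale /=; ring.
have dz' t : is_derive t 1 (@complex.Im R \o (fun t => z * t%:C)) (complex.Im z).
  have -> : @complex.Im R \o (fun t => z * t%:C) = (fun t => complex.Im z * t).
    by apply/funext => s /=; rewrite ImM /= mulr0 add0r.
  by apply: is_derive_eq; rewrite /GRing.scale /=; ring.
have := @complex_mvt R (fun t => cexp (z * t%:C)) (fun t => z * t%:C) (fun t => z * cexp (z * t%:C)) (fun=> z)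
  0 1 (nc z * (2 * nc z * expR (nc z))) ler01 (cexp_line_Re z) (cexp_line_Im z) dz dz'.
rewrite !subr0 !mulr1 mulr0 cexp0 subr0.
rewrite (_ : 2 * (_ * _) = 4 * nc z ^+ 2 * expR (nc z)); last by ring.
apply => t /andP[t0 t1].
rewrite -{3}[z]mulr1 -mulrBr ncM ler_wpM2l ?nc_ge0// (le_trans (cexp_sub1 _))//.
have zt : nc (z * t%:C) <= nc z by rewrite ncM ncR ger0_norm// ler_piMr// nc_ge0.
apply: ler_pM => //.
- by rewrite mulr_ge0// nc_ge0.
- by rewrite ler_wpM2l.
- rewrite ge_max ler_expR (le_trans (Re_le_ncW _) zt) andbT.
  by rewrite -[leLHS]expR0 ler_expR nc_ge0.
Qed.

Lemma entire_cexp : entire cexp.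
Proof.
apply/entireP => z; exists (cexp z) => e e0.
pose M := nc (cexp z) * 4 * expR 1.
have M0 : 0 < M by rewrite !mulr_gt0 ?nc_cexp ?expR_gt0.
exists (Num.min 1 (e / M)); first by rewrite lt_min ltr01 divr_gt0.
move=> h; rewrite lt_min ltr_pdivlMr// => /andP[h1 hM].
rewrite cexpD (_ : _ - _ = cexp z * (cexp h - 1 - h)); last by ring.
rewrite ncM; apply: (le_trans (ler_wpM2l (nc_ge0 _) (cexp_sub1_sub h))).
have E1 : expR (nc h) <= expR 1 by rewrite ler_expR ltW.
have N0 := nc_ge0 h.
have C0 : 0 <= nc (cexp z) * 4 * nc h ^+ 2.
  by rewrite !mulr_ge0 ?sqr_ge0// nc_ge0.
have := ler_wpM2l C0 E1; have := ler_wpM2l N0 (ltW hM).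
by rewrite /M; lra.
Qed.

Lemma powR_expR x p : (expR x) `^ p = expR (p * x).
Proof. by rewrite /powR gt_eqF ?expR_gt0// expRK. Qed.

End ComplexExponential.

(** * Growth in the upper half-plane *)

Section PhragmenLindelof.
Variable R : realType.
Implicit Types (f : R[i] -> R[i]) (x y a b h p J A M q d e : R).

(* This says that the integral of [|f|^p] over the real line is at most
   [J]; primitives replace the Lebesgue integral until [mass_le_of_norm]. *)
Definition boundary_mass_le f p J := forall a b : R, a <= b ->
  prim (fun x => nc (f x%:C) `^ p) b - prim (fun x => nc (f x%:C) `^ p) a <= J.

(** [A] absorbs the growth in [y], [q] tilts the damping towards one quarter-plane, and [d] gives
    Gaussian decay in [x]. On the real line the factor has modulus [exp (- d x^2)], so for [d >= 0]
    it does not increase the boundary mass. *)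
Definition twist f A q d (z : R[i]) : R[i] :=
  f z * cexp ((A *i) * z + ((- d) +i* (q / 2)) * (z * z)).

Lemma entire_twist f A q d : entire f -> entire (twist f A q d).
Proof.
move=> ef; apply: (@entireM R f _ ef).
have e1 := @entireM R (fun=> A *i) id (@entire_cst R _) (@entire_id R).
have e2 := @entireM R id id (@entire_id R) (@entire_id R).
have e3 := @entireM R (fun=> (- d) +i* (q / 2)) _ (@entire_cst R _) e2.
exact: (@entire_comp R _ (@cexp R) (@entireD R _ _ e1 e3) (@entire_cexp R)).
Qed.

Lemma nc_twist f A q d x y : nc (twist f A q d (x +i* y)) =
  nc (f (x +i* y)) * expR (- A * y - q * x * y - d * (x ^+ 2 - y ^+ 2)).
Proof.
rewrite /twist ncM nc_cexp; congr (_ * expR _).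
by rewrite !(ReD, ReM, ImM) /=; field.
Qed.

Lemma twist_estimate f A q d a b h p J M : entire f -> 0 < p -> p <= 1 ->
  a < b -> 0 < h -> 0 <= d -> 0 <= M -> boundary_mass_le f p J ->
  (forall x y, a <= x <= b -> 0 <= y <= h -> [\/ x = a, x = b | y = h] ->
    nc (f (x +i* y)) * expR (- A * y - q * x * y - d * (x ^+ 2 - y ^+ 2)) <= M) ->
  forall x y, a <= x <= b -> 0 < y <= h ->
    nc (f (x +i* y)) `^ p * expR (p * (- A * y - q * x * y - d * (x ^+ 2 - y ^+ 2)))
    <= 2 * J / y + M `^ p.
Proof.
move=> ef p0 p1 ab h0 d0 M0 HJ HM x y xab /andP[y0 yh].
rewrite -powR_expR -powRM ?nc_ge0 ?expR_ge0// -nc_twist.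
have eT := @entire_twist f A q d ef.
apply: (rect_estimate eT p0 p1 ab h0 (powR_ge0 _ _) _ _ _) => //=.
- apply: le_trans (HJ a b (ltW ab)).
  apply: (derive_le (ltW ab) (primP (powR_nc_cont eT p0 p1)) (primP (powR_nc_cont ef p0 p1))) => t _.
  apply: powR_le; rewrite ?nc_ge0 ?(ltW p0)//.
  rewrite (nc_twist f A q d t 0) ler_piMr ?nc_ge0// -[leRHS]expR0 ler_expR.
  by rewrite !mulr0 expr0n /= !subr0 sub0r oppr_le0 mulr_ge0 ?sqr_ge0.
- move=> [u v] [/= uab vh] Hb; apply: powR_le; rewrite ?nc_ge0 ?(ltW p0)//.
  rewrite nc_twist; apply: HM; try lra.
  by case: Hb => [->|[->|->]]; [apply: Or31|apply: Or32|apply: Or33].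
- by split => /=; lra.
Qed.

Lemma exponential_type_bound f e : exponential_type pi f -> 0 < e ->
  exists2 K, 0 < K & forall x y,
    nc (f (x +i* y)) <= K * expR ((pi + e) * (`|x| + `|y|)).
Proof.
move=> tf e0; have [K K0 HK] := tf e e0; exists K => // x y.
apply: (le_trans (HK _)); rewrite ler_pM2l// ler_expR ler_wpM2l//.
  by have := pi_ge0 R; lra.
exact: nc_le_ReIm.
Qed.

(* On the quarter plane [q x >= 0] the factor [exp (i q z^2 / 2)] has modulus
   [exp (- q x y)]: at height [A / |q|] it exactly compensates the growth [exp (A |x|)]. *)
Lemma quadrant_bound f p J e : entire f -> exponential_type pi f -> 0 < p -> p <= 1 ->
  boundary_mass_le f p J -> 0 < e ->
  exists2 K, 0 < K & forall x y, 0 < y ->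
    nc (f (x +i* y)) `^ p * expR (- (p * ((pi + e) * y))) <= expR 1 * (2 * J / y + K).
Proof.
move=> ef tf p0 p1 HJ e0; have [K K0 HK] := exponential_type_bound tf e0.
exists (expR 1 * K `^ p); first by rewrite mulr_gt0 ?expR_gt0 ?powR_gt0.
move=> x y y0.
pose A : R := pi + e.
have A0 : 0 < A by rewrite /A; have := pi_gt0 R; lra.
(* [s] is the sign of [x] and selects the quarter-plane that contains the point. *)
have [s s1 sx] : exists2 s : R, s * s = 1 & s * x = `|x|.
  have [x0|x0] := leP 0 x; first by exists 1; rewrite ?mulr1 ?mul1r ?ger0_norm.
  by exists (-1); rewrite ?mulN1r ?opprK ?ltr0_norm.
have s2 : s = 1 \/ s = -1.
  have /eqP : (s - 1) * (s + 1) = 0 by rewrite mulrDr mulrBl s1; ring.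
  by rewrite mulf_eq0 => /orP[]/eqP h; [left|right]; lra.
have x0 := normr_ge0 x.
have xy0 : 0 <= `|x| * y by rewrite mulr_ge0// ltW.
have yA0 : 0 <= y / A by rewrite divr_ge0// ltW.
(* The tilt costs at most [exp (1 / 2)] at the point itself, and the height [T = A / d], where it
   cancels the growth in [x], lies above [y]. *)
have [d [d0 dxy dA]] : exists d, [/\ 0 < d, d * (`|x| * y) <= 1 / 2 & d * y <= A].
  exists (2 + 2 * (`|x| * y) + y / A)^-1.
  have D0 : 0 < 2 + 2 * (`|x| * y) + y / A by lra.
  split; first by rewrite invr_gt0.
  - by rewrite mulrC ler_pdivrMr//; lra.
  - rewrite mulrC ler_pdivrMr// mulrC -ler_pdivrMr//; lra.
pose T := A / d.
have T0 : 0 < T by rewrite divr_gt0.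
have dT : d * T = A by rewrite /T mulrC divfK// gt_eqF.
have yT : y <= T by rewrite ler_pdivlMr// mulrC.
(* The Gaussian factor may grow by [exp (c v^2)] inside the rectangle and must be undone at [x];
   each effect is at most [exp (1 / 2)]. *)
have [c [c0 cT cx]] : exists c, [/\ 0 < c, c * T ^+ 2 <= 1 / 2 & c * x ^+ 2 <= 1 / 2].
  have := sqr_ge0 T; have := sqr_ge0 x => X1 X2.
  have D0 : 0 < 2 * (T ^+ 2 + x ^+ 2 + 1) by lra.
  exists (2 * (T ^+ 2 + x ^+ 2 + 1))^-1; split; first by rewrite invr_gt0.
  - by rewrite mulrC ler_pdivrMr//; lra.
  - by rewrite mulrC ler_pdivrMr//; lra.
(* Wide enough for the Gaussian decay [c X^2] to beat the growth [A X] on the far side. *)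
pose X := `|x| + 1 + A / c.
have X0 : 0 < X by rewrite /X; have : 0 < A / c by [rewrite divr_gt0]; lra.
have xX : `|x| <= X by rewrite /X; have : 0 < A / c by [rewrite divr_gt0]; lra.
have cX : A <= c * X.
  by rewrite mulrC -ler_pdivrMr// /X; lra.
pose M := K * expR 1.
have M0 : 0 <= M by rewrite mulr_ge0 ?expR_ge0// ltW.
have side u v : 0 <= s * u <= X -> 0 <= v <= T -> [\/ u = 0, s * u = X | v = T] ->
    nc (f (u +i* v)) * expR (- A * v - (s * d) * u * v - c * (u ^+ 2 - v ^+ 2)) <= M.
  move=> /andP[su0 suX] /andP[v0 vT] H.
  have ua : `|u| = s * u.
    rewrite -(ger0_norm su0) normrM; case: s2 => ->; rewrite ?normrN normr1 mul1r//.
  have uu : u ^+ 2 = (s * u) ^+ 2 by rewrite exprMn [s ^+ 2]expr2 s1 mul1r.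
  apply: (le_trans (ler_wpM2r (expR_ge0 _) (HK u v))).
  rewrite /M -(mulrA K).
 rewrite ler_pM2l// -expRD ler_expR -/A ua uu (ger0_norm v0).
  have vv : v ^+ 2 <= T ^+ 2 by rewrite lerXn2r ?nnegrE// ltW.
  have cv := ler_wpM2l (ltW c0) vv.
  have E : A * (s * u) - d * (s * u) * v - c * (s * u) ^+ 2 <= 0.
    have cu : 0 <= c * (s * u) ^+ 2 by rewrite mulr_ge0 ?sqr_ge0// ltW.
    case: H => H.
    - by rewrite H !(mulr0, mul0r) expr0n /= mulr0; lra.
    - rewrite H; have := ler_wpM2r (ltW X0) cX.
      have : 0 <= d * X * v by rewrite !mulr_ge0// ltW.
      by rewrite expr2; lra.
    - by rewrite H (mulrAC d) dT; lra.
  rewrite (_ : s * d * u * v = d * (s * u) * v); last by ring.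
  move: E cv cT; move: (s * u) => w.
  by lra.
have H : nc (f (x +i* y)) `^ p * expR (p * (- A * y - (s * d) * x * y - c * (x ^+ 2 - y ^+ 2)))
    <= 2 * J / y + M `^ p.
  have yT' : 0 < y <= T by rewrite y0.
  move: side sx; case: s2 => -> side sx.
  - apply: (@twist_estimate f A (1 * d) c 0 X T p J M) => //; try lra.
    move=> u v u0 v0 h; apply: side; rewrite ?mul1r//.
  - apply: (@twist_estimate f A (-1 * d) c (- X) 0 T p J M) => //; try lra.
    move=> u v u0 v0 h; apply: side => //; first lra.
    by case: h => h; [apply: Or32; lra|apply: Or31|apply: Or33].
have Mp : M `^ p <= expR 1 * K `^ p.
  rewrite powRM ?expR_ge0 ?(ltW K0)// mulrC ler_wpM2r ?powR_ge0// powR_expR ler_expR; lra.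
have E : expR (- 1) * expR (- (p * (A * y))) <=
    expR (p * (- A * y - (s * d) * x * y - c * (x ^+ 2 - y ^+ 2))).
  rewrite -expRD ler_expR.
  have cy : 0 <= c * y ^+ 2 by rewrite mulr_ge0 ?sqr_ge0// ltW.
  have sxy : s * d * x * y = d * (`|x| * y) by rewrite -sx; ring.
  rewrite sxy.
  have hh : d * (`|x| * y) + c * (x ^+ 2 - y ^+ 2) <= 1 by lra.
  by have := ler_wpM2l (ltW p0) hh; clear -p1; lra.
have := ler_wpM2l (powR_ge0 (nc (f (x +i* y))) p) E.
rewrite mulrCA => /le_trans/(_ H) /(ler_wpM2l (expR_ge0 1)).
rewrite (mulrA (expR 1) (expR (- 1))) -expRD subrr expR0 mul1r => /le_trans; apply.
by rewrite ler_wpM2l ?expR_ge0// lerD2l.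
Qed.

(** The second pass. By [quadrant_bound] the function times [exp (- (pi + e) y)] is bounded for
    [y >= 1], so one more [e] in the exponent makes it small on a high top side, while the Gaussian
    handles the vertical sides. Everything except the boundary mass falls below an arbitrary
    [eta]. *)
Lemma half_plane_estimate f p J : entire f -> exponential_type pi f -> 0 < p -> p <= 1 ->
  boundary_mass_le f p J -> forall x y, 0 < y ->
  nc (f (x +i* y)) `^ p * expR (- (p * (pi * y))) <= expR 1 * (2 * J / y).
Proof.
move=> ef tf p0 p1 HJ x y y0.
suff G eta : 0 < eta ->
    nc (f (x +i* y)) `^ p * expR (- (p * (pi * y))) <= expR 1 * (2 * J / y + eta).
  apply/ler_addgt0Pl => eta eta0.
  have e1 : 0 < eta / expR 1 by rewrite divr_gt0 ?expR_gt0.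
  by rewrite (le_trans (G _ e1))// mulrDr mulrC [expR 1 * _]mulrC divfK ?gt_eqF ?expR_gt0// addrC mulrC.
move=> eta0.
(* The total enlargement [2 e] of the exponent costs only [exp (1 / 2)] at height [y]; the Gaussian
   accounts for the other half of the factor [exp 1]. *)
pose e := (4 * y)^-1.
have e0 : 0 < e by rewrite invr_gt0 mulr_gt0.
have ey : 2 * e * y = 1 / 2 by rewrite /e; field; rewrite gt_eqF.
have [K K0 HK] := exponential_type_bound tf e0.
have [K1 K10 HK1] := quadrant_bound ef tf p0 p1 HJ e0.
have [M M0 Mp] := powR_small p0 eta0.
pose B : R := pi + e; pose A : R := pi + 2 * e.
have B0 : 0 < B by rewrite /B; have := pi_gt0 R; lra.
have BA : A = B + e by rewrite /A /B; ring.
have JJ := normr_ge0 J.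
have C0 : 0 < expR 1 * (2 * `|J| + K1) by rewrite mulr_gt0 ?expR_gt0//; lra.
have [C C'0 Cp] := powR_small p0 C0.
have top u T : 1 <= T -> nc (f (u +i* T)) * expR (- (B * T)) <= C.
  move=> T1; have T0 : 0 < T by lra.
  have : (nc (f (u +i* T)) * expR (- (B * T))) `^ p <= C `^ p.
    rewrite powRM ?nc_ge0 ?expR_ge0// powR_expR mulrN Cp.
    apply: (le_trans (HK1 u T T0)); rewrite ler_pM2l ?expR_gt0// lerD2r.
    rewrite ler_pdivrMr//.
    have h1 := ler_norm J; have : `|J| <= `|J| * T by rewrite ler_peMr.
    by lra.
  rewrite leNgt => h; rewrite leNgt; apply: contra h => h.
  by apply: gt0_ltr_powR; rewrite // nnegrE ?(ltW C'0)// mulr_ge0 ?nc_ge0 ?expR_ge0.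
(* These logarithms measure what the top and the vertical sides have to gain; [T] and [X] are chosen
   so that [e T >= L + 1] and [c X^2 >= B X + 1 + L2]. *)
pose L := ln (C / M); pose L2 := ln (K / M).
have CL : C = M * expR L by rewrite lnK ?posrE ?divr_gt0// mulrC divfK// gt_eqF.
have KL : K = M * expR L2 by rewrite lnK ?posrE ?divr_gt0// mulrC divfK// gt_eqF.
pose T := 1 + y + (`|L| + 1) / e.
have Le : 0 < (`|L| + 1) / e by rewrite divr_gt0//; have := normr_ge0 L; lra.
have T1 : 1 <= T by rewrite /T; lra.
have yT : y <= T by rewrite /T; lra.
have eT : L + 1 <= e * T.
  rewrite /T mulrDr [e * (_ / e)]mulrC divfK ?gt_eqF//.
  have : 0 < e * (1 + y) by rewrite mulr_gt0//; lra.
  by have := ler_norm L; lra.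
have [c [c0 cT cx]] : exists c, [/\ 0 < c, c * T ^+ 2 <= 1 / 2 & c * x ^+ 2 <= 1 / 2].
  have := sqr_ge0 T; have := sqr_ge0 x => X1 X2.
  have D0 : 0 < 2 * (T ^+ 2 + x ^+ 2 + 1) by lra.
  exists (2 * (T ^+ 2 + x ^+ 2 + 1))^-1; split; first by rewrite invr_gt0.
  - by rewrite mulrC ler_pdivrMr//; lra.
  - by rewrite mulrC ler_pdivrMr//; lra.
pose X := 1 + `|x| + (B + 1 + `|L2|) / c.
have Xc : 0 < (B + 1 + `|L2|) / c by rewrite divr_gt0//; have := normr_ge0 L2; lra.
have xX : `|x| <= X by rewrite /X; lra.
have X1 : 1 <= X by rewrite /X; have := normr_ge0 x; lra.
have cX : B * X + 1 + L2 <= c * X ^+ 2.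
  have h : B + 1 + `|L2| <= c * X.
    by rewrite mulrC -ler_pdivrMr// /X; have := normr_ge0 x; lra.
  have X0 : 0 <= X by lra.
  have := ler_wpM2r X0 h; rewrite expr2.
  have : `|L2| <= `|L2| * X by rewrite ler_peMr.
  by have := ler_norm L2; lra.
have H : nc (f (x +i* y)) `^ p * expR (p * (- A * y - 0 * x * y - c * (x ^+ 2 - y ^+ 2)))
    <= 2 * J / y + M `^ p.
  have XX : - X < X by clear -X1; lra.
  have T0 : 0 < T by clear -T1; lra.
  have xx : - X <= x <= X by rewrite -ler_norml.
  have yT' : 0 < y <= T by rewrite y0.
  apply: (@twist_estimate f A 0 c (- X) X T p J M ef p0 p1 XX T0 (ltW c0) (ltW M0) HJ _ x y xx yT').
    move=> u v uX /andP[v0 vT] h.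
    have vv : v ^+ 2 <= T ^+ 2 by rewrite lerXn2r ?nnegrE// ltW.
    have cv := ler_wpM2l (ltW c0) vv.
    have S : u ^+ 2 = X ^+ 2 -> nc (f (u +i* v)) * expR (- A * v - 0 * u * v - c * (u ^+ 2 - v ^+ 2)) <= M.
      move=> uu; have ua : `|u| = X.
        apply/eqP; rewrite -(eqrXn2 (n := 2)) //; last by clear -X1; lra.
        by rewrite real_normK ?num_real// uu.
      apply: (le_trans (ler_wpM2r (expR_ge0 _) (HK u v))).
      rewrite KL -!mulrA ger_pMr// -!expRD -[leRHS]expR0 ler_expR -/B ua uu.
      rewrite (ger0_norm v0) BA.
      have : 0 <= e * v by rewrite mulr_ge0// ltW.
      by lra.
    case: h => h; first by apply: S => //; rewrite h sqrrN.
    - by apply: S => //; rewrite h.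
    - rewrite h.
      have := ler_wpM2r (expR_ge0 (- e * T - c * (u ^+ 2 - T ^+ 2))) (top u T T1).
      rewrite -(mulrA (nc _)) -expRD => h1; apply: le_trans (le_trans h1 _).
        rewrite ler_wpM2l ?nc_ge0// ler_expR BA; lra.
      rewrite CL -(mulrA M) ger_pMr// -expRD -[leRHS]expR0 ler_expR.
      have : 0 <= c * u ^+ 2 by rewrite mulr_ge0 ?sqr_ge0// ltW.
      by lra.
have E : expR (- 1) * expR (- (p * (pi * y))) <=
    expR (p * (- A * y - 0 * x * y - c * (x ^+ 2 - y ^+ 2))).
  rewrite -expRD ler_expR.
  have cy : 0 <= c * y ^+ 2 by rewrite mulr_ge0 ?sqr_ge0// ltW.
  have hh : 2 * e * y + c * (x ^+ 2 - y ^+ 2) <= 1 by lra.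
  by rewrite /A; have := ler_wpM2l (ltW p0) hh; clear -p1; lra.
have := ler_wpM2l (powR_ge0 (nc (f (x +i* y))) p) E.
rewrite mulrCA => /le_trans/(_ H) /(ler_wpM2l (expR_ge0 1)).
rewrite (mulrA (expR 1) (expR (- 1))) -expRD subrr expR0 mul1r => /le_trans; apply.
by rewrite Mp.
Qed.

End PhragmenLindelof.
(** * The spaces E^p and their envelopes *)

Section LebesgueLink.
Variable R : realType.
Implicit Types (f : R[i] -> R[i]) (g : R -> R) (a b p J c : R).
Local Notation mu := (@lebesgue_measure R).

Lemma integral_prim g a b : continuous g -> a < b ->
  (\int[mu]_(x in `[a, b]) (g x)%:E = (prim g b - prim g a)%:E)%E.
Proof.
move=> cg ab; rewrite EFinB; apply: continuous_FTC2 => //.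
- exact: continuous_subspaceT.
- split.
  + by move=> x _; have [] := primP cg x.
  + by apply: cvg_at_right_filter; exact: (is_derive_continuous (primP cg a)).
  + by apply: cvg_at_left_filter; exact: (is_derive_continuous (primP cg b)).
- by move=> x _; rewrite derive1E; have [] := primP cg x.
Qed.

Lemma prim_le_integral g a b : continuous g -> (forall x, 0 <= g x) -> a <= b ->
  ((prim g b - prim g a)%:E <= \int[mu]_x (g x)%:E)%E.
Proof.
move=> cg g0; rewrite le_eqVlt => /predU1P[->|ab].
  by rewrite subrr; apply: integral_ge0 => x _; rewrite lee_fin.
rewrite -integral_prim//; apply: ge0_subset_integral => //=.
- by apply/measurable_EFinP; exact: continuous_measurable_fun.
- by move=> x _; rewrite lee_fin.
Qed.

Lemma integral_le_prim g J : continuous g -> (forall x, 0 <= g x) ->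
  (forall a b, a <= b -> prim g b - prim g a <= J) ->
  (\int[mu]_x (g x)%:E <= J%:E)%E.
Proof.
move=> cg g0 HJ.
have mg : measurable_fun [set: R] (EFin \o g).
  by apply/measurable_EFinP; exact: continuous_measurable_fun.
(* The successor keeps every interval nondegenerate, as [integral_prim] asks for [a < b]. *)
pose F n : set R := `[- n.+1%:R, n.+1%:R]%classic.
have UF : \bigcup_n F n = [set: R].
  rewrite -subTset => x _; exists (Num.bound `|x|) => //=; rewrite /F /= in_itv /= -ler_norml.
  have := archi_boundP (normr_ge0 x) => /ltW /le_trans; apply.
  by rewrite ler_nat.
have ndF : nondecreasing_seq F.
  move=> m n mn; rewrite subsetEset => x; rewrite /F /= !in_itv /= -!ler_norml => /le_trans; apply.
  by rewrite ler_nat ltnS.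
have mF i : measurable (F i) by exact: measurable_itv.
have mgF i : measurable_fun (F i) (EFin \o g) by exact: measurable_funTS.
have g0F i x : F i x -> (0 <= (EFin \o g) x)%E by rewrite lee_fin.
have := ge0_nondecreasing_set_cvg_integral (mu := mu) ndF mF mgF g0F.
rewrite UF => cF.
rewrite -(cvg_lim _ cF)//; apply: lime_le; first by apply/cvg_ex; eexists; exact: cF.
apply: nearW => n; rewrite /F integral_prim//; last by have := ltr0Sn R n; lra.
by rewrite lee_fin; apply: HJ; have := ltr0Sn R n; lra.
Qed.

Lemma Ep_norm_powR p f : p != 0 ->
  ((Ep_norm p f) `^ p)%E = (\int[mu]_x (nc (f x%:C) `^ p)%:E)%E.
Proof.
move=> p0; rewrite /Ep_norm (poweR_Lnorm _ _ p0); apply: eq_integral => x _.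
by rewrite /= ger0_norm ?nc_ge0// poweR_EFin.
Qed.

Lemma mass_le_of_norm p f c : entire f -> 0 < p -> p <= 1 -> 0 <= c ->
  (Ep_norm p f <= c%:E)%E -> boundary_mass_le f p (c `^ p).
Proof.
move=> ef p0 p1 c0 Hc a b ab; rewrite -lee_fin.
apply: (le_trans (prim_le_integral (powR_nc_cont ef p0 p1) (fun x => powR_ge0 _ _) ab)).
rewrite -Ep_norm_powR ?gt_eqF// -poweR_EFin.
apply: gt0_ler_poweR => //; first exact: ltW.
- by rewrite in_itv /= leey andbT; exact: Lnorm_ge0.
- by rewrite in_itv /= leey andbT lee_fin.
Qed.

Lemma norm_le_of_mass p f J : entire f -> 0 < p -> p <= 1 -> boundary_mass_le f p J ->
  (Ep_norm p f <= (J `^ p^-1)%:E)%E.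
Proof.
move=> ef p0 p1 HJ.
have J0 : 0 <= J by have := HJ 0 0 (lexx 0); rewrite subrr.
have N0 : (0 <= Ep_norm p f)%E by exact: Lnorm_ge0.
have I0 : (0 <= \int[mu]_x (nc (f x%:C) `^ p)%:E)%E.
  by apply: integral_ge0 => x _; rewrite lee_fin powR_ge0.
rewrite -[leLHS]poweRe1// -(divff (lt0r_neq0 p0)) poweRrM Ep_norm_powR ?gt_eqF//.
rewrite -poweR_EFin; apply: gt0_ler_poweR.
- by rewrite invr_ge0 ltW.
- by rewrite in_itv /= leey andbT.
- by rewrite in_itv /= leey andbT lee_fin.
- exact: (integral_le_prim (powR_nc_cont ef p0 p1) (fun x => powR_ge0 _ _) HJ).
Qed.

Lemma Ep_space_mass p f : 0 < p -> p <= 1 -> Ep_space p f -> exists J, boundary_mass_le f p J.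
Proof.
move=> p0 p1 [ef _ fp].
exists ((fine (Ep_norm p f)) `^ p); apply: mass_le_of_norm => //.
  by rewrite fine_ge0// Lnorm_ge0.
by rewrite fineK// ge0_fin_numE// Lnorm_ge0.
Qed.

End LebesgueLink.

(** * Boundedness on the real line and inclusion in E^1 *)

Section BoundedOnLine.
Variable R : realType.
Implicit Types (f : R[i] -> R[i]) (x y p J B : R).

(** Schwarz reflection, which carries the half-plane estimate to the lower half-plane. *)
Definition reflect f (z : R[i]) : R[i] := (f z^*%C)^*%C.

Lemma nc_conj (z : R[i]) : nc z^*%C = nc z.
Proof. by case: z => a b; rewrite /= sqrrN. Qed.

Lemma entire_reflect f : entire f -> entire (reflect f).
Proof.
move=> /entireP ef; apply/entireP => z; have [d Hd] := ef z^*%C.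
exists d^*%C => e e0; have [r r0 Hr] := Hd e e0; exists r => // h hr.
rewrite -nc_conj in hr; have := Hr _ hr; rewrite nc_conj; apply: le_trans.
rewrite -nc_conj /reflect le_eqVlt; apply/orP; left; apply/eqP; congr (nc _).
by rewrite !(rmorphB, rmorphD, rmorphM) /= !conjcK.
Qed.

Lemma exponential_type_reflect t f : exponential_type t f -> exponential_type t (reflect f).
Proof.
move=> tf e e0; have [K K0 HK] := tf e e0; exists K => // z.
by rewrite /reflect nc_conj -(nc_conj z).
Qed.

Lemma boundary_mass_reflect f p J : boundary_mass_le f p J -> boundary_mass_le (reflect f) p J.
Proof.
rewrite /boundary_mass_le.
have -> // : (fun x => nc (reflect f x%:C) `^ p) = (fun x => nc (f x%:C) `^ p).
by apply/funext => x; rewrite /reflect nc_conj; congr (nc (f _) `^ p); rewrite /= oppr0.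
Qed.

(** A three lines argument in the strip of height 2, with the factor [exp (- d z^2)] to control the
    vertical sides of a wide rectangle. *)
Lemma strip_bound f B : entire f -> exponential_type pi f -> 0 < B ->
  (forall x, nc (f (x +i* 1)) <= B) -> (forall x, nc (f (x +i* -1)) <= B) ->
  forall x, nc (f x%:C) <= expR 2 * B.
Proof.
move=> ef tf B0 H1 H2 x.
have [K K0 HK] := exponential_type_bound tf ltr01.
(* The factor grows by at most [exp d] on the two lines and costs [exp (d x^2)] at [x]; with this
   [d] both exponents are at most 1, whence [expR 2]. *)
pose d := (1 + x ^+ 2)^-1.
have x2 : 0 < 1 + x ^+ 2 by have := sqr_ge0 x; lra.
have d0 : 0 < d by rewrite invr_gt0.
have d1 : d * (1 + x ^+ 2) = 1 by rewrite mulVf// gt_eqF.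
have dx : 0 <= d * x ^+ 2 by rewrite mulr_ge0 ?sqr_ge0// ltW.
pose A : R := pi + 1.
have A0 : 0 < A by rewrite /A; have := pi_gt0 R; lra.
pose L := ln (K / B).
have KL : K = B * expR L by rewrite lnK ?posrE ?divr_gt0// mulrC divfK// gt_eqF.
pose X := 1 + `|x| + (2 * A + `|L|) / d.
have Xd : 0 < (2 * A + `|L|) / d by rewrite divr_gt0//; have := normr_ge0 L; lra.
have xX : `|x| <= X by rewrite /X; lra.
have X1 : 1 <= X by rewrite /X; have := normr_ge0 x; lra.
have cX : A * X + A + L <= d * X ^+ 2.
  have h : 2 * A + `|L| <= d * X.
    by rewrite [d * X]mulrC -ler_pdivrMr// /X; have := normr_ge0 x; lra.
  have X0 : 0 <= X by lra.
  have := ler_wpM2r X0 h; rewrite expr2.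
  have : `|L| <= `|L| * X by rewrite ler_peMr.
  have : A <= A * X by rewrite ler_peMr// ltW.
  by have := ler_norm L; lra.
have eT := @entire_twist R f 0 0 d ef.
have side u v : -1 <= v <= 1 -> u ^+ 2 = X ^+ 2 \/ v = 1 \/ v = -1 ->
    nc (twist f 0 0 d (u +i* v)) <= B * expR d.
  move=> v1 h; have vv : v ^+ 2 <= 1.
    by rewrite -real_normK ?num_real// exprn_ile1// ler_norml.
  have dv := ler_wpM2l (ltW d0) vv.
  have du : 0 <= d * u ^+ 2 by rewrite mulr_ge0 ?sqr_ge0// ltW.
  rewrite nc_twist; case: h => [uu|h].
    have ua : `|u| = X.
      apply/eqP; rewrite -(eqrXn2 (n := 2)) //; last by clear -X1; lra.
      by rewrite real_normK ?num_real// uu.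
    apply: (le_trans (ler_wpM2r (expR_ge0 _) (HK u v))).
    rewrite KL -!(mulrA B) ler_pM2l// -!expRD ler_expR -/A ua uu.
    have : `|v| <= 1 by rewrite ler_norml.
    by move=> /(ler_wpM2l (ltW A0)); lra.
  apply: ler_pM; rewrite ?nc_ge0 ?expR_ge0 ?ler_expR//; last by lra.
  by case: h => ->.
have : nc (twist f 0 0 d x%:C) `^ 1 <= 0 + B * expR d.
  apply: (@max_principle_entire R _ (fun=> 0) (- X) (-1) (2 * X) 2 1 (B * expR d) eT) => //; try lra.
  - by move=> z _ e e0; exists 1 => // k _; rewrite subrr normr0 ltW.
  - move=> z _ e e0; exists 1 => // t t0 _.
    by have := mulr_ge0 (ltW e0) (sqr_ge0 t); lra.
  - move=> [u v] [[/= ux vy] Hb]; rewrite powRr1 ?nc_ge0// add0r; apply: side; first lra.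
    case: Hb => /= Hb; [left|left|right|right].
    + by rewrite Hb sqrrN.
    + by congr (_ ^+ 2); lra.
    + by right; lra.
    + by left; lra.
  - by split => /=; [move: xX; rewrite ler_norml; lra|lra].
rewrite powRr1 ?nc_ge0// add0r (nc_twist f 0 0 d x 0) => h.
have := ler_wpM2l (expR_ge0 (d * x ^+ 2)) h.
rewrite mulrCA -expRD (_ : d * x ^+ 2 + _ = 0); last by ring.
rewrite expR0 mulr1 => /le_trans; apply.
rewrite mulrCA -expRD mulrC ler_pM2r// ler_expR; lra.
Qed.

(** The half-plane estimate degenerates at the real line, so it is used at heights 1 and -1, for [f]
    and its reflection, and the strip between them is filled by [strip_bound]. *)
Lemma Ep_bounded f p : 0 < p -> p <= 1 -> Ep_space p f ->
  exists2 B, 0 < B & forall x, nc (f x%:C) <= B.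
Proof.
move=> p0 p1 Ef; have [J HJ] := Ep_space_mass p0 p1 Ef; case: Ef => ef tf _.
have HB g : entire g -> exponential_type pi g -> boundary_mass_le g p J ->
    forall x, nc (g (x +i* 1)) `^ p <= expR (p * pi) * (expR 1 * (2 * `|J| + 1)).
  move=> eg tg Jg x; have := half_plane_estimate eg tg p0 p1 Jg x ltr01.
  rewrite expRN mulr1 ler_pdivrMr ?expR_gt0// mulrC => /le_trans; apply.
  rewrite ler_wpM2l ?expR_ge0// ler_wpM2l ?expR_ge0// divr1.
  by have := ler_norm J; lra.
pose C := expR (p * pi) * (expR 1 * (2 * `|J| + 1)).
have C0 : 0 < C by rewrite !mulr_gt0 ?expR_gt0//; have := normr_ge0 J; lra.
have [B B0 BC] := powR_small p0 C0.
have le_of u : u `^ p <= C -> 0 <= u -> u <= B.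
  rewrite -BC => h u0; rewrite leNgt; apply/negP => Bu.
  by have := gt0_ltr_powR p0; rewrite /= => /(_ B u); rewrite !nnegrE u0 (ltW B0) => /(_ isT isT Bu); rewrite ltNge h.
exists (expR 2 * B); first by rewrite mulr_gt0 ?expR_gt0.
apply: strip_bound => // x; apply: le_of; rewrite ?nc_ge0//; first exact: HB.
have := HB _ (entire_reflect ef) (exponential_type_reflect tf) (boundary_mass_reflect HJ) x.
by rewrite /reflect nc_conj /=.
Qed.

(** If [|f| <= B] on the line, then [|f| <= B^(1-p) |f|^p] there, which bounds the mass for exponent
    1. *)
Lemma Ep_sub_E1 p : 0 < p -> p <= 1 -> @Ep_space R p `<=` Ep_space 1.
Proof.
move=> p0 p1 f Ef; have [B B0 HB] := Ep_bounded p0 p1 Ef.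
have [J HJ] := Ep_space_mass p0 p1 Ef; case: (Ef) => ef tf _.
split => //; apply: (@le_lt_trans _ _ ((B `^ (1 - p) * J) `^ 1^-1)%:E); last exact: ltry.
apply: norm_le_of_mass => // a b ab.
have D (t : R) : is_derive t 1 (B `^ (1 - p) \*: prim (fun x => nc (f x%:C) `^ p)) (B `^ (1 - p) * nc (f t%:C) `^ p).
  have := primP (powR_nc_cont ef p0 p1) t => h; exact: is_deriveZ.
apply: le_trans (derive_le ab (primP (powR_nc_cont ef ltr01 (lexx 1))) D _) _.
  move=> x _; rewrite powRr1 ?nc_ge0//.
  have [->|n0] := eqVneq (nc (f x%:C)) 0; first by rewrite mulr_ge0 ?powR_ge0.
  rewrite -{1}[nc (f x%:C)]powRr1 ?nc_ge0// -{1}(subrK p 1) powRD; last by rewrite n0 implybT.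
  by rewrite ler_wpM2r ?powR_ge0// powR_le ?nc_ge0// subr_ge0.
by rewrite /GRing.scale /= -mulrBr ler_wpM2l ?powR_ge0//; exact: HJ.
Qed.

End BoundedOnLine.

(** * Point evaluation on the envelope *)

Section Envelope.
Variable R : realType.
Implicit Types (f g : R[i] -> R[i]) (p y t : R).

(** The half-plane estimate with [J = 1], solved for [|f(i y)|]. *)
Definition eval_bound p y : R := (expR 1 * (2 / y)) `^ p^-1 * expR (pi * y).

Lemma Ep_ball_eval f p y : 0 < p -> p <= 1 -> 0 < y -> Ep_space p f ->
  (Ep_norm p f <= 1)%E -> nc (f (0 +i* y)) <= eval_bound p y.
Proof.
move=> p0 p1 y0 [ef tf _] N1.
have HJ := mass_le_of_norm ef p0 p1 ler01 N1.
have := half_plane_estimate ef tf p0 p1 HJ 0 y0.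
rewrite powR1 mulr1 -mulrN -powR_expR -powRM ?nc_ge0 ?expR_ge0// => h.
rewrite /eval_bound -ler_pdivrMr ?expR_gt0// -expRN.
have E (u : R) : 0 <= u -> u = (u `^ p) `^ p^-1.
  by move=> u0; rewrite -powRrM divff ?gt_eqF// powRr1.
rewrite [leLHS]E ?mulr_ge0 ?nc_ge0 ?expR_ge0//.
by apply: (@powR_le _ _ _ _ (powR_ge0 _ _) h); rewrite invr_ge0 ltW.
Qed.

Lemma convex_hull_eval p y f : 0 < p -> p <= 1 -> 0 < y ->
  convex_hull [set g | Ep_space p g /\ (Ep_norm p g <= 1)%E] f ->
  nc (f (0 +i* y)) <= eval_bound p y.
Proof.
move=> p0 p1 y0.
rewrite /convex_hull /smallest.
move=> /(_ [set g | nc (g (0 +i* y)) <= eval_bound p y]); apply; split; last by move=> g [Eg Ng]; exact: Ep_ball_eval.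
move=> g h l; rewrite !inE => /= Hg Hh.
have [r [r0 r1 lr]] : exists r : R, [/\ 0 <= r, r <= 1 & l%:num = r%:C].
  have l0 : 0 <= l%:num :> R[i] by exact: ge0.
  have l1 : l%:num <= 1 :> R[i] by exact: le1.
  move: l0 l1; case: (l%:num) => a b; rewrite !lecE => /andP[/eqP b0 a0] /andP[_ a1].
  by exists a; split => //; move: b0 => /= ->.
suff : nc (l%:num * g (0 +i* y) + (1 - l%:num) * h (0 +i* y)) <= eval_bound p y by [].
rewrite lr.
apply: (le_trans (ncD _ _)); have -> : 1 - r%:C = (1 - r)%:C by rewrite rmorphB rmorph1.
rewrite !ncM !ncR !ger0_norm ?subr_ge0//.
have r1' : 0 <= 1 - r by rewrite subr_ge0.
have := ler_wpM2l r0 Hg; have := ler_wpM2l r1' Hh.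
move: (nc (g _)) (nc (h _)) (eval_bound p y) => u v w; lra.
Qed.

(** The strict inequality provides a dilate of the hull, of ratio [s < t], that contains [f]; the
    infimum itself may fail to be attained. *)
Lemma Epc_eval f p y t : 0 < p -> p <= 1 -> 0 < y -> (Epc_norm p f < t%:E)%E ->
  nc (f (0 +i* y)) <= t * eval_bound p y.
Proof.
move=> p0 p1 y0 /ereal_inf_lt[_ [s [s0 [a Ha <-]] <-]]; rewrite lte_fin => st.
have -> : (s%:C *: a) (0 +i* y) = s%:C * a (0 +i* y) by [].
rewrite ncM ncR gtr0_norm//.
apply: ler_pM; rewrite ?nc_ge0 ?(ltW s0) ?(ltW st)//; exact: convex_hull_eval.
Qed.

Lemma Ep_space0 p : 0 < p -> Ep_space p (0 : R[i] -> R[i]) /\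
  Ep_norm p (0 : R[i] -> R[i]) = 0%E.
Proof.
move=> p0; have N0 : Ep_norm p (0 : R[i] -> R[i]) = 0%E.
  rewrite /Ep_norm (_ : (fun x : R => _) = cst 0%E); first by rewrite Lnorm0// gt_eqF.
  by apply/funext => x; rewrite /= expr0n /= addr0 sqrtr0.
split => //; split; last by rewrite N0.
- exact: (@entire_cst R 0).
- move=> e e0; exists 1 => // z; rewrite -[X in nc X]/(0 : R[i]) nc0 mul1r; exact: expR_ge0.
Qed.

Lemma Epc_norm0 p t : 0 < p -> 0 < t -> (Epc_norm p (0%R : R[i] -> R[i]) < t%:E)%E.
Proof.
move=> p0 t0; apply: (@le_lt_trans _ _ (t / 2)%:E); last by rewrite lte_fin; lra.
apply: ereal_inf_lbound; exists (t / 2) => //; split; first by lra.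
exists 0; last by rewrite scaler0.
by move=> A [_]; apply; have [E0 N0] := Ep_space0 p0; split; rewrite ?N0.
Qed.

Lemma Ep_sub_Epc p : 0 < p -> @Ep_space R p `<=` Epc_space p.
Proof.
move=> p0 f Ef; split; first by case: Ef.
exists (fun=> f); split => //.
- by move=> e e0; exists 0%N => m n _ _; rewrite subrr; exact: Epc_norm0.
- exact: (@cvg_cst {family compact, R[i]^o -> R[i]^o} f nat \oo _).
Qed.

(* A Cauchy sequence is bounded, so that evaluation at [i y] stays [O(y^(-1/p) exp (pi y))]
   on the completion. *)
Lemma Epc_space_eval f p : 0 < p -> p <= 1 -> Epc_space p f ->
  exists C : R, forall y, 1 <= y -> nc (f (0 +i* y)) <= C * (expR (pi * y) * y `^ (- p^-1)).
Proof.
move=> p0 p1 [ef [u [Eu Cu uf]]].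
have [n0 Hn] := Cu 1 ltr01.
have [J HJ] := Ep_space_mass p0 p1 (Eu n0).
case: (Eu n0) => eu tu _.
have JJ := normr_ge0 J.
(* [2 |J| + 2] dominates both [2 |J|], which comes from [u n0], and 2, which comes from the
   differences [u n - u n0] of envelope norm below 1. *)
pose W : R := (expR 1 * (2 * `|J| + 2)) `^ p^-1.
have pV : 0 <= p^-1 by rewrite invr_ge0 ltW.
have E (v : R) : 0 <= v -> v = (v `^ p) `^ p^-1.
  by move=> v0; rewrite -powRrM divff ?gt_eqF// powRr1.
have K y (v : R) : 1 <= y -> 0 <= v -> v <= 2 * `|J| + 2 ->
    (expR 1 * (v / y)) `^ p^-1 * expR (pi * y) <= W * (expR (pi * y) * y `^ (- p^-1)).
  move=> y1 v0 vJ; have y0 : 0 < y by lra.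
  have iy : 0 <= y^-1 by rewrite invr_ge0 ltW.
  rewrite (mulrA (expR 1)) powRM ?mulr_ge0 ?expR_ge0//.
  have -> : y^-1 `^ p^-1 = y `^ (- p^-1).
    by rewrite -(powR_inv1 (ltW y0)) -powRrM mulN1r.
  rewrite -mulrA (mulrC (y `^ _)) ler_wpM2r ?mulr_ge0 ?expR_ge0 ?powR_ge0//.
  by apply: powR_le => //; rewrite ?mulr_ge0 ?expR_ge0// ler_wpM2l ?expR_ge0.
exists (W + W) => y y1; have y0 : 0 < y by lra.
have B1 : nc (u n0 (0 +i* y)) <= W * (expR (pi * y) * y `^ (- p^-1)).
  apply: le_trans (K y (2 * `|J|) y1 _ _); [|by rewrite mulr_ge0|lra].
  have := half_plane_estimate eu tu p0 p1 HJ 0 y0.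
  rewrite -mulrN -(powR_expR (- (pi * y))) -powRM ?nc_ge0 ?expR_ge0// => h.
  rewrite -ler_pdivrMr ?expR_gt0// -expRN [leLHS]E ?mulr_ge0 ?nc_ge0 ?expR_ge0//.
  apply: powR_le => //; first exact: powR_ge0.
  apply: (le_trans h); rewrite ler_wpM2l ?expR_ge0// ler_wpM2r ?invr_ge0 ?(ltW y0)//.
  by rewrite ler_wpM2l// ler_norm.
have B2 n : (n0 <= n)%N -> nc (u n (0 +i* y) - u n0 (0 +i* y)) <= W * (expR (pi * y) * y `^ (- p^-1)).
  move=> nn; apply: le_trans (K y 2 y1 _ _) => //; last lra.
  by have := Epc_eval p0 p1 y0 (Hn _ _ nn (leqnn n0)); rewrite mul1r.
have cu : u ^~ (0 +i* y) @ \oo --> (f (0 +i* y) : R[i]^o).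
  have /pointwise_cvg_compact_family : {family compact, u @ \oo --> (f : R[i]^o -> R[i]^o)} by [].
  by move=> /pointwise_cvgP /(_ (0 +i* y)).
apply/ler_addgt0Pl => e e0.
move/cvgrPdist_lt : cu => /(_ e%:C); rewrite ltcR => /(_ e0) [N _ HN].
have := HN (maxn N n0) (leq_maxl _ _); rewrite /= ltcR => h.
have := B2 (maxn N n0) (leq_maxr _ _).
set v := u (maxn N n0) _ in h *.
have -> : f (0 +i* y) = (f (0 +i* y) - v) + (v - u n0 (0 +i* y)) + u n0 (0 +i* y) by ring.
move=> h2; apply: (le_trans (ncD _ _)); apply: (le_trans (lerD (ncD _ _) (lexx _))).
have h' : nc (f (0 +i* y) - v) <= e by exact: ltW.
by apply: (le_trans (lerD (lerD h' h2) B1)); rewrite mulrDl; clear; lra.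
Qed.

End Envelope.
(** * Functions separating the norms *)

Section ParameterIntegrals.
Variable R : realType.
Implicit Types (g d : R[i] -> R[i]) (a : R -> R) (G H k l : R -> R[i]) (w h u : R[i]) (r e t s x y : R).

Definition path_deriv G k := forall t,
  is_derive t 1 (@complex.Re R \o G) (complex.Re (k t)) /\
  is_derive t 1 (@complex.Im R \o G) (complex.Im (k t)).

Lemma path_deriv_cint k : ccont k -> path_deriv (cint k 0) k.
Proof.
move=> [cr ci] t; split.
- have h := primP cr t.
  have -> : @complex.Re R \o cint k 0 = prim (@complex.Re R \o k) - cst (prim (@complex.Re R \o k) 0) by [].
  by rewrite -[complex.Re _]subr0; exact: is_deriveB.
- have h := primP ci t.
  have -> : @complex.Im R \o cint k 0 = prim (@complex.Im R \o k) - cst (prim (@complex.Im R \o k) 0) by [].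
  by rewrite -[complex.Im _]subr0; exact: is_deriveB.
Qed.

Lemma path_derivB G H k l : path_deriv G k -> path_deriv H l ->
  path_deriv (fun t => G t - H t) (fun t => k t - l t).
Proof.
move=> Gk Hl t; have [g1 g2] := Gk t; have [h1 h2] := Hl t; split.
- have -> : @complex.Re R \o (fun t => G t - H t) = (@complex.Re R \o G) - (@complex.Re R \o H).
    by apply/funext => s; rewrite /= ReD ReN.
  by rewrite ReD ReN; exact: is_deriveB.
- have -> : @complex.Im R \o (fun t => G t - H t) = (@complex.Im R \o G) - (@complex.Im R \o H).
    by apply/funext => s; rewrite /= ImD ImN.
  by rewrite ImD ImN; exact: is_deriveB.
Qed.

Lemma path_derivMr G k w : path_deriv G k -> path_deriv (fun t => G t * w) (fun t => k t * w).
Proof.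
move=> Gk t; have [g1 g2] := Gk t; split.
- have -> : @complex.Re R \o (fun t => G t * w) =
    (complex.Re w \*: (@complex.Re R \o G)) - (complex.Im w \*: (@complex.Im R \o G)).
    by apply/funext => s /=; rewrite ReM mulrC [X in _ - X]mulrC.
  apply: is_derive_eq (is_deriveB (is_deriveZ (complex.Re w) g1) (is_deriveZ (complex.Im w) g2)) _.
  by rewrite ReM mulrC [X in _ = _ - X]mulrC.
- have -> : @complex.Im R \o (fun t => G t * w) =
    (complex.Im w \*: (@complex.Re R \o G)) + (complex.Re w \*: (@complex.Im R \o G)).
    by apply/funext => s /=; rewrite ImM mulrC [X in _ + X]mulrC.
  apply: is_derive_eq (is_deriveD (is_deriveZ (complex.Im w) g1) (is_deriveZ (complex.Re w) g2)) _.
  by rewrite ImM mulrC [X in _ = _ + X]mulrC.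
Qed.

Lemma path_deriv_cexp w : path_deriv (fun t => cexp (w * t%:C)) (fun t => w * cexp (w * t%:C)).
Proof. by move=> t; split; [exact: cexp_line_Re|exact: cexp_line_Im]. Qed.

Lemma path_mvt G k e : path_deriv G k -> (forall t, 0 <= t <= 1 -> nc (k t) <= e) ->
  nc (G 1 - G 0) <= 2 * e.
Proof.
move=> Gk He.
have d0 t : is_derive t 1 (@complex.Re R \o (cst 0 : R -> R[i])) (complex.Re (0 : R[i])).
  exact: is_derive_cst.
have d0' t : is_derive t 1 (@complex.Im R \o (cst 0 : R -> R[i])) (complex.Im (0 : R[i])).
  exact: is_derive_cst.
have := @complex_mvt R G (cst 0) k (fun=> 0) 0 1 e ler01 (fun t => (Gk t).1) (fun t => (Gk t).2) d0 d0'.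
by rewrite /cst subrr !subr0 mulr1; apply => t tI; rewrite subr0; exact: He.
Qed.

Lemma nc_cint k e : ccont k -> (forall t, 0 <= t <= 1 -> nc (k t) <= e) -> nc (cint k 0 1) <= 2 * e.
Proof.
move=> ck He; have := path_mvt (path_deriv_cint ck) He.
have -> : cint k 0 0 = 0 by rewrite /cint !subrr.
by rewrite subr0.
Qed.

Lemma ccontMr a k : continuous a -> ccont k -> ccont (fun t => (a t)%:C * k t).
Proof.
move=> ca [cr ci]; split.
- have -> : @complex.Re R \o (fun t => (a t)%:C * k t) = a \* (@complex.Re R \o k).
    by apply/funext => t; rewrite /= ReM /= mul0r subr0.
  by move=> t; apply: continuousM; [exact: ca|exact: cr].
- have -> : @complex.Im R \o (fun t => (a t)%:C * k t) = a \* (@complex.Im R \o k).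
    by apply/funext => t; rewrite /= ImM /= mul0r addr0.
  by move=> t; apply: continuousM; [exact: ca|exact: ci].
Qed.

(* The quadratic remainder is asked uniformly on discs so that it can be integrated
   with respect to a parameter. *)
Definition quad g d := forall r, exists2 M : R, 0 <= M & forall w, nc w <= r ->
  [/\ nc (g w) <= M, nc (d w) <= M &
      forall h, nc h <= 1 -> nc (g (w + h) - g w - d w * h) <= M * nc h ^+ 2].

Lemma quad_cderiv g d w : quad g d -> cderiv g w (d w).
Proof.
move=> /(_ (nc w)) [M M0 /(_ w (lexx _))[_ _ H]] e e0.
exists (Num.min 1 (e / (M + 1))); first by rewrite lt_min ltr01 divr_gt0//; lra.
move=> h; rewrite lt_min => /andP[h1]; rewrite ltr_pdivlMr; last by lra.
move=> h2; apply: (le_trans (H h (ltW h1))).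
have n0 := nc_ge0 h; rewrite expr2 mulrA ler_wpM2r//.
by lra.
Qed.

Lemma quad_entire g d : quad g d -> entire g.
Proof. by move=> H; apply/entireP => w; exists (d w); exact: quad_cderiv. Qed.

(** Reading the quadratic remainder at [w] with [h] and at [w + h] with [- h], then adding, bounds
    [(d (w + h) - d w) * h] by a multiple of [|h|^2]. *)
Lemma quad_lip g d : quad g d -> forall w e, 0 < e -> exists2 r, 0 < r &
  forall h, nc h < r -> nc (d (w + h) - d w) <= e.
Proof.
move=> H w e e0; have [M M0 HM] := H (nc w + 1).
exists (Num.min 1 (e / (2 * M + 1))); first by rewrite lt_min ltr01 divr_gt0//; lra.
move=> h; rewrite lt_min => /andP[h1]; rewrite ltr_pdivlMr; last by lra.
move=> h2; have [->|h0] := eqVneq h 0; first by rewrite addr0 subrr nc0 ltW.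
have w1 : nc w <= nc w + 1 by lra.
have w2 : nc (w + h) <= nc w + 1 by apply: (le_trans (ncD _ _)); lra.
have [_ _ /(_ h (ltW h1)) A] := HM w w1.
have nh : nc (- h) <= 1 by rewrite ncN ltW.
have [_ _ /(_ (- h) nh) B] := HM (w + h) w2.
rewrite addrK ncN in B.
have hn : 0 < nc h by rewrite nc_gt0.
rewrite -(ler_pM2r hn) -ncM.
rewrite (_ : (d (w + h) - d w) * h = (g (w + h) - g w - d w * h) + (g w - g (w + h) - d (w + h) * - h)); last by ring.
apply: (le_trans (ncD _ _)); apply: (le_trans (lerD A B)).
rewrite -mulrDl expr2 mulrA ler_wpM2r ?(ltW hn)//.
by have := nc_ge0 h; lra.
Qed.

Lemma quad_cexp : quad (@cexp R) (@cexp R).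
Proof.
move=> r; exists (expR r * (4 * expR 1)); first by rewrite !mulr_ge0 ?expR_ge0.
have e1 : 1 <= 4 * expR 1 :> R.
  by have : (1 : R) <= expR 1 by [rewrite -[leLHS]expR0 ler_expR]; lra.
move=> w wr; have ew : nc (cexp w) <= expR r.
  by rewrite nc_cexp ler_expR (le_trans (Re_le_ncW w)).
have eM : nc (cexp w) <= expR r * (4 * expR 1).
  by rewrite (le_trans ew)// ler_peMr ?expR_ge0.
split=> // h h1; rewrite cexpD (_ : _ - _ = cexp w * (cexp h - 1 - h)); last by ring.
rewrite ncM; apply: (@le_trans _ _ (expR r * (4 * nc h ^+ 2 * expR (nc h)))).
  by apply: ler_pM; rewrite ?nc_ge0//; exact: cexp_sub1_sub.
have E1 : expR (nc h) <= expR 1 by rewrite ler_expR.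
by have := ler_wpM2l (mulr_ge0 (expR_ge0 r) (sqr_ge0 (nc h))) E1; clear; lra.
Qed.

Lemma quad_mul g d g1 d1 : quad g d -> quad g1 d1 ->
  quad (fun w => g w * g1 w) (fun w => d w * g1 w + g w * d1 w).
Proof.
move=> Hg Hg1 r; have [M M0 HM] := Hg r; have [N N0 HN] := Hg1 r.
pose K := M * N.
have K0 : 0 <= K by rewrite mulr_ge0.
exists (7 * K) => [|w wr]; first by rewrite mulr_ge0.
have [gM dM rM] := HM w wr; have [gN dN rN] := HN w wr.
have pK (u v : R[i]) : nc u <= M -> nc v <= N -> nc (u * v) <= K.
  by move=> uM vN; rewrite ncM; apply: ler_pM; rewrite ?nc_ge0.
split.
- by apply: (le_trans (pK _ _ gM gN)); lra.
- by apply: (le_trans (ncD _ _)); have := pK _ _ dM gN; have := pK _ _ gM dN; lra.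
move=> h h1; have n0 := nc_ge0 h; have hh : 0 <= nc h ^+ 2 by exact: sqr_ge0.
set a := g (w + h) - g w - d w * h; set b := g1 (w + h) - g1 w - d1 w * h.
have aM := rM h h1; have bN := rN h h1; rewrite -/a -/b in aM bN.
rewrite (_ : _ - _ = a * g1 w + g w * b + (d w * h + a) * (d1 w * h + b)); last by rewrite /a /b; ring.
have A1 : nc (a * g1 w) <= K * nc h ^+ 2.
  rewrite ncM (_ : K * _ = (M * nc h ^+ 2) * N); last by rewrite /K; ring.
  by apply: ler_pM; rewrite ?nc_ge0.
have A2 : nc (g w * b) <= K * nc h ^+ 2.
  by rewrite ncM -mulrA; apply: ler_pM; rewrite ?nc_ge0.
have hh1 : nc h ^+ 2 <= nc h by rewrite expr2 ler_piMl.
have X (c q : R[i]) L : 0 <= L -> nc c <= L -> nc q <= L * nc h ^+ 2 -> nc (c * h + q) <= 2 * L * nc h.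
  move=> L0 cL qL; apply: (le_trans (ncD _ _)); rewrite ncM.
  have := ler_wpM2r n0 cL; have := ler_wpM2l L0 hh1; lra.
have A3 : nc ((d w * h + a) * (d1 w * h + b)) <= 4 * (K * nc h ^+ 2).
  rewrite ncM (_ : 4 * _ = (2 * M * nc h) * (2 * N * nc h)); last by rewrite /K; ring.
  by apply: ler_pM; rewrite ?nc_ge0//; exact: X.
apply: (le_trans (ncD _ _)); apply: (le_trans (lerD (ncD _ _) (lexx _))).
have : 0 <= K * nc h ^+ 2 by rewrite mulr_ge0.
lra.
Qed.

Lemma quad_pow g d n : quad g d -> exists d1, quad (fun w => g w ^+ n) d1.
Proof.
move=> H; elim: n => [|n [d1 ih]].
  exists (fun=> 0) => r; exists 1 => // w _; split; rewrite ?expr0 ?nc1 ?nc0// => h _.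
  by rewrite !expr0 subrr mul0r subrr nc0 mul1r sqr_ge0.
eexists; have := quad_mul H ih.
have -> : (fun w => g w * g w ^+ n) = (fun w => g w ^+ n.+1) by apply/funext => w; rewrite exprS.
exact.
Qed.

Lemma quad_scale g d u : nc u <= 1 -> quad g d -> quad (fun w => g (u * w)) (fun w => u * d (u * w)).
Proof.
move=> u1 H r; have [M M0 HM] := H r; exists M => // w wr.
have uw : nc (u * w) <= r.
  by rewrite ncM (le_trans _ wr)// ler_piMl ?nc_ge0.
have [gM dM rM] := HM _ uw; split => //.
  by rewrite ncM (le_trans _ dM)// ler_piMl ?nc_ge0.
move=> h h1; have uh : nc (u * h) <= nc h by rewrite ncM ler_piMl ?nc_ge0.
have := rM (u * h) (le_trans uh h1).
rewrite mulrDr (_ : u * d (u * w) * h = d (u * w) * (u * h)); last by ring.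
move=> /le_trans; apply; apply: ler_wpM2l => //.
by rewrite lerXn2r ?nnegrE ?nc_ge0.
Qed.

(** Continuity is the hypothesis, rather than [entire], so that the lemma also applies to the
    derivative [d] of [quad g d]. *)
Lemma ccont_ray g w : (forall z e, 0 < e -> exists2 r, 0 < r & forall h, nc h < r -> nc (g (z + h) - g z) <= e) ->
  ccont (fun s => g (s%:C * w)).
Proof.
move=> Hg.
have K s e : 0 < e -> exists2 r : R, 0 < r & forall t, `|s - t| < r -> nc (g (t%:C * w) - g (s%:C * w)) < e.
  move=> e0; have [r r0 Hr] := Hg (s%:C * w) _ (divr_gt0 e0 (ltr0n _ 2)).
  have w1 : 0 < nc w + 1 by have := nc_ge0 w; lra.
  exists (r / (nc w + 1)) => [|t]; first by rewrite divr_gt0.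
  rewrite ltr_pdivlMr// => st; apply: (@le_lt_trans _ _ (e / 2)); last by lra.
  have := Hr ((t - s)%:C * w); rewrite rmorphB mulrBl subrKC; apply.
  rewrite -mulrBl -rmorphB ncM ncR distrC; apply: le_lt_trans st.
  by rewrite ler_wpM2l// lerDl.
split => s; apply/cvgrPdist_lt => e e0; have [r r0 Hr] := K s e e0;
  apply/nbhs_ballP; exists r => //= t /Hr st.
- by rewrite distrC -ReN -ReD (le_lt_trans (Re_le_nc _)).
- by rewrite distrC -ImN -ImD (le_lt_trans (Im_le_nc _)).
Qed.

Definition dilate_int a g w := cint (fun s => (a s)%:C * g (s%:C * w)) 0 1.

Lemma ccont_dilate a g d w : continuous a -> quad g d -> ccont (fun s => (a s)%:C * g (s%:C * w)).
Proof.
move=> ca qg; apply: ccontMr => //; apply: ccont_ray; apply: entire_cont.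
exact: quad_entire qg.
Qed.

(** Differentiation under the integral sign: the quadratic bound is uniform on the segment from [0]
    to [w], so it survives integration, up to the factor 2 of [path_mvt]. *)
Lemma quad_dilate_int a g d : continuous a -> (forall s, 0 <= s <= 1 -> 0 <= a s <= 1) ->
  quad g d -> exists d1, quad (dilate_int a g) d1.
Proof.
move=> ca a01 qg; exists (fun w => cint (fun s => (a s * s)%:C * d (s%:C * w)) 0 1) => r.
have [M M0 HM] := qg r; exists (2 * M) => [|w wr]; first by rewrite mulr_ge0.
have cg v := ccont_dilate v ca qg.
have cd : ccont (fun s => (a s * s)%:C * d (s%:C * w)).
  apply: (@ccontMr (fun s => a s * s)) => [s|].
    by apply: continuousM; [exact: ca|exact: cvg_id].
  by apply: ccont_ray; exact: quad_lip qg.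
have sw s v q : 0 <= s <= 1 -> nc v <= q -> nc (s%:C * v) <= q.
  move=> /andP[s0 s1] vq; rewrite ncM ncR ger0_norm// (le_trans _ vq)// ler_piMl ?nc_ge0//.
have aM (c v : R) (u : R[i]) : 0 <= c <= 1 -> nc u <= v -> nc (c%:C * u) <= v.
  by move=> /andP[c0 c1] uv; rewrite ncM ncR ger0_norm// (le_trans _ uv)// ler_piMl ?nc_ge0.
split.
- apply: nc_cint => // s s01; apply: aM; first exact: a01.
  by have [] := HM _ (sw _ _ _ s01 wr).
- apply: nc_cint => // s s01; apply: aM; last by have [] := HM _ (sw _ _ _ s01 wr).
  have := a01 s s01; case/andP: s01 => s0 s1 /andP[a0 a1].
  by rewrite mulr_ge0//= mulr_ile1.
move=> h h1.
pose G t := cint (fun s => (a s)%:C * g (s%:C * (w + h))) 0 t -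
  cint (fun s => (a s)%:C * g (s%:C * w)) 0 t - cint (fun s => (a s * s)%:C * d (s%:C * w)) 0 t * h.
(* The remainder is the value at 1 of a path in the upper limit of integration; its derivative at
   [s] is [a s] times the remainder of [g] at [s w] for the increment [s h]. *)
have Gd := path_derivB (path_derivB (path_deriv_cint (cg (w + h))) (path_deriv_cint (cg w)))
   (path_derivMr h (path_deriv_cint cd)).
have := @path_mvt _ _ (M * nc h ^+ 2) Gd.
have z0 k : cint k 0 0 = 0 by rewrite /cint !subrr.
rewrite !z0 mul0r !subr0 mulrA; apply => s s01.
rewrite (_ : _ - _ = (a s)%:C * (g (s%:C * w + s%:C * h) - g (s%:C * w) - d (s%:C * w) * (s%:C * h))); last first.
  by rewrite mulrDr rmorphM; ring.
apply: aM; first exact: a01.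
have [_ _ H] := HM _ (sw _ _ _ s01 wr).
apply: (le_trans (H _ (sw _ _ _ s01 h1))); rewrite ler_wpM2l// lerXn2r ?nnegrE ?nc_ge0//.
exact: sw.
Qed.

End ParameterIntegrals.

(** * Test functions with spectrum in [0, 1] *)

Section TestFunctions.
Variable R : realType.
Implicit Types (u w z : R[i]) (p t x y e : R) (n : nat).

(* [phi u = (exp u - 1) / u], entire across [0]. *)
Definition phi : R[i] -> R[i] := dilate_int (fun=> 1) (@cexp R).

(** With a variable upper limit [t], the left side and [cexp (u t)] have the same derivative, so
    [path_mvt] applies with [e = 0]. *)
Lemma phi_mul u : phi u * u = cexp u - 1.
Proof.
have cc := ccont_dilate u (@cst_continuous R R 1) (@quad_cexp R).
have D := path_derivB (path_derivMr u (path_deriv_cint cc)) (path_deriv_cexp u).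
have h : nc ((phi u * u - cexp (u * 1%:C)) -
    (cint (fun s => 1%:C * cexp (s%:C * u)) 0 0 * u - cexp (u * 0%:C))) <= 0.
  rewrite -[leRHS](mulr0 2); apply: (path_mvt D) => t _.
  by rewrite rmorph1 mul1r mulrC [t%:C * u]mulrC subrr nc0.
have c0 : cint (fun s => 1%:C * cexp (s%:C * u)) 0 0 = 0 by rewrite /cint !subrr.
have z0 : (0%:C : R[i]) = 0 by [].
have z1 : (1%:C : R[i]) = 1 by [].
rewrite c0 z0 z1 mul0r mulr0 mulr1 cexp0 in h.
have /eqP : nc (phi u * u - cexp u - (0 - 1)) == 0 by rewrite eq_le h nc_ge0.
move=> /Normc.eq0_normc /eqP; rewrite subr_eq0 sub0r => /eqP h'.
by rewrite -(subrK (cexp u) (phi u * u)) h' addrC.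
Qed.

Lemma phi_bound u : nc (phi u) <= 2 * Num.max 1 (expR (complex.Re u)).
Proof.
have cc := ccont_dilate u (@cst_continuous R R 1) (@quad_cexp R).
apply: nc_cint => // t /andP[t0 t1]; rewrite rmorph1 mul1r nc_cexp ReM /= mul0r subr0.
have [u0|u0] := leP 0 (complex.Re u).
  by rewrite le_max ler_expR ler_piMl// orbT.
by rewrite le_max -[leRHS]expR0 ler_expR mulr_ge0_le0// ltW.
Qed.

Lemma quad_phi : exists d, quad phi d.
Proof.
apply: quad_dilate_int (@quad_cexp R); first exact: cst_continuous.
by move=> s _; rewrite ler01 lexx.
Qed.

(** The function [G] with [N = n.+1], which is the characteristic function of the mean of [N]
    independent uniform variables on [0, 1]. The power gives decay of order [N] on the line, while
    the scaling by [1 / N] keeps the spectrum in [0, 1]. *)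
Definition bump n w : R[i] := phi ('i * (n.+1%:R^-1)%:C * w) ^+ n.+1.

Lemma quad_bump n : exists d, quad (bump n) d.
Proof.
have [d H] := quad_phi.
have h1 : nc ('i * (n.+1%:R^-1)%:C : R[i]) <= 1.
  by rewrite ncM nci mul1r ncR ger0_norm ?invr_ge0// invf_le1// ler1n.
exact: quad_pow (quad_scale h1 H).
Qed.

Lemma Re_rot n w : complex.Re ('i * (n.+1%:R^-1)%:C * w) = - complex.Im w / n.+1%:R.
Proof.
by rewrite !(ReM, ImM) /=; ring.
Qed.

Lemma bump_bound n w : nc (bump n w) <= 2 ^+ n.+1 * Num.max 1 (expR (- complex.Im w)).
Proof.
rewrite /bump ncX; have h := phi_bound ('i * (n.+1%:R^-1)%:C * w).
rewrite Re_rot in h.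
apply: (@le_trans _ _ ((2 * Num.max 1 (expR (- complex.Im w / n.+1%:R))) ^+ n.+1)).
  by rewrite lerXn2r ?nnegrE ?nc_ge0// mulr_ge0// le_max ler01.
rewrite exprMn ler_pM2l ?exprn_gt0//.
have [y0|y0] := leP 0 (- complex.Im w).
  have -> : Num.max 1 (expR (- complex.Im w / n.+1%:R)) = expR (- complex.Im w / n.+1%:R).
    by apply/max_idPr; rewrite -[leLHS]expR0 ler_expR divr_ge0.
  by rewrite -expRM_natr divfK ?pnatr_eq0// le_max lexx orbT.
have -> : Num.max 1 (expR (- complex.Im w / n.+1%:R)) = 1.
  by apply/max_idPl; rewrite -[leRHS]expR0 ler_expR pmulr_lle0 ?invr_gt0// ltW.
by rewrite expr1n le_max lexx.
Qed.

Lemma bump_line n p : 0 < p -> 2 <= n.+1%:R * p ->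
  exists2 C : R, 0 < C & forall x, nc (bump n x%:C) `^ p <= C / (1 + x ^+ 2).
Proof.
move=> p0 Np.
pose N : R := n.+1%:R.
have N0 : 0 < N by rewrite ltr0n.
(* From [m <= 2] and [m |x| <= 2 N] this gives [m / c <= 1] and [(m / c)^2 (1 + x^2) <= 1]. As
   [m / c <= 1], the exponent [N p >= 2] can be lowered to 2. *)
pose c := 2 + 2 * N.
have c0 : 0 < c by rewrite /c; lra.
exists (c `^ (N * p)); first exact: powR_gt0.
move=> x; pose m := nc (phi ('i * (N^-1)%:C * x%:C)).
have m0 : 0 <= m by exact: nc_ge0.
have x2 : 0 < 1 + x ^+ 2 by have := sqr_ge0 x; lra.
have h1 : m <= 2.
  apply: (le_trans (phi_bound _)); rewrite Re_rot /= oppr0 mul0r expR0.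
  by rewrite (_ : Num.max 1 1 = 1) ?mulr1//; apply/max_idPl.
have h2 : m * `|x| <= 2 * N.
  have := phi_mul ('i * (N^-1)%:C * x%:C) => /(congr1 (@Normc.normc R)).
  rewrite ncM -/m !ncM nci mul1r !ncR => E.
  have : nc (cexp ('i * (N^-1)%:C * x%:C) - 1) <= 2.
    by apply: (le_trans (ncB _ _)); rewrite nc1 nc_cexp Re_rot /= oppr0 mul0r expR0; lra.
  rewrite -E (gtr0_norm (_ : 0 < N^-1)) ?invr_gt0// mulrCA mulrC ler_pdivrMr//.
have h3 : (m / c) ^+ 2 * (1 + x ^+ 2) <= 1.
  rewrite exprMn exprVn mulrAC ler_pdivrMr ?exprn_gt0// mul1r.
  have -> : m ^+ 2 * (1 + x ^+ 2) = m ^+ 2 + (m * `|x|) ^+ 2.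
    by rewrite exprMn real_normK ?num_real//; ring.
  apply: (@le_trans _ _ (2 ^+ 2 + (2 * N) ^+ 2)).
    by apply: lerD; rewrite lerXn2r ?nnegrE ?mulr_ge0// ltW.
  by rewrite /c; nra.
have mc0 : 0 <= m / c by rewrite divr_ge0// ltW.
have mc1 : m / c <= 1 by rewrite ler_pdivrMr// mul1r /c; lra.
have -> : nc (bump n x%:C) `^ p = m `^ (N * p).
  by rewrite /bump ncX -/N -/m -powR_mulrn// -powRrM.
rewrite -{1}(divfK (lt0r_neq0 c0) m) powRM ?(ltW c0)// mulrC ler_wpM2l ?powR_ge0//.
rewrite -[leRHS]div1r ler_pdivlMr//; apply: le_trans h3; rewrite ler_wpM2r ?(ltW x2)//.
have [->|mn0] := eqVneq (m / c) 0.
  by rewrite powR0 ?expr0n// gt_eqF// mulr_gt0.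
rewrite -powR_mulrn//; apply: ger_powR => //.
by rewrite lt_def mn0 mc0.
Qed.

(** Here [phi] is taken at the negative real [- t], with [t = y / N], and
    [(1 - exp (- t)) / t >= exp (- t)] follows from [1 + t <= exp t]; the power [N] restores
    [exp (- y)]. *)
Lemma bump_imag n y : 0 < y -> exists2 r : R, expR (- y) <= r & bump n (0 +i* y) = r%:C.
Proof.
move=> y0; pose t := y / n.+1%:R.
have t0 : 0 < t by rewrite divr_gt0.
have uE : 'i * (n.+1%:R^-1)%:C * (0 +i* y) = (- t)%:C :> R[i].
  by apply/eqP; rewrite eq_complex /= /t; apply/andP; split; apply/eqP; ring.
have tn : (t%:C : R[i]) != 0 by apply/eqP => -[/eqP]; rewrite gt_eqF.
have pE : phi (- t)%:C = ((1 - expR (- t)) / t)%:C.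
  apply: (mulIf tn); rewrite -[RHS]rmorphM divfK ?gt_eqF//.
  have := phi_mul (- t)%:C; rewrite cexpR rmorphN mulrN => /eqP.
  by rewrite eqr_oppLR => /eqP ->; rewrite opprB rmorphB rmorph1.
exists (((1 - expR (- t)) / t) ^+ n.+1); last by rewrite /bump uE pE rmorphXn.
have -> : expR (- y) = expR (- t) ^+ n.+1.
  by rewrite -expRM_natr /t mulNr divfK// pnatr_eq0.
have h : expR (- t) <= (1 - expR (- t)) / t.
  have h0 := ler_wpM2l (expR_ge0 (- t)) (expR_ge1Dx t).
  by rewrite -expRD addNr expR0 in h0; rewrite ler_pdivlMr//; clear -h0; lra.
rewrite lerXn2r ?nnegrE ?expR_ge0//; exact: le_trans (expR_ge0 _) h.
Qed.

End TestFunctions.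

(** * Membership and growth of the separating functions *)

Section Witnesses.
Variable R : realType.
Implicit Types (f g : R[i] -> R[i]) (u w z : R[i]) (p q s t x y e : R) (n : nat).

(** Shifts the spectrum from [0, 1] to the left end of [-pi, pi], which gives type [pi] and the
    growth [exp (pi y)] up the imaginary axis, without changing the modulus on the line. *)
Definition modulate g z := cexp ((- pi) *i * z) * g z.

Lemma nc_modulate g x y : nc (modulate g (x +i* y)) = expR (pi * y) * nc (g (x +i* y)).
Proof. by rewrite /modulate ncM nc_cexp ReM /=; congr (expR _ * _); ring. Qed.

Lemma nc_modulate_line g x : nc (modulate g x%:C) = nc (g x%:C).
Proof. by rewrite (nc_modulate g x 0) mulr0 expR0 mul1r. Qed.

Lemma entire_modulate g : entire g -> entire (modulate g).
Proof.
move=> eg.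
have e1 := @entireM R (fun=> (- pi) *i) id (@entire_cst R _) (@entire_id R).
exact: (@entireM R _ g (@entire_comp R _ (@cexp R) e1 (@entire_cexp R)) eg).
Qed.

Lemma exponential_type_modulate g (K : R) : 0 < K ->
  (forall w, nc (g w) <= K * Num.max 1 (expR (- complex.Im w))) ->
  exponential_type pi (modulate g).
Proof.
move=> K0 HK e e0; exists K => // -[x y].
rewrite nc_modulate mulrC.
apply: (le_trans (ler_wpM2r (expR_ge0 _) (HK _))); rewrite -mulrA ler_pM2l//=.
have yn : `|y| <= nc (x +i* y) by have := Im_le_nc (x +i* y).
have P2 : 2 <= pi :> R by exact: pi_ge2.
have : expR (pi * `|y|) <= expR ((pi + e) * nc (x +i* y)).
  by rewrite ler_expR; apply: ler_pM => //; lra.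
apply: le_trans.
have [y0|y0] := leP 0 y.
  rewrite (_ : Num.max _ _ = 1) ?mul1r ?(ger0_norm y0)//.
  by apply/max_idPl; rewrite -[leRHS]expR0 ler_expR oppr_le0.
rewrite (_ : Num.max _ _ = expR (- y)); last first.
  by apply/max_idPr; rewrite -[leLHS]expR0 ler_expR oppr_ge0 ltW.
rewrite -expRD ler_expR ltr0_norm//; nra.
Qed.

(** The majorant has antiderivative [D atan (e x)], whose total variation does not depend on [e]. *)
Lemma atan_mass g p (D e : R) : entire g -> 0 < p -> p <= 1 -> 0 <= D ->
  (forall x, nc (g x%:C) `^ p <= D * (e / (1 + (e * x) ^+ 2))) ->
  boundary_mass_le g p (D * pi).
Proof.
move=> eg p0 p1 D0 Hg a b ab.
have dA t : is_derive t 1 (fun x => D * atan (e * x)) (D * (e / (1 + (e * t) ^+ 2))).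
  apply: is_derive_eq; rewrite /GRing.scale /=; ring.
apply: (le_trans (derive_le ab (primP (powR_nc_cont eg p0 p1)) dA (fun x _ => Hg x))).
rewrite -mulrBr ler_wpM2l//.
have := atan_ltpi2 (e * b); have := atan_gtNpi2 (e * a); lra.
Qed.

Definition dilated_bump n e w : R[i] := e%:C * bump n (e%:C * w).

Lemma entire_dilated_bump n e : entire (dilated_bump n e).
Proof.
have [d H] := quad_bump R n.
have e1 := @entireM R (fun=> e%:C) id (@entire_cst R _) (@entire_id R).
have e2 := @entire_comp R _ _ e1 (quad_entire H).
exact: (@entireM R (fun=> e%:C) _ (@entire_cst R _) e2).
Qed.

Lemma dilated_bump_bound n e w : 0 < e -> e <= 1 ->
  nc (dilated_bump n e w) <= 2 ^+ n.+1 * Num.max 1 (expR (- complex.Im w)).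
Proof.
move=> e0 e1; rewrite /dilated_bump ncM ncR gtr0_norm//.
apply: (@le_trans _ _ (1 * nc (bump n (e%:C * w)))).
  by rewrite ler_wpM2r ?nc_ge0.
rewrite mul1r (le_trans (bump_bound n _))// ler_pM2l ?exprn_gt0//.
rewrite ge_max le_max lexx /= ImM /= mul0r addr0.
have [y0|y0] := leP 0 (complex.Im w).
  by rewrite le_max -[X in _ <= X]expR0 ler_expR oppr_le0 mulr_ge0// ltW.
rewrite le_max ler_expR; apply/orP; right; nra.
Qed.

(** The factor [e^(p - 1)] comes from dilation. It equals 1 for [p = 1], which gives a bound in
    [E^1] uniform in [e]; for smaller [p] the lemma serves membership in [E^p]. *)
Lemma dilated_bump_mass n p : 0 < p -> p <= 1 -> 2 <= n.+1%:R * p ->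
  exists2 C : R, 0 < C & forall e, 0 < e -> e <= 1 ->
    boundary_mass_le (modulate (dilated_bump n e)) p (C * e `^ (p - 1) * pi).
Proof.
move=> p0 p1 Np; have [C C0 HC] := bump_line p0 Np.
exists C => // e e0 e1; apply: (@atan_mass _ p (C * e `^ (p - 1)) e) => //.
- by apply: entire_modulate; exact: entire_dilated_bump.
- by rewrite mulr_ge0 ?powR_ge0// ltW.
move=> x; rewrite nc_modulate_line /dilated_bump ncM ncR gtr0_norm// powRM ?nc_ge0 ?(ltW e0)//.
rewrite -rmorphM; apply: (le_trans (ler_wpM2l (powR_ge0 _ _) (HC (e * x)))).
rewrite -(mulr_powRB1 (ltW e0) p0) le_eqVlt; apply/orP; left; apply/eqP; ring.
Qed.

Lemma Ep_dilated_bump n p e : 0 < p -> p <= 1 -> 2 <= n.+1%:R * p -> 0 < e -> e <= 1 ->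
  Ep_space p (modulate (dilated_bump n e)).
Proof.
move=> p0 p1 Np e0 e1; have [C C0 HC] := dilated_bump_mass p0 p1 Np.
have em := entire_modulate (@entire_dilated_bump n e).
split => //.
- apply: (@exponential_type_modulate _ (2 ^+ n.+1)); first by rewrite exprn_gt0.
  by move=> w; exact: dilated_bump_bound.
- by apply: le_lt_trans (norm_le_of_mass em p0 p1 (HC e e0 e1)) _; rewrite ltry.
Qed.

Lemma modulate_bump_imag n e : 0 < e ->
  expR (pi / e) * (e * expR (- 1)) <= nc (modulate (dilated_bump n e) (0 +i* e^-1)).
Proof.
move=> e0; rewrite nc_modulate ler_wpM2l ?expR_ge0// /dilated_bump.
have -> : e%:C * (0 +i* e^-1) = 0 +i* 1 :> R[i].
  by apply/eqP; rewrite eq_complex /=; apply/andP; split; apply/eqP; field; rewrite gt_eqF.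
have [r Hr ->] := bump_imag n (@ltr01 R).
rewrite ncM !ncR gtr0_norm// ler_wpM2l ?(ltW e0)//.
by apply: (le_trans Hr); exact: ler_norm.
Qed.

Lemma abs_powR_cont q : 0 < q -> q <= 1 -> continuous (fun s : R => `|s| `^ q).
Proof.
move=> q0 q1 s; apply/cvgrPdist_lt => e e0.
have e2 : 0 < e / 2 by lra.
have [d d0 dp] := powR_small q0 e2.
apply/nbhs_ballP; exists d => //= t /ltW st.
have sub (u v : R) : `|u - v| <= d -> `|u| `^ q <= `|v| `^ q + e / 2.
  move=> uv; rewrite -dp; apply: le_trans (powR_subadditive _ _ q0 q1); rewrite ?(ltW d0)//.
  apply: powR_le; rewrite ?(ltW q0)//.
  by rewrite -{1}(subrKC v u) (le_trans (ler_normD _ _))// lerD2l.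
have h1 := sub _ _ st; rewrite /= distrC in st; have h2 := sub _ _ st.
by rewrite ltr_norml; lra.
Qed.

(** The absolute value makes the weight continuous on the whole line, as [ccont] demands of
    integrands. *)
Definition weight q s : R := `|s| `^ q.

Lemma weight01 q s : 0 < q -> 0 <= s <= 1 -> 0 <= weight q s <= 1.
Proof.
move=> q0 /andP[s0 s1]; rewrite /weight powR_ge0 /= ger0_norm//.
by have := powR_le s0 s1 (ltW q0); rewrite powR1.
Qed.

Definition averaged_bump n q : R[i] -> R[i] := dilate_int (weight q) (bump n).

Lemma entire_averaged_bump n q : 0 < q -> q <= 1 -> entire (averaged_bump n q).
Proof.
move=> q0 q1; have [d H] := quad_bump R n.
have [d1 H1] := quad_dilate_int (abs_powR_cont q0 q1) (fun s => @weight01 q s q0) H.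
exact: quad_entire H1.
Qed.

Lemma ccont_averaged_bump n q w : 0 < q -> q <= 1 ->
  ccont (fun s => (weight q s)%:C * bump n (s%:C * w)).
Proof.
move=> q0 q1; have [d H] := quad_bump R n.
exact: ccont_dilate (abs_powR_cont q0 q1) H.
Qed.

Lemma averaged_bump_bound n q w : 0 < q -> q <= 1 ->
  nc (averaged_bump n q w) <= 2 * 2 ^+ n.+1 * Num.max 1 (expR (- complex.Im w)).
Proof.
move=> q0 q1; rewrite -mulrA; apply: nc_cint; first exact: ccont_averaged_bump.
move=> s s01; rewrite ncM ncR; have /andP[a0 a1] := weight01 q0 s01.
case/andP: s01 => s0 s1; rewrite ger0_norm//.
apply: (@le_trans _ _ (1 * nc (bump n (s%:C * w)))).
  by rewrite ler_wpM2r ?nc_ge0.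
rewrite mul1r (le_trans (bump_bound n _))// ler_pM2l ?exprn_gt0//.
rewrite ge_max le_max lexx /= ImM /= mul0r addr0.
have [y0|y0] := leP 0 (complex.Im w).
  by rewrite le_max -[X in _ <= X]expR0 ler_expR oppr_le0 mulr_ge0.
rewrite le_max ler_expR; apply/orP; right; nra.
Qed.

(** The majorant [b] may blow up at an endpoint: its antiderivative [B] is only asked to be
    continuous there, which accommodates [s^(q/2 - 1)] near 0. *)
Lemma cint_dominated (k : R -> R[i]) (B b : R -> R) : ccont k -> continuous B ->
  (forall s, 0 < s < 1 -> is_derive s 1 B (b s)) ->
  (forall s, 0 < s < 1 -> nc (k s) <= b s) ->
  nc (cint k 0 1) <= 2 * (B 1 - B 0).
Proof.
move=> [cr ci] cB dB kb.
have K (h : R -> R) : continuous h -> (forall s, 0 < s < 1 -> `|h s| <= b s) ->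
    `|prim h 1 - prim h 0| <= B 1 - B 0.
  move=> ch hb.
  have cp : continuous (prim h) by move=> x; exact: is_derive_continuous (primP ch x).
  have h1 : (B - prim h) 0 <= (B - prim h) 1.
    have dd s : 0 < s < 1 -> is_derive s 1 (B - prim h) (b s - h s).
      by move=> s01; have := dB s s01 => ?; have := primP ch s => ?; exact: is_deriveB.
    apply: (derive_ge0_le ler01 dd).
    - by apply: continuous_subspaceT => x; apply: continuousB; [exact: cB|exact: cp].
    - by move=> s /hb; rewrite ler_norml; lra.
  have h2 : (B + prim h) 0 <= (B + prim h) 1.
    have dd s : 0 < s < 1 -> is_derive s 1 (B + prim h) (b s + h s).
      by move=> s01; have := dB s s01 => ?; have := primP ch s => ?; exact: is_deriveD.
    apply: (derive_ge0_le ler01 dd).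
    - by apply: continuous_subspaceT => x; apply: continuousD; [exact: cB|exact: cp].
    - by move=> s /hb; rewrite ler_norml; lra.
  by move: h1 h2; rewrite !fctE ler_norml; lra.
apply: (le_trans (nc_le_ReIm _)) => /=.
have h1 := K _ cr (fun s s01 => le_trans (Re_le_nc _) (kb s s01)).
have h2 := K _ ci (fun s s01 => le_trans (Im_le_nc _) (kb s s01)).
by lra.
Qed.

Lemma powR_interp t q : 0 < t -> 0 <= q -> q <= 1 -> t `^ (1 + q) <= 1 + t ^+ 2.
Proof.
move=> t0 q0 q1; have [t1|t1] := leP t 1.
  have q2 : 0 <= 1 + q by lra.
  have := powR_le (ltW t0) t1 q2; rewrite powR1.
  by have := sqr_ge0 t; lra.
have : t `^ (1 + q) <= t ^+ 2.
  by rewrite -powR_mulrn ?(ltW t0)//; apply: ler_powR; [exact: ltW|lra].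
lra.
Qed.

(** The bound [1 / (1 + t^2) <= t^(-(1 + q/2))] at [t = s |x|] leaves the integrable weight
    [s^(q/2 - 1)]. The exponent [1 + q] would leave [1 / s], hence the loss of half of [q]. *)
Lemma averaged_bump_line n q : 2 <= n.+1%:R :> R -> 0 < q -> q <= 1 ->
  exists2 D : R, 0 < D & forall x, x != 0 ->
    nc (averaged_bump n q x%:C) <= D * `|x| `^ (- (1 + q / 2)).
Proof.
move=> Np q0 q1.
have Np1 : 2 <= n.+1%:R * 1 :> R by rewrite mulr1.
have [C C0 HC] := bump_line ltr01 Np1.
exists (2 * (C * (2 / q))); first by rewrite !mulr_gt0// invr_gt0.
move=> x x0; have X0 : 0 < `|x| by rewrite normr_gt0.
pose E := `|x| `^ (- (1 + q / 2)).
have E0 : 0 < E by exact: powR_gt0.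
have q2 : 0 < q / 2 by lra.
have q21 : q / 2 <= 1 by lra.
pose B (s : R) := C * (2 / q) * E * `|s| `^ (q / 2).
have cB : continuous B.
  move=> s; apply: (@continuousM _ _ (cst (C * (2 / q) * E)) (fun s : R => `|s| `^ (q / 2))).
    exact: cst_continuous.
  exact: abs_powR_cont.
have := @cint_dominated (fun s => (weight q s)%:C * bump n (s%:C * x%:C)) B
  (fun s => C * E * s `^ (q / 2 - 1)) (@ccont_averaged_bump n q _ q0 q1) cB.
have -> : B 1 - B 0 = C * (2 / q) * E.
  by rewrite /B normr0 normr1 powR1 powR0 ?gt_eqF// !mulr0 mulr1 subr0.
rewrite (_ : 2 * (C * (2 / q) * E) = 2 * (C * (2 / q)) * E); last by ring.
apply.
- move=> s /andP[s0 s1].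
  have D : is_derive s 1 (fun s : R => C * (2 / q) * E * s `^ (q / 2)) (C * E * s `^ (q / 2 - 1)).
    apply: is_derive_eq (is_deriveZ (C * (2 / q) * E) (is_derive1_powR (q / 2) s0)) _.
    rewrite -[LHS]/(C * (2 / q) * E * (q / 2 * s `^ (q / 2 - 1))).
    by field; exact: lt0r_neq0.
  apply: near_eq_is_derive D; apply/nbhs_ballP; exists s => //= t st.
  have : `|s - t| < s by exact: st.
  by rewrite ltr_norml => st'; rewrite /B gtr0_norm//; lra.
- move=> s /andP[s0 s1]; rewrite ncM ncR -rmorphM.
  have /andP[w0 _] := @weight01 q s q0 ltac:(by rewrite !ltW).
  rewrite ger0_norm//.
  have := HC (s * x); rewrite powRr1 ?nc_ge0// => h.
  apply: (le_trans (ler_wpM2l w0 h)).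
  have t0 : 0 < s * `|x| by rewrite mulr_gt0.
  have q20 : 0 <= q / 2 by exact: ltW.
  have I := powR_interp t0 q20 q21.
  have sx2 : (s * x) ^+ 2 = (s * `|x|) ^+ 2 by rewrite !exprMn real_normK ?num_real.
  have d0 : 0 < 1 + (s * x) ^+ 2 by have := sqr_ge0 (s * x); lra.
  rewrite mulrA ler_pdivrMr// sx2.
  rewrite /weight (gtr0_norm s0).
  have -> : s `^ q = s `^ (q / 2 - 1) * s `^ (1 + q / 2).
    by rewrite -powRD ?(gt_eqF s0) ?implybT//; congr (_ `^ _); field.
  have -> : s `^ (1 + q / 2) = (s * `|x|) `^ (1 + q / 2) * E.
    rewrite powRM ?(ltW s0)// /E powRN -mulrA divff ?mulr1// gt_eqF// powR_gt0//.
  have h2 : 0 <= C * E * s `^ (q / 2 - 1).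
    by rewrite !mulr_ge0 ?powR_ge0// ltW.
  have := ler_wpM2l h2 I.
  by apply: le_trans; rewrite le_eqVlt; apply/orP; left; apply/eqP; ring.
Qed.

End Witnesses.

(** * Separation of the two spaces and of the two norms *)

Section Separation.
Variable R : realType.
Implicit Types (f g : R[i] -> R[i]) (p q s t x y e D M : R) (n : nat).

Lemma tail_prim (h : R -> R) D b X : continuous h -> 0 < b -> 0 <= D -> 1 <= X ->
  (forall x, 1 <= x -> h x <= D * x `^ (- (1 + b))) ->
  prim h X - prim h 1 <= D / b.
Proof.
move=> ch b0 D0 X1 Hh.
pose F x := (- (D / b)) * x `^ (- b).
have dF x : 0 < x -> is_derive x 1 F (D * x `^ (- (1 + b))).
  move=> x0; apply: is_derive_eq (is_deriveZ (- (D / b)) (is_derive1_powR (- b) x0)) _.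
  rewrite -[LHS]/(- (D / b) * (- b * x `^ (- b - 1))) (_ : - b - 1 = - (1 + b)); last by ring.
  by field; exact: lt0r_neq0.
have h1 : (F - prim h) 1 <= (F - prim h) X.
  have dd x : 1 < x < X -> is_derive x 1 (F - prim h) (D * x `^ (- (1 + b)) - h x).
    move=> /andP[x1 _]; have x0 : 0 < x by lra.
    by have := dF x x0 => ?; have := primP ch x => ?; exact: is_deriveB.
  apply: (derive_ge0_le X1 dd).
  - apply: continuous_in_subspaceT => x; rewrite inE /= in_itv /= => /andP[x1 _].
    have x0 : 0 < x by lra.
    apply: (@continuousB _ _ _ F (prim h)).
      exact: (is_derive_continuous (dF x x0)).
    exact: (is_derive_continuous (primP ch x)).
  - by move=> x /andP[x1 _]; rewrite subr_ge0; apply: Hh; exact: ltW.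
move: h1; rewrite !fctE /F powR1 mulr1 => h1.
have : 0 <= D / b * X `^ (- b) by rewrite mulr_ge0 ?powR_ge0// divr_ge0// ltW.
by lra.
Qed.

Lemma prim_oppr (h : R -> R) a b : continuous h -> a <= b ->
  prim (fun x => h (- x)) b - prim (fun x => h (- x)) a = prim h (- a) - prim h (- b).
Proof.
move=> ch ab.
have ch' : continuous (fun x => h (- x)).
  by move=> x; apply: (@continuous_comp _ _ _ -%R h); [exact: opp_continuous|exact: ch].
have dN x : is_derive x 1 (fun x => - prim h (- x)) (h (- x)).
  have := primP ch (- x) => ?.
  by apply: is_derive_eq; rewrite /GRing.scale /=; ring.
have := @derive_dist R _ _ _ _ a b 0 ab (primP ch') dN.
rewrite mul0r => /(_ _)/wrap[x _|]; first by rewrite subrr normr0.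
rewrite normr_le0 subr_eq0 => /eqP ->; ring.
Qed.

Lemma mass_of_decay f M D b : entire f -> 0 < b -> 0 <= D -> 0 <= M ->
  (forall x, nc (f x%:C) <= M) ->
  (forall x, 1 <= `|x| -> nc (f x%:C) <= D * `|x| `^ (- (1 + b))) ->
  boundary_mass_le f 1 (D / b + 2 * M + D / b).
Proof.
move=> ef b0 D0 M0 HM HD x y xy.
pose h x := nc (f x%:C) `^ 1.
have ch : continuous h by exact: powR_nc_cont.
rewrite -/h.
pose X := 1 + `|x| + `|y|.
have x0 := normr_ge0 x; have y0 := normr_ge0 y.
have X1 : 1 <= X by rewrite /X; lra.
have hx := ler_norm (- x); rewrite normrN in hx; have hy := ler_norm y.
have h0 t : 0 <= h t by exact: powR_ge0.
have m1 : prim h (- X) <= prim h x by apply: prim_mono => //; rewrite /X; lra.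
have m2 : prim h y <= prim h X by apply: prim_mono => //; rewrite /X; lra.
have t1 : prim h X - prim h 1 <= D / b.
  apply: tail_prim => // t tge1; rewrite /h powRr1 ?nc_ge0//.
  by have := HD t; rewrite ger0_norm; [apply|]; lra.
have t2 : prim h (- 1) - prim h (- X) <= D / b.
  rewrite -prim_oppr//; apply: tail_prim => //.
    by move=> t; apply: (@continuous_comp _ _ _ -%R h); [exact: opp_continuous|exact: ch].
  move=> t tge1; rewrite /h powRr1 ?nc_ge0//.
  by have := HD (- t); rewrite normrN ger0_norm; [apply|]; lra.
have t3 : prim h 1 - prim h (- 1) <= 2 * M.
  have d t : is_derive t 1 (fun t : R => M * t) M.
    by apply: is_derive_eq; rewrite /GRing.scale /=; ring.
  have l : (- 1 : R) <= 1 by lra.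
  apply: (le_trans (derive_le l (primP ch) d _)); last by lra.
  by move=> t _; rewrite /h powRr1 ?nc_ge0.
lra.
Qed.

Lemma averaged_bump_E1 n q : 2 <= n.+1%:R :> R -> 0 < q -> q <= 1 ->
  Ep_space 1 (modulate (averaged_bump n q)).
Proof.
move=> Np q0 q1; have eS := entire_modulate (@entire_averaged_bump R n q q0 q1).
have K0 : 0 < 2 * 2 ^+ n.+1 :> R by rewrite mulr_gt0// exprn_gt0.
have HK w := averaged_bump_bound n w q0 q1.
have [D D0 HD] := averaged_bump_line Np q0 q1.
have q2 : 0 < q / 2 by lra.
split => //; first exact: (exponential_type_modulate K0).
apply: le_lt_trans (norm_le_of_mass eS ltr01 (lexx 1) _) (ltry _).
apply: (@mass_of_decay _ (2 * 2 ^+ n.+1) D (q / 2)) => //; try exact: ltW.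
- move=> x; rewrite nc_modulate_line; apply: (le_trans (HK _)) => /=.
  by rewrite oppr0 expR0 (_ : Num.max 1 1 = 1) ?mulr1//; apply/max_idPl.
- move=> x x1; rewrite nc_modulate_line; apply: HD.
  by rewrite -normr_gt0; lra.
Qed.

Lemma averaged_bump_imag n q y : 0 < q -> q <= 1 -> 1 <= y ->
  expR (- 1) * (2 * y) `^ (- (1 + q)) <= nc (averaged_bump n q (0 +i* y)).
Proof.
move=> q0 q1 y1; have y0 : 0 < y by lra.
pose k s := (weight q s)%:C * bump n (s%:C * (0 +i* y)).
have [cr _] := @ccont_averaged_bump R n q (0 +i* y) q0 q1.
apply: le_trans (le_trans (ler_norm _) (Re_le_nc _)).
rewrite -[complex.Re _]/(prim (@complex.Re R \o k) 1 - prim (@complex.Re R \o k) 0).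
have sy s : s%:C * (0 +i* y) = 0 +i* (s * y) :> R[i].
  by apply/eqP; rewrite eq_complex /=; apply/andP; split; apply/eqP; ring.
have kE s : 0 < s -> weight q s * expR (- (s * y)) <= complex.Re (k s).
  move=> s0; rewrite /k sy; have [r Hr ->] := bump_imag n (mulr_gt0 s0 y0).
  by rewrite -rmorphM /= ler_wpM2l ?powR_ge0.
have k0 s : 0 <= s <= 1 -> 0 <= (@complex.Re R \o k) s.
  move=> /andP[s0 _]; have [->|sn0] := eqVneq s 0.
    by rewrite /= /k /weight normr0 powR0 ?gt_eqF// mul0r.
  have s0' : 0 < s by rewrite lt_def sn0.
  by apply: le_trans (kE s s0'); rewrite mulr_ge0 ?powR_ge0 ?expR_ge0.
(* Only [s] between [a] and [2 a] is kept: there the weight is at least [a^q], the exponential at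
   least [exp (- 1)] because [s y <= 1], and the length is [a]. The condition [1 <= y] puts this
   interval inside [0, 1]. *)
pose a := (2 * y)^-1.
have a0 : 0 < a by rewrite invr_gt0; lra.
have ay : a * y = 1 / 2 by rewrite /a; field; exact: lt0r_neq0.
have a2 : 2 * a <= 1 by have := ler_wpM2l (ltW a0) y1; lra.
have m1 : prim (@complex.Re R \o k) 0 <= prim (@complex.Re R \o k) a.
  by apply: prim_mono => //; [move=> s sa; apply: k0; lra|lra].
have m2 : prim (@complex.Re R \o k) (2 * a) <= prim (@complex.Re R \o k) 1.
  by apply: prim_mono => //; move=> s sa; apply: k0; lra.
have m3 : a `^ q * expR (- 1) * (2 * a) - a `^ q * expR (- 1) * a <=
    prim (@complex.Re R \o k) (2 * a) - prim (@complex.Re R \o k) a.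
  have d t : is_derive t 1 (fun t : R => a `^ q * expR (- 1) * t) (a `^ q * expR (- 1)).
    by apply: is_derive_eq; rewrite /GRing.scale /=; ring.
  apply: (derive_le _ d (primP cr)); first by lra.
  move=> s /andP[sa s2a]; have s0 : 0 < s by lra.
  apply: le_trans (kE s s0); apply: ler_pM; rewrite ?powR_ge0 ?expR_ge0//.
    by rewrite /weight (gtr0_norm s0); apply: powR_le => //; exact: ltW.
  by rewrite ler_expR; have := ler_wpM2r (ltW y0) s2a; lra.
have -> : expR (- 1) * (2 * y) `^ (- (1 + q)) = a `^ q * expR (- 1) * a.
  have -> : (2 * y) `^ (- (1 + q)) = a * a `^ q.
    have y2 : 0 <= 2 * y by lra.
    rewrite -mulN1r powRrM (powR_inv1 y2) -/a powRD ?powRr1 ?(ltW a0)//.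
    by rewrite (gt_eqF a0) implybT.
  by ring.
lra.
Qed.

Lemma powR_unbounded q D : 0 < q -> exists2 y : R, 1 <= y & D < y `^ q.
Proof.
move=> q0; have [z z0 zq] := @powR_small R (`|D| + 1) q q0 ltac:(have := normr_ge0 D; lra).
exists (1 + z); first by lra.
have h : z <= 1 + z by lra.
have := powR_le (ltW z0) h (ltW q0); rewrite zq; have := ler_norm D; lra.
Qed.

Lemma E1_neq_Epc p : 0 < p -> p < 1 -> @Epc_space R p <> Ep_space 1.
Proof.
move=> p0 p1 E.
have pV : 1 < p^-1 by rewrite -[ltLHS]invr1 ltf_pV2 ?posrE.
(* Halving makes [1 + q < 1 / p] strict, so the decay [y^(-(1 + q))] is slower than the [y^(-1/p)]
   forced on the completion. *)
pose q := Num.min 1 (p^-1 - 1) / 2.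
have m0 : 0 < Num.min 1 (p^-1 - 1) by rewrite lt_min ltr01 subr_gt0.
have [m1 m2] : Num.min 1 (p^-1 - 1) <= 1 /\ Num.min 1 (p^-1 - 1) <= p^-1 - 1.
  by rewrite !ge_min !lexx orbT.
have [q0 q1 qp] : [/\ 0 < q, q <= 1 & 0 < p^-1 - (1 + q)].
  by rewrite /q; split; lra.
(* Index 1 means [N = 2], enough decay for membership in [E^1]. *)
have ES : Epc_space p (modulate (averaged_bump 1 q)).
  by rewrite E; exact: averaged_bump_E1.
have [C HC] := Epc_space_eval p0 (ltW p1) ES.
have [y y1 Hy] := powR_unbounded (C * 2 `^ (1 + q) * expR 1) qp.
have y0 : 0 < y by lra.
have := HC y y1; rewrite nc_modulate mulrCA ler_pM2l ?expR_gt0// => h.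
have := le_trans (averaged_bump_imag 1 q0 q1 y1) h.
rewrite expRN powRN powRM ?(ltW y0)// invfM.
have Y0 : 0 < y `^ (1 + q) by exact: powR_gt0.
have T0 : 0 < 2 `^ (1 + q) :> R by exact: powR_gt0.
have e0 := expR_gt0 (1 : R).
have -> : y `^ (- p^-1) = (y `^ (1 + q))^-1 * (y `^ (p^-1 - (1 + q)))^-1.
  rewrite -invfM -powRD ?(gt_eqF y0) ?implybT// -powRN; congr (_ `^ _); ring.
move: Hy; set Z := y `^ (p^-1 - (1 + q)) => Hy.
have Z0 : 0 < Z by exact: powR_gt0.
rewrite mulrA [C * _]mulrCA mulrC ler_pM2l ?invr_gt0//.
rewrite ler_pdivlMr// mulrC -invfM ler_pdivrMr ?mulr_gt0// => h2.
by have := lt_le_trans Hy h2; rewrite mulrA mulrAC ltxx.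
Qed.

Lemma E1_Epc_not_equivalent p : 0 < p -> p < 1 ->
  ~ equivalent_norms_on (@Ep_space R p) (@Ep_norm R 1) (@Epc_norm R p).
Proof.
move=> p0 p1 [a [b [_ b0 Hab]]].
have pV : 0 < p^-1 - 1 by rewrite subr_gt0 -[ltLHS]invr1 ltf_pV2 ?posrE.
(* [N p >= 2] puts the test functions in [E^p], where the two norms are compared. *)
pose n := Num.bound (2 / p).
have Np : 2 <= n.+1%:R * p.
  rewrite -ler_pdivrMr// (le_trans (ltW (archi_boundP _)))//; last by rewrite ler_nat.
  by rewrite divr_ge0// ltW.
have Np1 : 2 <= n.+1%:R * 1 :> R.
  by apply: (le_trans Np); rewrite ler_wpM2l// ltW.
have [C C0 HC] := dilated_bump_mass ltr01 (lexx 1) Np1.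
(* [C pi] bounds the [E^1] norms uniformly in [e], so equivalence would keep all the envelope norms
   strictly below [t]. *)
pose t := b * (C * pi) + 1.
have t0 : 0 < t by have := mulr_gt0 b0 (mulr_gt0 C0 (pi_gt0 R)); rewrite /t; lra.
(* The evaluation height [y] and the dilation [e = 1 / y] are tied. The test function is at least
   [exp (pi y) exp (- 1) / y] there, against [t] times a constant times [exp (pi y) y^(-1/p)], so
   the ratio grows like [y^(1/p - 1)]. *)
have [y y1 Hy] := powR_unbounded (t * (expR 1 * 2) `^ p^-1 * expR 1) pV.
have y0 : 0 < y by lra.
pose e := y^-1.
have e0 : 0 < e by rewrite invr_gt0.
have e1 : e <= 1 by rewrite invf_le1.
have ey : e^-1 = y by rewrite /e invrK.
pose f := modulate (@dilated_bump R n e).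
have Ef : Ep_space p f by apply: Ep_dilated_bump => //; exact: ltW.
have ef : entire f by case: Ef.
have N1 : (Ep_norm 1 f <= (C * pi)%:E)%E.
  have := norm_le_of_mass ef ltr01 (lexx 1) (HC e e0 e1).
  by rewrite subrr powRr0 mulr1 invr1 powRr1// mulr_ge0 ?pi_ge0// ltW.
have Nt : (Epc_norm p f < t%:E)%E.
  apply: (le_lt_trans (proj2 (Hab f Ef))).
  apply: (@le_lt_trans _ _ (b%:E * (C * pi)%:E)%E).
    by rewrite lee_pmul2l ?lte_fin.
  by rewrite -EFinM lte_fin /t; lra.
have h1 := Epc_eval p0 (ltW p1) y0 Nt.
have h2 := modulate_bump_imag n e0.
rewrite ey -/f in h2; move: (le_trans h2 h1).
rewrite /eval_bound [leRHS]mulrA [leRHS]mulrC ler_pM2l ?expR_gt0// => h.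
have q0 : 0 < p^-1 by rewrite invr_gt0.
have Z0 : 0 < y `^ (p^-1 - 1) by exact: powR_gt0.
have E : (expR 1 * (2 / y)) `^ p^-1 = (expR 1 * 2) `^ p^-1 / (y * y `^ (p^-1 - 1)).
  rewrite mulrA powRM ?invr_ge0 ?(ltW y0) ?mulr_ge0 ?expR_ge0// mulr_powRB1 ?(ltW y0)//.
  by rewrite -(powR_inv1 (ltW y0)) -powRrM mulN1r powRN.
move: h Hy; rewrite E expRN /e; move: (y `^ _) Z0 => Z Z0.
move: (_ `^ p^-1) => W; move: (expR 1) (@expR_gt0 R 1) => X X0 h Hy.
have P : 0 <= y * Z * X by rewrite !mulr_ge0// ltW.
have := ler_wpM2r P h.
have -> : y^-1 * X^-1 * (y * Z * X) = Z by field; rewrite !lt0r_neq0.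
have -> : t * (W / (y * Z)) * (y * Z * X) = t * W * X by field; rewrite !lt0r_neq0.
by rewrite leNgt Hy.
Qed.

End Separation.
Theorem mainTheorem3 (R : realType) (p : R) (hp0 : 0 < p) (hp1 : p < 1) :
  [/\ Ep_space p `<=` Ep_space 1,
      Ep_space p `<=` Epc_space p,
      Epc_space p <> Ep_space 1 &
      ~ equivalent_norms_on (@Ep_space R p) (@Ep_norm R 1) (@Epc_norm R p)].
Proof.
split.
- exact: Ep_sub_E1 hp0 (ltW hp1).
- exact: Ep_sub_Epc.
- exact: E1_neq_Epc.
- exact: E1_Epc_not_equivalent.
Qed.
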